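(* Let $W_C(x),W_G(x)\in\mathbb C^{p\times p}[x]$ be matrix polynomials with $W_C$ monic and $\sigma(W_G(y))\cap\operatorname{supp}_y(u)=\varnothing$, and let $\hat u$ be a corresponding Geronimus--Uvarov transformation of $u$, i.e. $\hat u_{x,y}W_G(y)=W_C(x)u_{x,y}$. Then, for $r_1>r_x$ and $r_2>r_y$, the following bilinear identities hold (for all times $t,t'$ and all $k,l\in\{0,1,2,\dots\}$): $$\oint_{|z|=r_1}\hat\Psi_{1,k}(t',z)W_C(z)\big(\Psi^*_{1,l}(t,z)\big)^\top dz=\oint_{|z|=r_2}\hat\Psi_{2,k}(t',z)W_G(z)\big(\Psi^*_{2,l}(t,z)\big)^\top dz,$$ $$\oint_{|z|=r_1}e^{t_1'(z)-t_1(z)}\hat P^{[1],t'}_k(z)W_C(z)\big(C^{[2],t}_l(z)\big)^\top dz=\oint_{|z|=r_2}\hat C^{[1],t'}_k(z)W_G(z)\big(P^{[2],t}_l(z)\big)^\top e^{t_2'(z)-t_2(z)}dz,$$ and, in terms of the $\tau$-ratio matrices, $$\Big(\oint_{|z|=r_1}e^{t_1'(z)-t_1(z)}z^{l-k-1}\hat\tau^{(1)}_{k-1}(t'-[z]_1,t')W_C(z)\big(\tau^{(1)}_l(t,t+[z]_1)\big)^{-1}dz\Big)H^t_l$$ $$=\hat H^{t'}_k\Big(\oint_{|z|=r_2}z^{k-l+1}\hat\tau^{(2)}_k(t',t'-[z]_2)W_G(z)\big(\tau^{(2)}_{l-1}(t+[z]_2,t)\big)^{-1}e^{t_2'(z)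-t_2(z)}dz\Big).$$
   Context: Notation. $p\ge1$ is fixed; $I_p$ is the $p\times p$ identity. Semi-infinite matrices are written in $p\times p$ blocks indexed by $0,1,2,\dots$; $A_{[n]}$ is the truncation to the first $n$ block rows and columns. $\chi(x)=[I_p,I_px,I_px^2,\dots]^\top$. Generalized kernels. $u=u_{x,y}$ is a $p\times p$ matrix of fast decreasing distributions in the real variables $(x,y)$ (distributions $w$ such that $(1+x^2+y^2)^{k/2}w$ is a bounded distribution for all $k$). With $\operatorname{supp}_x(u),\operatorname{supp}_y(u)$ the projections of its support, $r_x=\sup\{|z|:z\in\operatorname{supp}_x(u)\}$ and $r_y=\sup\{|z|:z\in\operatorname{supp}_y(u)\}$ are assumed finite. Sesquilinear form: $\big(\langle P(x),Q(y)\rangle_u\big)_{i,j}=\sum_{k,l}\langle (u_{x,y})_{k,l},P_{i,k}(x)Q_{j,l}(y)\rangle$, for matrix functions smooth near the support. $\sigma(W)$ is the zero set of $\det W$. $\hat uW_G(y)=W_C(x)u$ means $\langle P(x),Q(y)(W_G(y))^\top\rangle_{\hat u}=\langle P(x)W_C(x),Q(y)\rangle_u$. Flows. $t=(t_1,t_2)$, $t_i=(t_{i,1},t_{i,2},\dots)$ with finitely many nonzero entries; $t_1(x)=\sum_jt_{1,j}x^j$, $t_2(y)=\sum_jt_{2,j}y^j$; $u^t_{x,y}=e^{t_1(x)-t_2(y)}u_{x,y}$ and $\hat u^t_{x,y}=e^{t_1(x)-t_2(y)}\hat u_{x,y}$. The Gram matrix $G^t$ has blocks $\langle I_px^k,I_py^l\rangle_{u^t}$.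 All kernels $u^t,\hat u^t$ considered (including Miwa shifted ones) are assumed quasidefinite, i.e. all truncations of their Gram matrices are nonsingular, so that $G^t=(S^t_1)^{-1}H^t(S^t_2)^{-\top}$ with $S_1^t,S_2^t$ lower unitriangular by blocks and $H^t=\operatorname{diag}(H^t_0,H^t_1,\dots)$. $P^{[i],t}(x)=S^t_i\chi(x)$ has blocks $P^{[i],t}_n(x)$. $C^{[1],t}_n(z)=\langle P^{[1],t}_n(x),\frac{I_p}{z-y}\rangle_{u^t}$ for $z$ outside the $y$-projection of the support, $\big(C^{[2],t}_n(z)\big)^\top=\langle\frac{I_p}{z-x},P^{[2],t}_n(y)\rangle_{u^t}$ for $z$ outside the $x$-projection. Hatted objects are the same objects for $\hat u$. Baker functions (blocks): $\Psi_{1,n}(t,z)=e^{t_1(z)}P^{[1],t}_n(z)$; $\Psi^*_{2,n}(t,z)=e^{-t_2(z)}(H^t_n)^{-\top}P^{[2],t}_n(z)$; $\big(\Psi^*_{1,n}(t,z)\big)^\top=\big\langle\frac{I_p}{z-x},e^{-t_2(y)}P^{[2],t}_n(y)\big\rangle_u(H^t_n)^{-1}$; $\Psi_{2,n}(t,z)=\big\langle e^{t_1(x)}P^{[1],t}_n(x),\frac{I_p}{z-y}\big\rangle_u$; for $\hat\Psi_{i,n}$ replace $u$ by $\hat u$ throughout. Miwa shifts. $[z]=\big(\frac1z,\frac1{2z^2},\frac1{3z^3},\dots\big)$; $t\pm[z]_1=(t_1\pm[z],t_2)$, $t\pm[z]_2=(t_1,t_2\pm[z])$; the shifted kernels are $u^{t-[z]_1}=(1-\frac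 xz)u^t$, $u^{t+[z]_1}=(1-\frac xz)^{-1}u^t$, $u^{t-[z]_2}=(1-\frac yz)^{-1}u^t$, $u^{t+[z]_2}=(1-\frac yz)u^t$, and similarly for $\hat u$. $\tau$-ratio matrices: $\tau^{(1)}_n(t,s)=A_nA_{n-1}\cdots A_0$ with $A_m=H^t_m(H^s_m)^{-1}$, and $\tau^{(2)}_n(t,s)=B_nB_{n-1}\cdots B_0$ with $B_m=(H^t_m)^{-1}H^s_m$; an empty product ($\tau^{(i)}_{-1}$) is $I_p$; $\hat\tau^{(i)}_n$ is defined in the same way from $\hat H^t_m$.
   Formalization: In the third identity the printed powers z^{l-k-1} (left) and z^{k-l+1} (right) are replaced by z^{k-l-1} and z^{l-k-1}; the printed ones fail for p=1, W_C=W_G=1, t=t'=0, k=l=0, u=dx/2 on the diagonal over [-1,1] (2πi versus 2πi/3). *)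

(* Defs.v *)
From HB Require Export structures.
From mathcomp Require Export all_boot all_order all_algebra.
From mathcomp Require Export all_classical all_reals all_analysis.
From mathcomp Require Export complex.
Set Implicit Arguments.
Unset Strict Implicit.
Unset Printing Implicit Defensive.
Import Order.TTheory GRing.Theory Num.Theory.
Import numFieldNormedType.Exports.
Local Open Scope classical_set_scope.
Local Open Scope complex_scope.
Local Open Scope ring_scope.

Section Distributions.
Variable R : realType.
Implicit Types (f phi : R * R -> R[i]) (U A : set (R * R)) (s : seq bool).

(* Iterated partial derivative along the word s: false stands for d/dx and
   true for d/dy. *)
Definition rpartial s (g : R * R -> R) : R * R -> R :=
  foldr (fun b (h : R * R -> R) a =>
    'D_(if b then (0, 1) else (1, 0) : R * R) h a) g s.

Definition partial s f (a : R * R) : R[i] :=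
  rpartial s (fun b => complex.Re (f b)) a +i*
  rpartial s (fun b => complex.Im (f b)) a.

(* C^infinity on U: all iterated partial derivatives of the real and imaginary
   parts are Frechet differentiable, hence continuous, at the points of U. *)
Definition smooth_on U f := forall s a, U a ->
  differentiable (rpartial s (fun b => complex.Re (f b))) a /\
  differentiable (rpartial s (fun b => complex.Im (f b))) a.

Definition smooth_near A f := exists U, [/\ open U, A `<=` U & smooth_on U f].

Definition fsupport f : set (R * R) := closure [set a | f a != 0].

Definition test_function phi := smooth_on setT phi /\ compact (fsupport phi).

(* Only the values on test functions are meaningful. *)
Definition functional := (R * R -> R[i]) -> R[i].
Implicit Type w : functional.

Definition is_distribution w :=
  (forall (c : R[i]) phi psi, test_function phi -> test_function psi ->
     w (fun a => c * phi a + psi a) = c * w phi + w psi) /\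
  (forall K : set (R * R), compact K -> exists (m : nat) (c : R),
     forall phi (M : R), test_function phi -> fsupport phi `<=` K ->
       (forall s a, (size s <= m)%N -> `|partial s phi a| <= M%:C) ->
       `|w phi| <= (c * M)%:C).

Definition supp w : set (R * R) :=
  [set a | forall U, open U -> U a ->
     exists phi, [/\ test_function phi, fsupport phi `<=` U & w phi != 0]].

(* <w, f> for f smooth near supp w: the value of w on any test function that
   coincides with f near supp w (0 when there is no such test function). *)
Definition pairing w f : R[i] :=
  xget 0 [set v | exists phi U, [/\ test_function phi, open U, supp w `<=` U,
                    forall a, U a -> phi a = f a & v = w phi]].

Definition dmul f w : functional := fun phi => pairing w (fun a => f a * phi a).

(* Bounded distributions in the sense of Schwartz: the dual of the space of
   smooth functions all of whose derivatives are in L^1. *)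
Definition bounded_distribution w := is_distribution w /\
  exists (m : nat) (c : R), forall phi (M : R), test_function phi ->
    (forall s, (size s <= m)%N ->
       (\int[(@lebesgue_measure R \x @lebesgue_measure R)%E]_a
          (complex.Re `|partial s phi a|)%:E <= M%:E)%E) ->
    `|w phi| <= (c * M)%:C.

Definition fast_decreasing w := is_distribution w /\
  forall k : nat, bounded_distribution
    (dmul (fun a => (Num.sqrt (1 + a.1 ^+ 2 + a.2 ^+ 2) ^+ k)%:C) w).

End Distributions.

Section Kernels.
Variables (R : realType) (p : nat).
Local Notation C := R[i].
Local Notation M := 'M[R[i]]_p.

Definition kernelM := 'M[functional R]_p.
Implicit Types u v w : kernelM.

Definition ksupp u : set (R * R) := [set a | exists i j, supp (u i j) a].
Definition supp_x u : set R := [set a.1 | a in ksupp u].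
Definition supp_y u : set R := [set a.2 | a in ksupp u].
Definition rad_x u : R := sup [set `|x| | x in supp_x u].
Definition rad_y u : R := sup [set `|y| | y in supp_y u].

Definition generalized_kernel u :=
  [/\ forall i j, fast_decreasing (u i j),
      has_ubound [set `|x| | x in supp_x u] &
      has_ubound [set `|y| | y in supp_y u]].

Definition form u (P Q : R -> M) : M :=
  \matrix_(i, j) \sum_k \sum_l pairing (u k l) (fun a => P a.1 i k * Q a.2 j l).

Definition kmul (f : R * R -> C) u : kernelM := \matrix_(i, j) dmul f (u i j).

Definition gram u (k l : nat) : M :=
  form u (fun x => (x%:C ^+ k)%:M) (fun y => (y%:C ^+ l)%:M).

(* Semi-infinite matrices in p x p blocks. *)
Definition bmatrix := nat -> nat -> M.

Definition truncation (A : bmatrix) (n : nat) : 'M[C]_(\sum_(i < n) p) :=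
  \mxblock_(i < n, j < n) A i j.

Definition quasidefinite u :=
  forall n : nat, truncation (gram u) n \in unitmx.

Definition lower_unitriangular (A : bmatrix) :=
  (forall i, A i i = 1%:M) /\ (forall i j, (i < j)%N -> A i j = 0).

(* A *m B for A lower triangular by blocks. *)
Definition lmul (A B : bmatrix) : bmatrix :=
  fun i j => \sum_(m < i.+1) A i m *m B m j.

Definition bid : bmatrix := fun i j => if i == j then 1%:M else 0.
Definition bdiag (H : nat -> M) : bmatrix := fun i j => if i == j then H i else 0.
Definition btr (A : bmatrix) : bmatrix := fun i j => (A j i)^T.

Definition is_inverse (A B : bmatrix) :=
  [/\ lower_unitriangular B, lmul A B = bid & lmul B A = bid].

(* G = S1^-1 H S2^-T. *)
Definition gauss_borel (G S1 : bmatrix) (H : nat -> M) (S2 : bmatrix) :=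
  [/\ lower_unitriangular S1, lower_unitriangular S2 &
      exists L1 L2, [/\ is_inverse S1 L1, is_inverse S2 L2 &
        G = lmul L1 (lmul (bdiag H) (btr L2))]].

(* The factors (S1, H, S2), which are unique when the kernel is
   quasidefinite. *)
Definition gb_factors u : bmatrix * (nat -> M) * bmatrix :=
  xget (bid, fun=> 1%:M, bid)
    [set F | gauss_borel (gram u) F.1.1 F.1.2 F.2].

Definition S1 u := (gb_factors u).1.1.
Definition Hblk u := (gb_factors u).1.2.
Definition S2 u := (gb_factors u).2.

(* The n-th block of S chi(z), for S lower triangular by blocks. *)
Definition chi_block (S : bmatrix) (n : nat) (z : C) : M :=
  \sum_(k < n.+1) z ^+ k *: S n k.

Definition P1 u n (z : C) : M := chi_block (S1 u) n z.
Definition P2 u n (z : C) : M := chi_block (S2 u) n z.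

Definition cauchy (z : C) (x : R) : M := ((z - x%:C)^-1)%:M.

(* Meaningful only for z outside supp_y u, respectively supp_x u. *)
Definition C1 u n (z : C) : M := form u (fun x => P1 u n x%:C) (cauchy z).
Definition C2 u n (z : C) : M := (form u (cauchy z) (fun y => P2 u n y%:C))^T.

Definition cexp (z : C) : C :=
  (expR (complex.Re z))%:C * (cos (complex.Im z) +i* sin (complex.Im z)).

(* A time t = (t_1, t_2): the finitely supported sequence t_i is stored as the
   polynomial whose coefficient of degree j is t_{i,j+1}. *)
Definition time := ({poly C} * {poly C})%type.
Implicit Type t : time.
Definition t1 t (z : C) : C := z * (t.1).[z].
Definition t2 t (z : C) : C := z * (t.2).[z].

Definition flow t u : kernelM :=
  kmul (fun a => cexp (t1 t a.1%:C - t2 t a.2%:C)) u.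

(* Miwa shifts v -> v^{-[z]_1}, v^{+[z]_1}, v^{-[z]_2}, v^{+[z]_2}. *)
Definition miwa1m (z : C) v : kernelM := kmul (fun a => 1 - a.1%:C / z) v.
Definition miwa1p (z : C) v : kernelM := kmul (fun a => (1 - a.1%:C / z)^-1) v.
Definition miwa2m (z : C) v : kernelM := kmul (fun a => (1 - a.2%:C / z)^-1) v.
Definition miwa2p (z : C) v : kernelM := kmul (fun a => 1 - a.2%:C / z) v.

(* Psi1s and Psi2s are the adjoint functions Psi_1^* and Psi_2^*; all four
   are built from the kernel u and the Gauss-Borel factors of flow t u. *)
Definition Psi1 u n t (z : C) : M := cexp (t1 t z) *: P1 (flow t u) n z.
Definition Psi2s u n t (z : C) : M :=
  cexp (- t2 t z) *: ((invmx (Hblk (flow t u) n))^T *m P2 (flow t u) n z).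
Definition Psi1s u n t (z : C) : M :=
  (form u (cauchy z) (fun y => cexp (- t2 t y%:C) *: P2 (flow t u) n y%:C)
     *m invmx (Hblk (flow t u) n))^T.
Definition Psi2 u n t (z : C) : M :=
  form u (fun x => cexp (t1 t x%:C) *: P1 (flow t u) n x%:C) (cauchy z).

(* The index counts the factors: tau1 n v w and tau2 n v w are the tau-ratio
   matrices of index n - 1, so that tau1 0 and tau2 0 are the empty products. *)
Fixpoint tau1 (n : nat) v w : M :=
  if n is m.+1 then (Hblk v m *m invmx (Hblk w m)) *m tau1 m v w else 1%:M.
Fixpoint tau2 (n : nat) v w : M :=
  if n is m.+1 then (invmx (Hblk v m) *m Hblk w m) *m tau2 m v w else 1%:M.

Definition circle_point (r theta : R) : C := r * cos theta +i* (r * sin theta).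

(* The contour integral over |z| = r, counterclockwise: dz = i z dtheta.  The
   value of f at finitely many points of the circle is irrelevant. *)
Definition circint (r : R) (f : C -> M) : M :=
  \matrix_(i, j)
    let g theta :=
      let z := circle_point r theta in (0 +i* 1) * z * f z i j in
    (\int[@lebesgue_measure R]_(theta in `[0, 2 * pi]) complex.Re (g theta)) +i*
    (\int[@lebesgue_measure R]_(theta in `[0, 2 * pi]) complex.Im (g theta)).

End Kernels.

Section Transformation.
Variables (R : realType) (p : nat).
Local Notation M := 'M[R[i]]_p.+1.

Definition meval (W : {poly M}) (z : R[i]) : M := W.[z%:M].

Definition sigma (W : {poly M}) : set R[i] := [set z | \det (meval W z) = 0].

(* uh W_G(y) = W_C(x) u. *)
Definition geronimus_uvarov (u uh : kernelM R p.+1) (WC WG : {poly M}) :=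
  forall P Q : R -> M,
    (forall i j, smooth_near (ksupp u `|` ksupp uh) (fun a => P a.1 i j)) ->
    (forall i j, smooth_near (ksupp u `|` ksupp uh) (fun a => Q a.2 i j)) ->
    form uh P (fun y => Q y *m (meval WG y%:C)^T) =
    form u (fun x => P x *m meval WC x%:C) Q.

End Transformation.

(* Main.v *)
Require Import Defs.
From mathcomp Require finmap.
From mathcomp Require Import measurable_realfun ring lra.
Set Implicit Arguments.
Unset Strict Implicit.
Unset Printing Implicit Defensive.
Import Order.TTheory GRing.Theory Num.Theory.
Import numFieldNormedType.Exports.
Local Open Scope classical_set_scope.
Local Open Scope complex_scope.
Local Open Scope ring_scope.

(** Both sides of the identities for the Baker functions, and of those for the
orthogonal polynomials, are Cauchy integrals with the same value, namely 2 pi i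
times the form < e^(t'_1(x)) P_k(x) W_C(x), e^(-t_2(y)) Q_l(y) >_u, where P_k is
the first polynomial of the transformed kernel at time t' and Q_l the second
polynomial of u at time t ([bilinear_value]); for the Baker functions there is a
further right factor, the inverse of H_l.

On the circle |z| = r1 the integrand is an entire function of z times a form
that contains 1/(z - x). As r1 exceeds r_x, Cauchy's formula applies inside the
distribution and replaces z by x ([contour_form_x]). On the circle |z| = r2 the
form is that of the transformed kernel, whose support may also contain zeros of
W_G, at any distance from the origin. The matrix W_G(z) of the integrand cures
this: W_G(z) - W_G(y) is divisible by z - y, so that W_G(z) may be replaced by
W_G(y) up to a polynomial in z, which contributes 0, and W_G(y) turns the
transformed kernel into W_C(x) u ([contour_form_geronimus_uvarov]).

Cauchy's formula inside a pairing ([pairing_cauchy]) comes from series. A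
distribution with compact support is continuous for some C^m seminorm on a
neighbourhood of its support ([pairing_continuous]). For this seminorm the
geometric series of 1/(z - c) converges uniformly on the circle
([pairing_cauchy_rate]) and so does the exponential series
([pairing_exp_tail]); what remains are the contour integrals of the powers of z
([has_circint_monomial]) and the passage to uniform limits
([has_circint_limit]). The two real points of a circle form a null set. At all
other points z, the functions 1/(z - x) and 1/(z - y) are smooth on the whole
plane, hence pairings are only ever taken with functions smooth on the whole
plane. That a pairing depends only on the function near the support is
[null_off_supp], an argument with finitely many cutoffs.

The identity between ratio matrices is the one between orthogonal polynomials
and Cauchy transforms, rewritten. A Miwa shift multiplies the kernel by 1 - x/z
or by its inverse, so that a three-term relation connects the orthogonal
polynomials of both kernels ([three_term]). Its value at x = z expresses the
polynomials at z by ratios of pivots ([shift_polynomial]); its value under the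
form with a second polynomial does the same for the Cauchy transforms
([shift_cauchy]). The statements for the other variable follow by transposing
the Gram matrix. All this needs the block factorization of a Gram matrix with
nonsingular truncations ([gauss_borel_exists]). *)

(** * Flat functions and partial derivatives *)

Section FlatFunction.
Variable R : realType.

(** The derivatives of the flat function exp(-1/x) are combinations of these. *)
Definition psi (n : nat) (x : R) : R :=
  if 0 < x then x ^- n * expR (- x^-1) else 0.

(** Since exp(1/x) dominates every power of 1/x, this gives more than enough
flatness for a derivative at 0. *)
Lemma psi_bound n : exists2 C : R, 0 < C & forall x, `|psi n x| <= C * x ^+ 2.
Proof.
exists (n.+2)`!%:R; first by rewrite ltr0n fact_gt0.
move=> x; rewrite /psi; case: ifPn => x0; last first.
  by rewrite normr0 mulr_ge0// ?ler0n// sqr_ge0.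
have f0 : (0 : R) < (n.+2)`!%:R by rewrite ltr0n fact_gt0.
rewrite ger0_norm; last by rewrite mulr_ge0 ?expR_ge0// invr_ge0 exprn_ge0// ltW.
have xi : 0 < x^-1 by rewrite invr_gt0.
have H := expR_ge1Dxn n.+1 (ltW xi).
have {}H : x^-1 ^+ n.+2 / (n.+2)`!%:R <= expR x^-1.
  by apply: le_trans H; rewrite lerDr.
rewrite expRN; have E0 := expR_gt0 x^-1.
have xn : 0 < x ^+ n by rewrite exprn_gt0.
have -> : (n.+2)`!%:R * x ^+ 2 = x ^- n * (x^-1 ^+ n.+2 / (n.+2)`!%:R)^-1.
  rewrite -addn2 exprVn exprD !invfM !invrK.
  field; rewrite ?gt_eqF//.
rewrite ler_pM2l ?invr_gt0// lef_pV2 ?posrE//.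
by rewrite divr_gt0// exprn_gt0.
Qed.

Lemma is_derive_psi n (x : R) :
  is_derive x 1 (psi n) (psi n.+2 x - n%:R * psi n.+1 x).
Proof.
have [x0|x0|->] := ltgtP x 0.
- apply: (@near_eq_is_derive _ _ _ (cst 0)).
    near=> y; rewrite /psi ifF//; apply/negbTE; rewrite -leNgt ltW//.
    by near: y; exact: lt_nbhsl.
  rewrite /psi !ltNge (ltW x0)/= mulr0 subr0; exact: is_derive_cst.
- apply: (@near_eq_is_derive _ _ _ (fun y : R => y ^- n * expR (- y^-1))).
    near=> y; rewrite /psi ifT//.
    by near: y; exact: lt_nbhsr.
  have xn0 : x != 0 by rewrite gt_eqF.
  have dV : is_derive x 1 (fun y : R => y^-1) (- x ^- 2).
    split; first exact: (derivableV xn0).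
    by rewrite (@deriveV _ _ id)// derive_id scaler1.
  have dVn : is_derive x 1 (fun y : R => y ^- n) (- (n%:R * x ^- n.+1)).
    case: n => [|n].
      rewrite mul0r oppr0 (_ : (fun y : R => y ^- 0) = cst 1).
        exact: is_derive_cst.
      by apply/funext => y; rewrite expr0 invr1.
    have -> : (fun y : R => y ^- n.+1) = (fun y : R => y^-1) ^+ n.+1.
      by apply/funext => y; rewrite exprfctE exprVn.
    apply: is_derive_eq.
    rewrite -!exprVn /GRing.scale/= mulrN -mulrA -exprD.
    by rewrite addn2.
  have dE : is_derive x 1 (fun y : R => expR (- y^-1)) (expR (- x^-1) * x ^- 2).
    have dN : is_derive x 1 (fun y : R => - y^-1) (- (- x ^- 2)) by exact: is_deriveN.
    rewrite opprK in dN.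
    exact: (is_derive1_comp (f := expR)).
  have dM := @is_deriveM _ _ _ _ _ _ _ _ dVn dE.
  apply: is_derive_eq.
  rewrite /GRing.scale/= /psi x0 -!exprVn exprSr !exprS; ring.
- have [C C0 HC] := psi_bound n.
  have p0 : forall k, psi k 0 = 0 by move=> k; rewrite /psi ltxx.
  rewrite !p0 mulr0 subr0.
  have H : (h^-1 *: (psi n (h *: 1 + 0) - psi n 0)) @[h --> 0^'] --> (0 : R).
    apply/cvgr0Pnorm_lt => e e0; near=> h.
    have hn0 : h != 0 by near: h; exact: nbhs_dnbhs_neq.
    rewrite p0 subr0 addr0 /GRing.scale/= mulr1 normrM normfV.
    apply: (@le_lt_trans _ _ (C * `|h|)).
      apply: (@le_trans _ _ (`|h|^-1 * (C * h ^+ 2))).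
        by rewrite ler_pM2l ?invr_gt0 ?normr_gt0.
      by rewrite -(real_normK (num_real h)) expr2 mulrCA mulKf ?normr_eq0.
    rewrite -ltr_pdivlMl// mulrC.
    near: h; apply: dnbhs0_lt; exact: divr_gt0.
  split; first by apply/cvg_ex; exists 0.
  exact/cvg_lim.
Unshelve. all: by end_near. Qed.

End FlatFunction.

Section Calculus.
Variable R : realType.
Implicit Types (f g : R * R -> R[i]) (a : R * R) (b : bool).

Definition axis b : R * R := if b then (0, 1) else (1, 0).

Definition cdiff f a := differentiable (fun x => complex.Re (f x)) a /\
  differentiable (fun x => complex.Im (f x)) a.

Definition cderive b f a : R[i] :=
  'D_(axis b) (fun x => complex.Re (f x)) a +i*
  'D_(axis b) (fun x => complex.Im (f x)) a.

Lemma rpartial_ReIm s f :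
  rpartial s (fun x => complex.Re (f x)) = (fun a => complex.Re (foldr cderive f s a)) /\
  rpartial s (fun x => complex.Im (f x)) = (fun a => complex.Im (foldr cderive f s a)).
Proof.
elim: s => [|b s [IH1 IH2]] //=.
by rewrite /rpartial /= -!/(rpartial _ _) IH1 IH2.
Qed.

Lemma partialE s f : partial s f = foldr cderive f s.
Proof.
have [H1 H2] := rpartial_ReIm s f.
by apply/funext => a; rewrite /partial H1 H2; case: (foldr _ _ _ a).
Qed.

Lemma smooth_onE U f :
  smooth_on U f <-> forall s a, U a -> cdiff (foldr cderive f s) a.
Proof.
split=> h s a /(h s a); rewrite /cdiff; have [H1 H2] := rpartial_ReIm s f.
  by rewrite H1 H2.
by rewrite H1 H2.
Qed.

(** Differentiability is kept together with the value of the derivative, so that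
the rules below compose. *)
Definition has_cderive f a (df : bool -> R[i]) := cdiff f a /\ forall b, cderive b f a = df b.

Lemma has_cderive_eq f a df df' : has_cderive f a df -> df =1 df' -> has_cderive f a df'.
Proof. by move=> [h1 h2] e; split=> // b; rewrite h2. Qed.

Lemma cderive_has f a : cdiff f a -> has_cderive f a (fun b => cderive b f a).
Proof. by []. Qed.

Lemma has_cderive_cst c a : has_cderive (fun=> c) a (fun=> 0).
Proof.
split; first by split; exact: differentiable_cst.
by move=> b; rewrite /cderive !derive_cst.
Qed.

Lemma has_cderive_add f g a df dg : has_cderive f a df -> has_cderive g a dg ->
  has_cderive (fun x => f x + g x) a (fun b => df b + dg b).
Proof.
move=> [[f1 f2] hf] [[g1 g2] hg].
have E1 : (fun x => complex.Re (f x + g x)) =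
    (fun x => complex.Re (f x)) + (fun x => complex.Re (g x)).
  by apply/funext => x; rewrite fctE; case: (f x) (g x) => ? ? [].
have E2 : (fun x => complex.Im (f x + g x)) =
    (fun x => complex.Im (f x)) + (fun x => complex.Im (g x)).
  by apply/funext => x; rewrite fctE; case: (f x) (g x) => ? ? [].
split; first by split; rewrite ?E1 ?E2; exact: differentiableD.
move=> b; rewrite -hf -hg /cderive E1 E2 !deriveD//; exact: diff_derivable.
Qed.

Lemma deriveMM (F1 F2 G1 G2 : R * R -> R) a v :
  differentiable F1 a -> differentiable F2 a ->
  differentiable G1 a -> differentiable G2 a ->
  differentiable (F1 * G1 + F2 * G2) a /\
  'D_v (F1 * G1 + F2 * G2) a =
  F1 a * 'D_v G1 a + G1 a * 'D_v F1 a + (F2 a * 'D_v G2 a + G2 a * 'D_v F2 a).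
Proof.
move=> f1 f2 g1 g2.
have d1 : differentiable (F1 * G1) a by exact: differentiableM.
have d2 : differentiable (F2 * G2) a by exact: differentiableM.
split; first exact: differentiableD.
rewrite (deriveD (diff_derivable d1) (diff_derivable d2)).
by rewrite (deriveM (diff_derivable f1) (diff_derivable g1))
  (deriveM (diff_derivable f2) (diff_derivable g2)).
Qed.

Lemma has_cderive_mul f g a df dg : has_cderive f a df -> has_cderive g a dg ->
  has_cderive (fun x => f x * g x) a (fun b => df b * g a + f a * dg b).
Proof.
move=> [[f1 f2] hf] [[g1 g2] hg].
have E1 : (fun x => complex.Re (f x * g x)) =
    (fun x => complex.Re (f x)) * (fun x => complex.Re (g x)) +
    (fun x => complex.Im (f x)) * (- (fun x => complex.Im (g x))).
  by apply/funext => x; rewrite !fctE mulrN; case: (f x) (g x) => ? ? [].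
have E2 : (fun x => complex.Im (f x * g x)) =
    (fun x => complex.Re (f x)) * (fun x => complex.Im (g x)) +
    (fun x => complex.Im (f x)) * (fun x => complex.Re (g x)).
  by apply/funext => x; rewrite !fctE; case: (f x) (g x) => ? ? [].
have g2N := differentiableN g2.
have H1 v := deriveMM v f1 f2 g1 g2N.
have H2 v := deriveMM v f1 f2 g2 g1.
split; first by split; rewrite ?E1 ?E2; [have [] := H1 0|have [] := H2 0].
move=> b; rewrite -hf -hg /cderive E1 E2.
have [_ ->] := H1 (axis b); have [_ ->] := H2 (axis b).
rewrite (deriveN (diff_derivable g2)) /= fctE.
move: ('D__ _ _) ('D__ _ _) ('D__ _ _) ('D__ _ _) => u v w z.
case: (f a) (g a) => fr fi [gr gi] /=.
by congr (_ +i* _); ring.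
Qed.

Lemma derive_comp1 (h : R -> R) (dh : R) (g : R * R -> R) a v :
  differentiable g a -> is_derive (g a) 1 h dh ->
  differentiable (h \o g) a /\ 'D_v (h \o g) a = dh * 'D_v g a.
Proof.
move=> dg [/derivable1_diffP dh1 dhE].
have dc : differentiable (h \o g) a by exact: differentiable_comp.
split=> //; rewrite !deriveE// diff_comp//= diff1E//.
by rewrite /GRing.scale/= derive1E dhE mulrC.
Qed.

Lemma has_cderive_real (h : R -> R) (dh : R) f a df :
  has_cderive f a df -> is_derive (complex.Re (f a)) 1 h dh ->
  has_cderive (fun x => (h (complex.Re (f x)))%:C) a
    (fun b => (dh * complex.Re (df b))%:C).
Proof.
move=> [[f1 f2] hf] hd.
have [d1 _] := derive_comp1 0 f1 hd.
split; first by split; [exact: d1|exact: differentiable_cst].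
move=> b; rewrite /cderive derive_cst -hf /=.
by have [_ <-] := derive_comp1 (axis b) f1 hd.
Qed.

(** The real and imaginary parts of 1/f give its differentiability; the value of
the derivative then follows from the product rule for f^-1 f = 1. *)
Lemma has_cderive_inv f a df : has_cderive f a df -> (forall x, f x != 0) ->
  has_cderive (fun x => (f x)^-1) a (fun b => - (df b) * (f a)^-1 ^+ 2).
Proof.
move=> [[f1 f2] hf] f0.
pose n2 x := (complex.Re (f x)) ^+ 2 + (complex.Im (f x)) ^+ 2.
have n20 x : n2 x != 0.
  apply: contra (f0 x); rewrite paddr_eq0 ?sqr_ge0// !sqrf_eq0.
  by case: (f x) => u v /= /andP[/eqP-> /eqP->].
have n2E : n2 = (fun x => complex.Re (f x)) * (fun x => complex.Re (f x)) +
    (fun x => complex.Im (f x)) * (fun x => complex.Im (f x)).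
  by apply/funext => x; rewrite /n2 !fctE !expr2.
have dn2 : differentiable n2 a.
  by rewrite n2E; apply: differentiableD; apply: differentiableM.
have dV : differentiable (fun x => (n2 x)^-1) a by exact: differentiableV.
have E1 : (fun x => complex.Re (f x)^-1) =
    (fun x => complex.Re (f x)) * (fun x => (n2 x)^-1).
  by apply/funext => x; rewrite !fctE /n2; case: (f x).
have E2 : (fun x => complex.Im (f x)^-1) =
    - ((fun x => complex.Im (f x)) * (fun x => (n2 x)^-1)).
  by apply/funext => x; rewrite !fctE /n2; case: (f x).
have cdV : cdiff (fun x => (f x)^-1) a.
  split; rewrite ?E1 ?E2; first exact: differentiableM.
  by apply: differentiableN; apply: differentiableM.
split=> // b.
have [_ /(_ b)] := has_cderive_mul (cderive_has cdV) (conj (conj f1 f2) hf).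
have -> : (fun x => (f x)^-1 * f x) = fun=> 1.
  by apply/funext => x; rewrite mulVf.
have [_ ->] := has_cderive_cst 1 a.
move=> /esym/eqP; rewrite addr_eq0 => /eqP H.
apply: (mulIf (f0 a)); rewrite H expr2 -!mulrA mulVf// mulr1 mulNr; congr (- _).
by rewrite mulrC.
Qed.

Lemma has_cderive_exp f a df : has_cderive f a df ->
  has_cderive (fun x => cexp (f x)) a (fun b => cexp (f a) * df b).
Proof.
move=> [[f1 f2] hf].
pose im x : R[i] := (complex.Im (f x))%:C.
have him : has_cderive im a (fun b => (complex.Im (df b))%:C).
  split; first by split => //=; exact: differentiable_cst.
  by move=> b; rewrite /cderive derive_cst -hf.
have He := has_cderive_real (conj (conj f1 f2) hf) (is_derive_expR _).
have Hc := has_cderive_real him (is_derive_cos _).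
have Hs := has_cderive_real him (is_derive_sin _).
have H := has_cderive_mul He
  (has_cderive_add Hc (has_cderive_mul (has_cderive_cst (0 +i* 1) a) Hs)).
have E : (fun x => cexp (f x)) = (fun x => (expR (complex.Re (f x)))%:C *
    ((cos (complex.Re (im x)))%:C + (0 +i* 1) * (sin (complex.Re (im x)))%:C)).
  apply/funext => x; rewrite /cexp; congr (_ * _).
  by apply/eqP; rewrite eq_complex /=; apply/andP; split; apply/eqP; ring.
rewrite E; apply: (has_cderive_eq H) => b; rewrite /cexp /im.
case: (df b) (f a) => u v [x y] /=.
apply/eqP; rewrite eq_complex /=; apply/andP; split; apply/eqP; ring.
Qed.

Lemma has_cderive_re f a df : has_cderive f a df ->
  has_cderive (fun x => (complex.Re (f x))%:C) a (fun b => (complex.Re (df b))%:C).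
Proof.
move=> h; have := has_cderive_real h (is_derive_id _ (1 : R)).
by move/has_cderive_eq; apply=> b; rewrite mul1r.
Qed.

Lemma has_cderive_fst a : has_cderive (fun x => (x.1)%:C) a (fun b => (~~ b)%:R).
Proof.
have d : differentiable (fst : R * R -> R) a.
  by apply: (linear_differentiable (f := fst)) => x; exact: cvg_fst.
split; first by split => //=; exact: differentiable_cst.
move=> b; rewrite /cderive derive_cst deriveE// diff_lin; last first.
  by move=> x; exact: cvg_fst.
by case: b.
Qed.

Lemma has_cderive_snd a : has_cderive (fun x => (x.2)%:C) a (fun b => b%:R).
Proof.
have d : differentiable (snd : R * R -> R) a.
  by apply: (linear_differentiable (f := snd)) => x; exact: cvg_snd.
split; first by split => //=; exact: differentiable_cst.
move=> b; rewrite /cderive derive_cst deriveE// diff_lin; last first.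
  by move=> x; exact: cvg_snd.
by case: b.
Qed.

End Calculus.
Arguments cderive {R}.

(** * Smooth functions on the plane *)

Section Smooth.
Variable R : realType.
Implicit Types (f g : R * R -> R[i]) (a : R * R) (b : bool).

Definition smooth f := smooth_on setT f.

(** This class is stable under partial derivatives, so that belonging to it gives
smoothness of all orders at once. Every closure property of smooth functions
follows from it, without an induction on the order of differentiation. *)
Inductive generated : (R * R -> R[i]) -> Prop :=
| gen_base f : smooth f -> generated f
| gen_cst c : generated (fun=> c)
| gen_fst : generated (fun a => a.1%:C)
| gen_snd : generated (fun a => a.2%:C)
| gen_add f g : generated f -> generated g -> generated (fun a => f a + g a)
| gen_mul f g : generated f -> generated g -> generated (fun a => f a * g a)
| gen_inv f : generated f -> (forall a, f a != 0) -> generated (fun a => (f a)^-1)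
| gen_re f : generated f -> generated (fun a => (complex.Re (f a))%:C)
| gen_exp f : generated f -> generated (fun a => cexp (f a))
| gen_psi n f : generated f ->
    generated (fun a => (psi n (complex.Re (f a)))%:C).

Lemma generated_has_cderive f : generated f ->
  exists df : bool -> R * R -> R[i],
    (forall b, generated (df b)) /\ forall a, has_cderive f a (df^~ a).
Proof.
elim=> {f} [f hf|c|||f g _ [df [Hf hf]] _ [dg [Hg hg]]
  |f g Gf [df [Hf hf]] Gg [dg [Hg hg]]|f Gf [df [Hf hf]] f0|f _ [df [Hf hf]]
  |f Gf [df [Hf hf]]|n f Gf [df [Hf hf]]].
- exists (fun b => cderive b f); split=> [b|a].
    apply: gen_base; apply/smooth_onE => s a _.
    by rewrite -foldr_rcons; exact: (proj1 (smooth_onE _ _) hf).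
  by apply: cderive_has; exact: (proj1 (smooth_onE _ _) hf [::]).
- by exists (fun _ _ => 0); split=> [b|a]; [exact: gen_cst|exact: has_cderive_cst].
- exists (fun b _ => (~~ b)%:R); split=> [b|a]; first exact: gen_cst.
  exact: has_cderive_fst.
- exists (fun b _ => b%:R); split=> [b|a]; first exact: gen_cst.
  exact: has_cderive_snd.
- exists (fun b a => df b a + dg b a); split=> [b|a]; first exact: gen_add.
  exact: has_cderive_add.
- exists (fun b a => df b a * g a + f a * dg b a); split=> [b|a].
    by apply: gen_add; apply: gen_mul.
  exact: (has_cderive_mul (hf a) (hg a)).
- exists (fun b a => - (df b a) * (f a)^-1 ^+ 2); split=> [b|a].
    have -> : (fun a => - df b a * (f a)^-1 ^+ 2) =
      (fun a => ((- 1) * df b a) * ((f a)^-1 * (f a)^-1)).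
      by apply/funext => x; rewrite mulN1r expr2.
    by apply: gen_mul; apply: gen_mul => //; [exact: gen_cst|exact: gen_inv..].
  exact: (has_cderive_inv (hf a)).
- exists (fun b a => (complex.Re (df b a))%:C); split=> [b|a]; first exact: gen_re.
  exact: (has_cderive_re (hf a)).
- exists (fun b a => cexp (f a) * df b a); split=> [b|a].
    by apply: gen_mul => //; exact: gen_exp.
  exact: (has_cderive_exp (hf a)).
- exists (fun b a => ((psi n.+2 (complex.Re (f a)) -
     n%:R * psi n.+1 (complex.Re (f a))) * complex.Re (df b a))%:C); split=> [b|a].
    have -> : (fun a => ((psi n.+2 (complex.Re (f a)) -
       n%:R * psi n.+1 (complex.Re (f a))) * complex.Re (df b a))%:C) =
      (fun a => ((psi n.+2 (complex.Re (f a)))%:C +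
        (- n%:R) * (psi n.+1 (complex.Re (f a)))%:C) * (complex.Re (df b a))%:C).
      apply/funext => x; rewrite rmorphM rmorphB rmorphM /=; congr (_ * _).
      by rewrite mulNr rmorph_nat.
    apply: gen_mul; last exact: gen_re.
    apply: gen_add; first exact: gen_psi.
    by apply: gen_mul; [exact: gen_cst|exact: gen_psi].
  exact: (has_cderive_real (hf a) (is_derive_psi _ _)).
Qed.

Lemma generated_smooth f : generated f -> smooth f.
Proof.
move=> gf; apply/smooth_onE => s a _.
suff : generated (foldr cderive f s) by move=> /generated_has_cderive[df [_ /(_ a) []]].
elim: s => [|b s IH] //=.
have [df [gdf H]] := generated_has_cderive IH.
suff -> : cderive b (foldr cderive f s) = df b by [].
by apply/funext => x; have [_ ->] := H x.
Qed.

Lemma smooth_cst c : smooth (fun=> c).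
Proof. exact/generated_smooth/gen_cst. Qed.

Lemma smooth_fst : smooth (fun a => a.1%:C).
Proof. exact/generated_smooth/gen_fst. Qed.

Lemma smooth_snd : smooth (fun a => a.2%:C).
Proof. exact/generated_smooth/gen_snd. Qed.

Lemma smooth_add f g : smooth f -> smooth g -> smooth (fun a => f a + g a).
Proof. by move=> hf hg; apply/generated_smooth/gen_add; exact: gen_base. Qed.

Lemma smooth_mul f g : smooth f -> smooth g -> smooth (fun a => f a * g a).
Proof. by move=> hf hg; apply/generated_smooth/gen_mul; exact: gen_base. Qed.

Lemma smooth_inv f : smooth f -> (forall a, f a != 0) ->
  smooth (fun a => (f a)^-1).
Proof. by move=> hf f0; apply/generated_smooth/gen_inv => //; exact: gen_base. Qed.

Lemma smooth_exp f : smooth f -> smooth (fun a => cexp (f a)).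
Proof. by move=> hf; apply/generated_smooth/gen_exp/gen_base. Qed.

Lemma smooth_psi n f : smooth f -> smooth (fun a => (psi n (complex.Re (f a)))%:C).
Proof. by move=> hf; apply/generated_smooth/gen_psi/gen_base. Qed.

Lemma smooth_scale c f : smooth f -> smooth (fun a => c * f a).
Proof. by move=> hf; apply: smooth_mul => //; exact: smooth_cst. Qed.

Lemma smooth_opp f : smooth f -> smooth (fun a => - f a).
Proof.
move=> /(smooth_scale (-1)); congr smooth.
by apply/funext => a; rewrite mulN1r.
Qed.

Lemma smooth_sub f g : smooth f -> smooth g -> smooth (fun a => f a - g a).
Proof. by move=> hf /smooth_opp; exact: smooth_add. Qed.

Lemma smooth_ext f g : f =1 g -> smooth g -> smooth f.
Proof. by move=> /funext ->. Qed.

Lemma smooth_sum (I : Type) (r : seq I) (P : pred I) (F : I -> R * R -> R[i]) :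
  (forall i, smooth (F i)) -> smooth (fun a => \sum_(i <- r | P i) F i a).
Proof.
move=> hF; elim: r => [|i r IH].
  by apply: (smooth_ext (g := fun=> 0)) => [a|]; [rewrite big_nil|exact: smooth_cst].
apply: (smooth_ext (g := fun a => (if P i then F i a else 0) +
    \sum_(i <- r | P i) F i a)).
  by move=> a; rewrite big_cons; case: ifP => // _; rewrite add0r.
apply: smooth_add => //; case: (P i) => //; exact: smooth_cst.
Qed.

Lemma smooth_exprn n f : smooth f -> smooth (fun a => f a ^+ n).
Proof.
move=> hf; elim: n => [|n IH].
  by apply: (smooth_ext (g := fun=> 1)) => [a|]; [rewrite expr0|exact: smooth_cst].
apply: (smooth_ext (g := fun a => f a * f a ^+ n)) => [a|]; first by rewrite exprS.
exact: smooth_mul.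
Qed.

Lemma smooth_horner (p : {poly R[i]}) f : smooth f -> smooth (fun a => p.[f a]).
Proof.
move=> hf; apply: (smooth_ext (g := fun a => \sum_(i < size p) p`_i * f a ^+ i)).
  by move=> a; rewrite horner_coef.
by apply: smooth_sum => i; apply: smooth_scale; exact: smooth_exprn.
Qed.

Lemma smooth_cderive b f : smooth f -> smooth (cderive b f).
Proof.
move=> hf; apply/smooth_onE => s a _.
by rewrite -foldr_rcons; exact: (proj1 (smooth_onE _ _) hf).
Qed.

Lemma smooth_cdiff f a : smooth f -> cdiff f a.
Proof. by move=> hf; exact: (proj1 (smooth_onE _ _) hf [::]). Qed.

Lemma cderive_ext b f (df : bool -> R * R -> R[i]) :
  (forall a, has_cderive f a (fun c => df c a)) -> cderive b f = df b.
Proof. by move=> H; apply/funext => a; have [_ ->] := H a. Qed.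

Lemma cderive_add b f g : smooth f -> smooth g ->
  cderive b (fun a => f a + g a) = fun a => cderive b f a + cderive b g a.
Proof.
move=> hf hg; apply: (@cderive_ext b _ (fun b a => cderive b f a + cderive b g a)) => a.
by apply: has_cderive_add; apply/cderive_has/smooth_cdiff.
Qed.

Lemma cderive_mul b f g : smooth f -> smooth g ->
  cderive b (fun a => f a * g a) = fun a => cderive b f a * g a + f a * cderive b g a.
Proof.
move=> hf hg; apply: (@cderive_ext b _ (fun b a => cderive b f a * g a + f a * cderive b g a)) => a.
by apply: has_cderive_mul; apply/cderive_has/smooth_cdiff.
Qed.

Lemma cderive_cst b (c : R[i]) : cderive b (fun=> c) = (fun=> 0) :> (R * R -> R[i]).
Proof.
by apply: (@cderive_ext b (fun=> c) (fun _ _ => 0)) => a; exact: has_cderive_cst.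
Qed.

Lemma cderive_scale b c f : smooth f -> cderive b (fun a => c * f a) = fun a => c * cderive b f a.
Proof.
move=> hf; rewrite cderive_mul ?cderive_cst//; last exact: smooth_cst.
by apply/funext => a; rewrite mul0r add0r.
Qed.

Lemma cderive_inv b f : smooth f -> (forall a, f a != 0) ->
  cderive b (fun a => (f a)^-1) = fun a => - (cderive b f a) * (f a)^-1 ^+ 2.
Proof.
move=> hf f0; apply: (@cderive_ext b _ (fun b a => - (cderive b f a) * (f a)^-1 ^+ 2)) => a.
by apply: has_cderive_inv => //; apply/cderive_has/smooth_cdiff.
Qed.

Lemma cderive_exp b f : smooth f ->
  cderive b (fun a => cexp (f a)) = fun a => cexp (f a) * cderive b f a.
Proof.
move=> hf; apply: (@cderive_ext b _ (fun b a => cexp (f a) * cderive b f a)) => a.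
by apply: has_cderive_exp; apply/cderive_has/smooth_cdiff.
Qed.

Lemma cderive_exprn b n f : smooth f ->
  cderive b (fun a => f a ^+ n) = fun a => n%:R * f a ^+ n.-1 * cderive b f a.
Proof.
move=> hf; elim: n => [|n IH].
  have -> : (fun a => f a ^+ 0) = fun=> 1 by apply/funext => a; rewrite expr0.
  by rewrite cderive_cst; apply/funext => a; rewrite !mul0r.
have -> : (fun a => f a ^+ n.+1) = fun a => f a * f a ^+ n.
  by apply/funext => a; rewrite exprS.
rewrite cderive_mul ?IH//; last exact: smooth_exprn.
apply/funext => a /=; case: n {IH} => [|n] /=; first by rewrite !expr0; ring.
by rewrite exprS -[n.+2]addn1 natrD; ring.
Qed.

End Smooth.
Arguments smooth {R}.

(** * Cutoffs *)

Section Cutoff.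
Variable R : realType.
Implicit Types (f g phi : R * R -> R[i]) (a : R * R).

Definition smooth_step (x : R) : R := psi 0 x / (psi 0 x + psi 0 (1 - x)).

Lemma psi0_gt0 (x : R) : 0 < x -> 0 < psi 0 x.
Proof. by move=> x0; rewrite /psi x0 expr0 invr1 mul1r expR_gt0. Qed.

Lemma psi0_ge0 (x : R) : 0 <= psi 0 x.
Proof.
have [x0|x0] := ltP 0 x; first exact/ltW/psi0_gt0.
by rewrite /psi ltNge x0.
Qed.

Lemma smooth_step_den (x : R) : psi 0 x + psi 0 (1 - x) != 0.
Proof.
rewrite gt_eqF//; have [x0|x0] := ltP 0 x.
  by rewrite ltr_pwDl ?psi0_ge0 ?psi0_gt0.
by rewrite ltr_wpDl ?psi0_ge0 ?psi0_gt0// subr_gt0 (le_lt_trans x0).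
Qed.

Lemma smooth_step0 x : x <= 0 -> smooth_step x = 0.
Proof. by move=> x0; rewrite /smooth_step {1}/psi ltNge x0 mul0r. Qed.

Lemma smooth_step1 x : 1 <= x -> smooth_step x = 1.
Proof.
move=> x1; have := smooth_step_den x; rewrite /smooth_step.
have -> : psi 0 (1 - x) = 0 by rewrite /psi subr_gt0 ltNge x1.
rewrite addr0; exact: divff.
Qed.

Lemma smooth_smooth_step (c : R * R -> R) : smooth (fun a => (c a)%:C) ->
  smooth (fun a => (smooth_step (c a))%:C).
Proof.
move=> hc.
apply: (smooth_ext (g := fun a => (psi 0 (c a))%:C *
   ((psi 0 (c a))%:C + (psi 0 (1 - c a))%:C)^-1)).
  by move=> a; rewrite /smooth_step rmorphM fmorphV rmorphD.
have h1 := smooth_psi 0 hc.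
have h2 : smooth (fun a => (psi 0 (1 - c a))%:C).
  have := smooth_psi 0 (smooth_sub (smooth_cst 1) hc).
  by [].
apply: smooth_mul => //; apply: smooth_inv; first exact: smooth_add.
by move=> a; rewrite -rmorphD fmorph_eq0 smooth_step_den.
Qed.

(** The step is composed with a function of c^2 rather than of |c|, because the
absolute value is not smooth. *)
Lemma cutoff (c : R * R -> R) (r r' : R) : smooth (fun a => (c a)%:C) ->
  0 <= r -> r < r' -> exists chi, [/\ smooth chi,
    forall a, `|c a| <= r -> chi a = 1 & forall a, r' <= `|c a| -> chi a = 0].
Proof.
move=> hc r0 rr'.
have d0 : 0 < r' ^+ 2 - r ^+ 2 by rewrite subr_gt0 ltr_pXn2r// nnegrE (le_trans r0)// ltW.
pose q a := (r' ^+ 2 - (c a) ^+ 2) / (r' ^+ 2 - r ^+ 2).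
exists (fun a => (smooth_step (q a))%:C); split.
- apply: smooth_smooth_step.
  apply: (smooth_ext (g := fun a => ((r' ^+ 2 - r ^+ 2)^-1)%:C *
     ((r' ^+ 2)%:C - (c a)%:C ^+ 2))) => [a|].
    by rewrite /q mulrC rmorphM rmorphB; congr (_ * (_ - _)); rewrite rmorphXn.
  apply: smooth_scale; apply: smooth_sub; first exact: smooth_cst.
  exact: smooth_exprn.
- move=> a ca; rewrite smooth_step1// /q ler_pdivlMr// mul1r lerD2l lerN2.
  by rewrite -(real_normK (num_real (c a))) ler_pXn2r// nnegrE.
- move=> a ca; rewrite smooth_step0// /q pmulr_lle0 ?invr_gt0// subr_le0.
  by rewrite -(real_normK (num_real (c a))) ler_pXn2r// nnegrE// (le_trans r0)// ltW.
Qed.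

Definition box a0 (A B : R) : set (R * R) :=
  [set a | `|a.1 - a0.1| <= A /\ `|a.2 - a0.2| <= B].

Lemma box_compact a0 A B : compact (box a0 A B).
Proof.
have -> : box a0 A B =
    `[a0.1 - A, a0.1 + A] `*` `[a0.2 - B, a0.2 + B].
  apply/seteqP; split=> a; rewrite /box /= !in_itv /= !ler_distl.
    by move=> [-> ->].
  by move=> [-> ->].
by apply: compact_setX; exact: segment_compact.
Qed.

Lemma box_closed a0 A B : closed (box a0 A B).
Proof. by apply: compact_closed; [exact: norm_hausdorff|exact: box_compact]. Qed.

Lemma open_box U a0 : open U -> U a0 ->
  exists2 d : R, 0 < d & box a0 d d `<=` U.
Proof.
move=> oU Ua; have /nbhs_ballP[e /= e0 He] : nbhs a0 U by exact: open_nbhs_nbhs.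
exists (e / 2) => [|a [h1 h2]]; first exact: divr_gt0.
have e2 : e / 2 < e by rewrite ltr_pdivrMr// mulr_natr mulr2n ltrDl.
by apply: He; split; rewrite /ball/= distrC; apply: le_lt_trans e2.
Qed.

Lemma fsupport_box phi a0 A B : (forall a, phi a != 0 -> box a0 A B a) ->
  fsupport phi `<=` box a0 A B /\ compact (fsupport phi).
Proof.
move=> H; have S : fsupport phi `<=` box a0 A B.
  rewrite (closure_id (box a0 A B)).1; last exact: box_closed.
  exact: closure_subset.
split=> //; apply: subclosed_compact S; [exact: closed_closure|exact: box_compact].
Qed.

Lemma fsupport_out phi a : ~ fsupport phi a -> phi a = 0.
Proof.
move=> na; apply: contrapT => h; apply: na; apply: subset_closure.
by apply/eqP.
Qed.

Lemma test_smooth phi : test_function phi -> smooth phi.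
Proof. by case. Qed.

Lemma fsupport_sub phi psi : (forall a, psi a = 0 -> phi a = 0) ->
  fsupport phi `<=` fsupport psi.
Proof.
move=> H; apply: closure_subset => a /=; apply: contra => /eqP h.
by rewrite H.
Qed.

Lemma test_mull f phi : smooth f -> test_function phi ->
  test_function (fun a => f a * phi a).
Proof.
move=> hf [h1 h2]; split; first exact: smooth_mul.
apply: subclosed_compact h2 _; first exact: closed_closure.
by apply: fsupport_sub => a ->; rewrite mulr0.
Qed.

Lemma test_mulr f phi : smooth f -> test_function phi ->
  test_function (fun a => phi a * f a).
Proof.
move=> hf hp; have := test_mull hf hp; congr test_function.
by apply/funext => a; rewrite mulrC.
Qed.

Lemma test0 : test_function (fun _ : R * R => 0).
Proof.
split; first exact: smooth_cst.
have [] // := @fsupport_box (fun=> 0) (0, 0) 0 0.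
by move=> a; rewrite eqxx.
Qed.

Lemma test_add f g : test_function f -> test_function g ->
  test_function (fun a => f a + g a).
Proof.
move=> [f1 f2] [g1 g2]; split; first exact: smooth_add.
apply: subclosed_compact (compactU f2 g2) _; first exact: closed_closure.
rewrite -closureU; apply: closure_subset => a /= h.
by have [fa|fa] := eqVneq (f a) 0; [right|left] => //; move: h; rewrite fa add0r.
Qed.

(** Cuts a test function into pieces on which a distribution is known to vanish. *)
Lemma point_cutoff U a0 : open U -> U a0 ->
  exists chi V, [/\ test_function chi, fsupport chi `<=` U, open V, V a0 &
    forall a, V a -> chi a = 1].
Proof.
move=> oU /(open_box oU)[d d0 dU].
have s1 : smooth (fun a : R * R => (a.1 - a0.1)%:C).
  apply: (smooth_ext (g := fun a => a.1%:C - a0.1%:C)) => [a|].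
    by rewrite rmorphB.
  by apply: smooth_sub; [exact: smooth_fst|exact: smooth_cst].
have s2 : smooth (fun a : R * R => (a.2 - a0.2)%:C).
  apply: (smooth_ext (g := fun a => a.2%:C - a0.2%:C)) => [a|].
    by rewrite rmorphB.
  by apply: smooth_sub; [exact: smooth_snd|exact: smooth_cst].
have d20 : 0 < d / 2 by exact: divr_gt0.
have d2 : d / 2 < d by rewrite ltr_pdivrMr// mulr_natr mulr2n ltrDl.
have [x1 [x1s x1o x1z]] := cutoff s1 (ltW d20) d2.
have [x2 [x2s x2o x2z]] := cutoff s2 (ltW d20) d2.
have [S C] : fsupport (fun a => x1 a * x2 a) `<=` box a0 d d /\
   compact (fsupport (fun a => x1 a * x2 a)).
  apply: fsupport_box => a; rewrite mulf_eq0 negb_or => /andP[h1 h2].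
  split; rewrite leNgt; apply/negP => /ltW.
    by move/x1z/eqP; rewrite (negbTE h1).
  by move/x2z/eqP; rewrite (negbTE h2).
exists (fun a => x1 a * x2 a), (interior (box a0 (d / 2) (d / 2))); split.
- by split=> //; exact: smooth_mul.
- exact: subset_trans dU.
- exact: open_interior.
- apply/nbhs_ballP; exists (d / 2) => //= a [h1 h2].
  by split; rewrite distrC ltW.
- by move=> a /interior_subset [h1 h2]; rewrite x1o// x2o// mulr1.
Qed.

End Cutoff.

(** * Pairings *)

Section Pairing.
Variable R : realType.
Implicit Types (f g phi : R * R -> R[i]) (a : R * R) (w : functional R).

Definition test_linear w := forall (c : R[i]) phi psi,
  test_function phi -> test_function psi ->
  w (fun a => c * phi a + psi a) = c * w phi + w psi.

Lemma test_linear0 w : test_linear w -> w (fun=> 0) = 0.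
Proof.
move=> lw; have := lw 1 _ _ (test0 R) (test0 R).
rewrite !mul1r addr0 => /eqP; rewrite -subr_eq0 opprD addNKr oppr_eq0.
by move/eqP.
Qed.

Lemma test_linearB w phi psi : test_linear w -> test_function phi ->
  test_function psi -> w (fun a => phi a - psi a) = w phi - w psi.
Proof.
move=> lw tphi tpsi; have := lw (-1) _ _ tpsi tphi.
rewrite mulN1r addrC => <-; congr w.
by apply/funext => a; rewrite mulN1r addrC.
Qed.

Lemma plane_compact_cover (A : set (R * R)) : compact A -> cover_compact A.
Proof.
pose T : ptopologicalType :=
  HB.pack (R * R)%type (isPointed.Build (R * R)%type (0, 0)).
by have /(congr1 (fun P => P A)) <- := @compact_cover T.
Qed.

(** Finitely many cutoffs chi_i, all of whose multiples are annihilated by w, are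
equal to 1 on sets that cover the support of phi. Multiplying phi by the factors
1 - chi_i, one after the other, does not change the value of w and ends with 0. *)
Lemma null_off_supp w phi : test_linear w -> test_function phi ->
  (forall a, fsupport phi a -> ~ supp w a) -> w phi = 0.
Proof.
move=> lw tphi disj.
have /choice[F HF] : forall a, exists F : (R * R -> R[i]) * set (R * R),
    fsupport phi a -> [/\ test_function F.1, open F.2, F.2 a,
      forall x, F.2 x -> F.1 x = 1 &
      forall psi, test_function psi -> fsupport psi `<=` fsupport F.1 -> w psi = 0].
  move=> a; have [sa|nsa] := pselect (fsupport phi a); last by exists (fun=> 0, setT).
  have /existsNP[U /not_implyP[oU /not_implyP[Ua nU]]] := disj _ sa.
  have [chi [V [tchi schi oV Va chi1]]] := point_cutoff oU Ua.
  exists (chi, V) => _; split=> //= psi tpsi spsi.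
  apply: contrapT => /eqP wpsi; apply: nU; exists psi; split=> //.
  exact: subset_trans schi.
have : cover_compact (fsupport phi) by apply: plane_compact_cover; case: tphi.
move=> /(_ _ (fsupport phi) (fun a => (F a).2)); case.
- by move=> a /HF[].
- by move=> a sa; exists a => //; have [] := HF _ sa.
move=> D DS cov.
pose q (s : seq (R * R)) (a : R * R) := phi a * \prod_(i <- s) (1 - (F i).1 a).
have H s : {subset s <= fsupport phi} -> test_function (q s) /\ w (q s) = w phi.
  elim: s => [|i s IH] sub.
    have -> : q [::] = phi by apply/funext => a; rewrite /q big_nil mulr1.
    by [].
  have [tq wq] := IH (fun x xs => sub x (@mem_behead _ (i :: s) x xs)).
  have /HF[tF _ _ _ nF] : fsupport phi i by apply/set_mem/sub/mem_head.
  have tqF : test_function (fun a => q s a * (F i).1 a).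
    by apply: test_mulr => //; exact: test_smooth.
  have -> : q (i :: s) = fun a => q s a - q s a * (F i).1 a.
    by apply/funext => a; rewrite /q big_cons; ring.
  split.
    apply: test_add => //.
    have := test_mull (smooth_cst (-1)) tqF; congr test_function.
    by apply/funext => a; rewrite mulN1r.
  rewrite test_linearB// (nF _ tqF) ?subr0//.
  by apply: fsupport_sub => a ->; rewrite mulr0.
have [|_ <-] := H (finmap.enum_fset D).
  by move=> x xD; apply: DS; exact: xD.
(* At every point of the support of phi one of the factors vanishes. *)
rewrite (_ : q _ = fun=> 0); first exact: test_linear0.
apply/funext => a; rewrite /q.
have [sa|/fsupport_out ->] := pselect (fsupport phi a); last by rewrite mul0r.
have [i /= iD Via] := cov _ sa.
have /HF[_ _ _ F1 _] : fsupport phi i by apply/set_mem/DS.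
by rewrite (big_rem i)//= F1// subrr mul0r mulr0.
Qed.

(** Two test functions that coincide with f near the support of w differ by one
whose support does not meet that of w. *)
Lemma pairing_test w f phi U : test_linear w -> test_function phi -> open U ->
  supp w `<=` U -> (forall a, U a -> phi a = f a) -> pairing w f = w phi.
Proof.
move=> lw tphi oU sU fU; rewrite /pairing.
case: xgetP => [v _ [psi [V [tpsi oV sV fV ->]]]|/(_ (w phi)) h]; last first.
  by exfalso; apply: h; exists phi, U.
apply/eqP; rewrite -subr_eq0 -test_linearB//; apply/eqP.
apply: null_off_supp => //.
  apply: test_add => //.
  have := test_mull (smooth_cst (-1)) tphi; congr test_function.
  by apply/funext => a; rewrite mulN1r.
move=> a fa sa.
have /fa[b [/eqP /= h [Ub Vb]]] : nbhs a (U `&` V).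
  by apply: filterI; apply: open_nbhs_nbhs; split => //; [exact: sU|exact: sV].
by apply: h; rewrite fV// fU// subrr.
Qed.

(** This algebraic notion is kept apart from continuity, so that it passes to
products with smooth functions without any estimate. *)
Definition tame w := test_linear w /\ exists A, supp w `<=` box (0, 0) A A.

Lemma box_cutoff A : exists chi U, [/\ test_function chi, open U,
  box (0, 0) A A `<=` U & forall a, U a -> chi a = 1 :> R[i]].
Proof.
wlog A0 : A / 0 <= A.
  move=> H; have [chi [U [h1 h2 h3 h4]]] := H `|A| (normr_ge0 _).
  exists chi, U; split=> // a [h5 h6]; apply: h3.
  by split; [apply: le_trans h5 _|apply: le_trans h6 _]; exact: ler_norm.
have A1 : 0 <= A + 1 by rewrite addr_ge0.
have A12 : A + 1 < A + 2 by rewrite ltrD2l ltr1n.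
have [x1 [x1s x1o x1z]] := cutoff (@smooth_fst R) A1 A12.
have [x2 [x2s x2o x2z]] := cutoff (@smooth_snd R) A1 A12.
exists (fun a => x1 a * x2 a), (interior (box (0, 0) (A + 1) (A + 1))); split.
- split; first exact: smooth_mul.
  have [] // := @fsupport_box _ (fun a => x1 a * x2 a) (0, 0) (A + 2) (A + 2).
  move=> a; rewrite mulf_eq0 negb_or => /andP[h1 h2].
  split; rewrite /= subr0 leNgt; apply/negP => /ltW.
    by move/x1z/eqP; rewrite (negbTE h1).
  by move/x2z/eqP; rewrite (negbTE h2).
- exact: open_interior.
- move=> a [h1 h2]; apply/nbhs_ballP; exists 1 => //= b [b1 b2].
  split; rewrite /= subr0.
    rewrite -[b.1](subrK a.1) addrC (le_trans (ler_normD _ _))// lerD//.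
      by move: h1; rewrite subr0.
    by rewrite distrC ltW.
  rewrite -[b.2](subrK a.2) addrC (le_trans (ler_normD _ _))// lerD//.
    by move: h2; rewrite subr0.
  by rewrite distrC ltW.
- move=> a /interior_subset [h1 h2]; rewrite x1o ?x2o ?mulr1//.
    by move: h2; rewrite subr0.
  by move: h1; rewrite subr0.
Qed.

(** A single cutoff serves all smooth functions, so that the linearity of w passes
to pairings. *)
Lemma tame_cutoff w : tame w -> exists chi U, [/\ test_function chi, open U,
  supp w `<=` U, forall a, U a -> chi a = 1 &
  forall f, smooth f -> pairing w f = w (fun a => chi a * f a)].
Proof.
move=> [lw [A sA]]; have [chi [U [tchi oU AU chi1]]] := box_cutoff A.
exists chi, U; split=> //; first exact: subset_trans AU.
move=> f sf; apply: (pairing_test lw (U := U)) => //.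
- exact: test_mulr.
- exact: subset_trans AU.
- by move=> a /chi1 ->; rewrite mul1r.
Qed.

Lemma pairing_linear w c f g : tame w -> smooth f -> smooth g ->
  pairing w (fun a => c * f a + g a) = c * pairing w f + pairing w g.
Proof.
move=> tw sf sg; have [chi [U [tchi _ _ _ E]]] := tame_cutoff tw.
rewrite !E//; last by apply: smooth_add => //; exact: smooth_scale.
rewrite -(proj1 tw); [|exact: test_mulr..]; congr w.
by apply/funext => a; ring.
Qed.

Lemma pairing0 w : tame w -> pairing w (fun=> 0) = 0.
Proof.
move=> tw; have [chi [U [tchi _ _ _ E]]] := tame_cutoff tw.
rewrite E; last exact: smooth_cst.
rewrite (_ : (fun a => chi a * 0) = fun=> 0); first exact: (test_linear0 (proj1 tw)).
by apply/funext => a; rewrite mulr0.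
Qed.

Lemma pairing_scale w c f : tame w -> smooth f ->
  pairing w (fun a => c * f a) = c * pairing w f.
Proof.
move=> tw sf; have := pairing_linear c tw sf (smooth_cst 0).
rewrite pairing0// addr0 => <-; congr pairing.
by apply/funext => a; rewrite addr0.
Qed.

Lemma pairing_add w f g : tame w -> smooth f -> smooth g ->
  pairing w (fun a => f a + g a) = pairing w f + pairing w g.
Proof.
move=> tw sf sg; have := pairing_linear 1 tw sf sg.
rewrite mul1r => <-; congr pairing.
by apply/funext => a; rewrite mul1r.
Qed.

Lemma pairing_sum w (I : Type) (r : seq I) (P : pred I) (F : I -> R * R -> R[i]) :
  tame w -> (forall i, smooth (F i)) ->
  pairing w (fun a => \sum_(i <- r | P i) F i a) = \sum_(i <- r | P i) pairing w (F i).
Proof.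
move=> tw sF; elim: r => [|i r IH].
  rewrite big_nil -[RHS](pairing0 tw); congr pairing.
  by apply/funext => a; rewrite big_nil.
rewrite big_cons -IH; case: (boolP (P i)) => Pi.
  rewrite -pairing_add//; last exact: smooth_sum.
  by congr pairing; apply/funext => a; rewrite big_cons Pi.
by congr pairing; apply/funext => a; rewrite big_cons (negbTE Pi).
Qed.

(** Near the support of w, the product of f with a test function supported off it
vanishes. *)
Lemma supp_dmul f w : tame w -> smooth f -> supp (dmul f w) `<=` supp w.
Proof.
move=> tw sf a; apply: contraPP => /existsNP[U /not_implyP[oU /not_implyP[Ua nU]]].
move=> /(_ U oU Ua)[phi [tphi sphi /eqP]]; apply; rewrite /dmul.
rewrite -[RHS](test_linear0 (proj1 tw)).
apply: (pairing_test (proj1 tw) (U := ~` fsupport phi)) => //.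
- exact: test0.
- by apply: closed_openC; exact: closed_closure.
- move=> b sb /sphi Ub; have [psi [h1 h2 h3]] := sb U oU Ub.
  by apply: nU; exists psi.
- by move=> b /fsupport_out ->; rewrite mulr0.
Qed.

Lemma tame_dmul f w : tame w -> smooth f -> tame (dmul f w).
Proof.
move=> tw sf; split.
  move=> c phi psi tphi tpsi; rewrite /dmul.
  rewrite -pairing_linear//; [|by apply: smooth_mul => //; exact: test_smooth..].
  by congr pairing; apply/funext => a; ring.
have [_ [A sA]] := tw; exists A; apply: subset_trans sA.
exact: supp_dmul.
Qed.

Lemma pairing_dmul f g w : tame w -> smooth f -> smooth g ->
  pairing (dmul f w) g = pairing w (fun a => f a * g a).
Proof.
move=> tw sf sg; have [chi [U [tchi oU sU chi1 E]]] := tame_cutoff tw.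
have tw' := tame_dmul tw sf.
rewrite (pairing_test (proj1 tw') (phi := fun a => chi a * g a) (U := U)) //.
- rewrite /dmul !E; [|exact: smooth_mul|]; last first.
    apply: smooth_mul => //; apply: test_smooth; exact: test_mulr.
  apply/eqP; rewrite -subr_eq0 -(test_linearB (proj1 tw)); last first.
  + by apply: test_mulr => //; exact: smooth_mul.
  + by apply: test_mull; [exact: test_smooth|apply: test_mull => //; exact: test_mulr].
  apply/eqP; rewrite -[RHS](pairing0 tw); apply/esym.
  apply: (pairing_test (proj1 tw) (U := U)) => //; last first.
    by move=> a Ua; rewrite chi1//; ring.
  apply: test_add; first by
    apply: test_mull; [exact: test_smooth|apply: test_mull => //; exact: test_mulr].
  have := test_mull (smooth_cst (-1)) (test_mulr (smooth_mul sf sg) tchi).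
  by congr test_function; apply/funext => a; rewrite mulN1r.
- exact: test_mulr.
- by apply: subset_trans sU; exact: supp_dmul.
- by move=> a /chi1 ->; rewrite mul1r.
Qed.

End Pairing.

(** * Seminorms and continuity *)

Section Bounds.
Variable R : realType.
Implicit Types (f g phi : R * R -> R[i]) (a : R * R) (w : functional R).
Implicit Types (K : set (R * R)) (m N : nat).

(** The seminorms of C^m on K. The bound is an argument, because whole families of
functions are estimated by a common bound. *)
Definition bounded_upto m K f (M : R) :=
  forall s a, (size s <= m)%N -> K a -> `|foldr cderive f s a| <= M%:C.

Lemma bounded_upto0 m K f M a : bounded_upto m K f M -> K a -> `|f a| <= M%:C.
Proof. by move=> h Ka; exact: (h [::]). Qed.

Lemma bounded_upto_ge0 m K f M a : bounded_upto m K f M -> K a -> 0 <= M.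
Proof.
by move=> h /(bounded_upto0 h) H; rewrite -ler0c; exact: le_trans H.
Qed.

Lemma bounded_upto_le m K f M M' : M <= M' ->
  bounded_upto m K f M -> bounded_upto m K f M'.
Proof.
by move=> MM h s a sm Ka; rewrite (le_trans (h s a sm Ka))// lecR.
Qed.

Lemma bounded_uptoS m K f M :
  bounded_upto m.+1 K f M <-> (forall a, K a -> `|f a| <= M%:C) /\
    forall b, bounded_upto m K (cderive b f) M.
Proof.
split=> [h|[h1 h2] s a].
  split=> [a Ka|b s a sm Ka]; first exact: (bounded_upto0 h).
  by have := h (rcons s b) a; rewrite size_rcons foldr_rcons; exact.
case/lastP: s => [_|s b]; first exact: h1.
by rewrite size_rcons foldr_rcons => sm Ka; exact: h2.
Qed.

Lemma bounded_upto_sub m m' K f M : (m' <= m)%N ->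
  bounded_upto m K f M -> bounded_upto m' K f M.
Proof. by move=> mm h s a sm; apply: h; exact: leq_trans mm. Qed.

Lemma smooth_foldr s f : smooth f -> smooth (foldr cderive f s).
Proof. by move=> sf; elim: s => //= b s; exact: smooth_cderive. Qed.

Lemma foldr_cderive_add s f g : smooth f -> smooth g ->
  foldr cderive (fun a => f a + g a) s = fun a => foldr cderive f s a + foldr cderive g s a.
Proof.
move=> sf sg; elim: s => //= b s ->.
by rewrite cderive_add//; exact: smooth_foldr.
Qed.

Lemma bounded_upto_add m K f g A B : smooth f -> smooth g ->
  bounded_upto m K f A -> bounded_upto m K g B ->
  bounded_upto m K (fun a => f a + g a) (A + B).
Proof.
move=> sf sg hf hg s a sm Ka; rewrite foldr_cderive_add// rmorphD.
by rewrite (le_trans (ler_normD _ _))// lerD// ?hf// hg.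
Qed.

(** By the Leibniz rule each differentiation doubles the number of terms, whence
the factor 2^m. *)
Lemma bounded_upto_mul m K f g A B : smooth f -> smooth g ->
  bounded_upto m K f A -> bounded_upto m K g B ->
  bounded_upto m K (fun a => f a * g a) (2 ^+ m * (A * B)).
Proof.
elim: m f g A B => [|m IH] f g A B sf sg hf hg.
  move=> [|//] a _ Ka /=; rewrite normrM expr0 mul1r rmorphM.
  by rewrite ler_pM// ?(bounded_upto0 hf)// (bounded_upto0 hg).
apply/bounded_uptoS; split=> [a Ka|b].
  rewrite normrM; have A0 := bounded_upto_ge0 hf Ka.
  have B0 := bounded_upto_ge0 hg Ka.
  apply: (@le_trans _ _ ((A * B)%:C)); last first.
    rewrite lecR ler_peMl// ?mulr_ge0//.
    by rewrite exprn_ege1// ler1n.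
  by rewrite rmorphM ler_pM// ?(bounded_upto0 hf)// (bounded_upto0 hg).
rewrite cderive_mul// exprS -mulrA mulr_natl mulr2n.
have /bounded_uptoS[_ /(_ b) hf'] := hf.
have /bounded_uptoS[_ /(_ b) hg'] := hg.
have sf' := smooth_cderive b sf; have sg' := smooth_cderive b sg.
apply: bounded_upto_add; try exact: smooth_mul.
  by apply: IH => //; apply: bounded_upto_sub hg.
by apply: IH => //; apply: bounded_upto_sub hf.
Qed.

Lemma bounded_upto_scale m K c f A : smooth f -> bounded_upto m K f A ->
  bounded_upto m K (fun a => c * f a) (complex.Re `|c| * A).
Proof.
move=> sf hf s a sm Ka.
have -> : foldr cderive (fun a => c * f a) s = fun a => c * foldr cderive f s a.
  elim: s {sm} => //= b s ->; rewrite cderive_scale//; exact: smooth_foldr.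
by rewrite normrM rmorphM; apply: ler_pM => //; exact: hf.
Qed.

Lemma continuous_bounded (h : R * R -> R) K : (forall a, differentiable h a) ->
  compact K -> exists2 M, 0 <= M & forall a, K a -> `|h a| <= M.
Proof.
move=> dh cK.
have /compact_bounded : compact (h @` K).
  apply: continuous_compact => //; apply: continuous_subspaceT => a.
  exact: differentiable_continuous.
move=> /pinfty_ex_gt0[M M0 HM]; exists M; first exact: ltW.
by move=> a Ka; apply: HM; exists a.
Qed.

Lemma norm_le_ReIm (z : R[i]) (A B : R) : `|complex.Re z| <= A ->
  `|complex.Im z| <= B -> `|z| <= (A + B)%:C.
Proof.
move=> hA hB; case: z hA hB => x y /= hA hB.
have -> : x +i* y = x%:C + 'i * y%:C by rewrite {1}(complexE (x +i* y)).
rewrite (le_trans (ler_normD _ _))// rmorphD normrM.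
have -> : `|'i%C : R[i]| = 1 by rewrite normc_def /= expr0n add0r expr1n sqrtr1.
rewrite mul1r lerD//; rewrite normc_def /= expr0n addr0 sqrtr_sqr lecR//.
Qed.

Lemma bounded_upto_exists m K f : smooth f -> compact K ->
  exists2 M, 0 <= M & bounded_upto m K f M.
Proof.
move=> + cK; elim: m f => [|m IH] f sf.
  have [M1 M10 H1] := continuous_bounded (fun a => (smooth_cdiff a sf).1) cK.
  have [M2 M20 H2] := continuous_bounded (fun a => (smooth_cdiff a sf).2) cK.
  exists (M1 + M2); first exact: addr_ge0.
  by move=> [|//] a _ Ka; apply: norm_le_ReIm; [exact: H1|exact: H2].
have [M1 M10 H1] := continuous_bounded (fun a => (smooth_cdiff a sf).1) cK.
have [M2 M20 H2] := continuous_bounded (fun a => (smooth_cdiff a sf).2) cK.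
have [M3 M30 H3] := IH _ (smooth_cderive false sf).
have [M4 M40 H4] := IH _ (smooth_cderive true sf).
exists (M1 + M2 + (M3 + M4)); first by rewrite !addr_ge0.
apply/bounded_uptoS; split.
  move=> a Ka; apply: (@le_trans _ _ (M1 + M2)%:C).
    by apply: norm_le_ReIm; [exact: H1|exact: H2].
  by rewrite lecR lerDl addr_ge0.
case.
  by apply: bounded_upto_le H4; rewrite addrA lerDr !addr_ge0.
by apply: bounded_upto_le H3; rewrite addrCA lerDl !addr_ge0.
Qed.

Lemma foldr_cderive_off s (U : set (R * R)) f a : open U ->
  (forall x, U x -> f x = 0) -> U a -> foldr cderive f s a = 0.
Proof.
move=> oU; elim: s f a => [|b s IH] f a f0 Ua /=; first exact: f0.
have U0 x : U x -> foldr cderive f s x = 0 by exact: IH.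
have nU : \forall x \near a, U x by exact: open_nbhs_nbhs.
rewrite /cderive (@near_eq_derive _ _ _ _ (cst 0)) ?derive_cst; last first.
  by apply: filterS nU => x /U0 ->.
rewrite (@near_eq_derive _ _ _ (fun x => complex.Im (foldr cderive f s x)) (cst 0)) ?derive_cst//.
by apply: filterS nU => x /U0 ->.
Qed.

(** The continuity bound on test functions is transferred to smooth functions by a
cutoff that is 1 near the support of w and 0 where |c| > r'. Keeping the compact
set inside |c| <= r' matters: the powers of c are dominated by those of r'. *)
Lemma pairing_continuous w (c : R * R -> R) (r r' : R) :
  is_distribution w -> tame w -> smooth (fun a => (c a)%:C) ->
  0 <= r -> r < r' -> (forall a, supp w a -> `|c a| <= r) ->
  exists K m (C : R), [/\ compact K, forall a, K a -> `|c a| <= r', 0 <= C &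
    forall f M, smooth f -> 0 <= M -> bounded_upto m K f M ->
      `|pairing w f| <= (C * M)%:C].
Proof.
move=> [_ dw] tw sc r0 rr' sr.
have [chi0 [U0 [tchi0 oU0 sU0 chi01 _]]] := tame_cutoff tw.
have ccont : continuous c.
  by move=> a; apply: differentiable_continuous; have [] := smooth_cdiff a sc.
have cncont : continuous (fun a => `|c a|).
  by move=> a; apply: continuous_comp; [exact: ccont|exact: norm_continuous].
(* The cutoff is 1 where |c| <= r1, which leaves room for an open neighbourhood of
   the support. *)
pose r1 := (r + r') / 2.
have rr1 : r < r1 by rewrite /r1; lra.
have r1r' : r1 < r' by rewrite /r1; lra.
have [chi1 [schi1 chi11 chi10]] := cutoff sc (le_trans r0 (ltW rr1)) r1r'.
pose chi a := chi0 a * chi1 a.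
have tchi : test_function chi by exact: test_mulr.
have [m [c0 H]] := dw _ (proj2 tchi).
have [A A0 HA] := bounded_upto_exists m (test_smooth tchi) (proj2 tchi).
exists (fsupport chi), m, (`|c0| * (2 ^+ m * A)); split.
- exact: (proj2 tchi).
- have cl : closed [set a | `|c a| <= r'].
    have := @closed_comp _ _ (fun a => `|c a|) [set x | x <= r'].
    apply; last exact: closed_le.
    by move=> a _; exact: cncont.
  have : fsupport chi `<=` [set a | `|c a| <= r'].
    rewrite [X in _ `<=` X]((closure_id _).1 cl); apply: closure_subset.
    move=> a; rewrite /= /chi mulf_eq0 negb_or => /andP[_ h].
    rewrite leNgt; apply/negP => /ltW /chi10 E.
    by move: h; rewrite E eqxx.
  by move=> S a /S.
- by rewrite !mulr_ge0// exprn_ge0.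
move=> f M sf M0 hf.
have tf : test_function (fun a => chi a * f a) by exact: test_mulr.
rewrite (pairing_test (proj1 tw) (phi := fun a => chi a * f a)
   (U := U0 `&` [set a | `|c a| < r1])) //; last first.
- by move=> a [h1 /ltW h2]; rewrite /chi chi01// chi11// !mul1r.
- by move=> a sa; split; [exact: sU0|exact: le_lt_trans (sr _ sa) rr1].
- apply: openI => //; have := @open_comp _ _ (fun a => `|c a|) [set x | x < r1].
  apply; last exact: open_lt.
  by move=> a _; exact: cncont.
have B := bounded_upto_mul (test_smooth tchi) sf HA hf.
have M'0 : 0 <= 2 ^+ m * (A * M) by rewrite !mulr_ge0// exprn_ge0.
apply: (@le_trans _ _ (c0 * (2 ^+ m * (A * M)))%:C).
  apply: H => //.
    by apply: fsupport_sub => a ->; rewrite mul0r.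
  move=> s a sm; rewrite partialE.
  have [sa|nsa] := pselect (fsupport chi a); first exact: B.
  rewrite (@foldr_cderive_off _ (~` fsupport chi)) ?normr0 ?lecR//.
    by apply: closed_openC; exact: closed_closure.
  by move=> x /fsupport_out ->; rewrite mul0r.
by rewrite lecR -!mulrA; apply: ler_wpM2r => //; exact: ler_norm.
Qed.

End Bounds.

(** * Remainders of the exponential series *)

Section ExponentialTail.
Variable R : realType.

(** Up to a shift of N, this family is stable under differentiation. *)
Definition exp_tail (N : nat) (z : R[i]) : R[i] :=
  cexp z - \sum_(j < N) (j`!)%:R^-1 * z ^+ j.

Lemma exp_tailS N z : exp_tail N.+1 z = exp_tail N z - (N`!)%:R^-1 * z ^+ N.
Proof. by rewrite /exp_tail big_ord_recr /= opprD addrA. Qed.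

Lemma smooth_exp_tail N (f : R * R -> R[i]) : smooth f ->
  smooth (fun a => exp_tail N (f a)).
Proof.
move=> sf; apply: smooth_sub; first exact: smooth_exp.
by apply: smooth_sum => j; apply: smooth_scale; exact: smooth_exprn.
Qed.

Lemma cderive_exp_tail b N (f : R * R -> R[i]) : smooth f ->
  cderive b (fun a => exp_tail N (f a)) = fun a => exp_tail N.-1 (f a) * cderive b f a.
Proof.
move=> sf; have E0 g : exp_tail 0 g = cexp g.
  by rewrite /exp_tail big_ord0 subr0.
elim: N => [|N IH].
  have -> : (fun a => exp_tail 0 (f a)) = fun a => cexp (f a).
    by apply/funext => a; rewrite E0.
  by rewrite cderive_exp//; apply/funext => a; rewrite E0.
have -> : (fun a => exp_tail N.+1 (f a)) =
    fun a => exp_tail N (f a) + (- (N`!)%:R^-1) * f a ^+ N.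
  by apply/funext => a; rewrite exp_tailS mulNr.
rewrite cderive_add ?IH; [|exact: smooth_exp_tail|]; last first.
  by apply: smooth_scale; exact: smooth_exprn.
rewrite cderive_scale ?cderive_exprn//; last exact: smooth_exprn.
apply/funext => a /=; case: N {IH} => [|N] /=.
  by rewrite mul0r mul0r mulr0 addr0.
rewrite exp_tailS factS natrM invfM.
have : (N.+1%:R : R[i]) != 0 by rewrite pnatr_eq0.
have : ((N`!)%:R : R[i]) != 0 by rewrite pnatr_eq0 -lt0n fact_gt0.
by move=> h1 h2; field; rewrite h1 addrC natr1.
Qed.

(** The slope along the ray through z is the partial derivative along the first
axis of a function on the plane that depends on the first variable only. *)
Lemma is_derive_ray N (z : R[i]) (s : R) :
  is_derive s 1 (fun s : R => complex.Re (exp_tail N (s%:C * z)))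
    (complex.Re (exp_tail N.-1 (s%:C * z) * z)) /\
  is_derive s 1 (fun s : R => complex.Im (exp_tail N (s%:C * z)))
    (complex.Im (exp_tail N.-1 (s%:C * z) * z)).
Proof.
pose f (a : R * R) := a.1%:C * z.
have sf : smooth f.
  by apply: smooth_mul; [exact: smooth_fst|exact: smooth_cst].
have sE := smooth_exp_tail N sf.
have cf : cderive false f = fun=> z.
  rewrite /f cderive_mul; [|exact: smooth_fst|exact: smooth_cst].
  rewrite cderive_cst; apply/funext => a; rewrite mulr0 addr0.
  by have [_ ->] := has_cderive_fst a; rewrite mul1r.
have := cderive_exp_tail false N sf; rewrite cf => /(congr1 (fun h => h (s, 0))) /=.
have [dR dI] := smooth_cdiff (s, 0) sE.
rewrite {1}/cderive => E.
have key (h : R * R -> R) : differentiable h (s, 0) ->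
    is_derive s 1 (fun s => h (s, 0)) ('D_(axis R false) h (s, 0)).
  move=> /(diff_derivable (v := axis R false)) dh.
  have EE : (fun k : R => k^-1 *: (h (k *: 1 + s, 0) - h (s, 0))) =
      (fun k : R => k^-1 *: (h (k *: axis R false + (s, 0)) - h (s, 0))).
    apply/funext => k; congr (_ *: (h _ - _)).
    by congr pair; rewrite /= ?scaler0 ?addr0.
  split; first by rewrite /derivable EE.
  by rewrite /derive EE.
split.
  have := key _ dR; rewrite -[X in complex.Re X]E; exact.
by have := key _ dI; rewrite -[X in complex.Im X]E; exact.
Qed.

(** The functions A s^(N+1) / (N+1) - h(s) and A s^(N+1) / (N+1) + h(s) are
nondecreasing. *)
Lemma derivative_power_bound (h dh : R -> R) (A : R) (N : nat) : 0 <= A ->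
  (forall s : R, is_derive s 1 h (dh s)) -> h 0 = 0 ->
  (forall s, 0 <= s <= 1 -> `|dh s| <= A * s ^+ N) ->
  forall s, 0 <= s <= 1 -> `|h s| <= A / N.+1%:R * s ^+ N.+1.
Proof.
move=> A0 dH h0 bd s /andP[s0 s1].
have key (e : R) : `|e| = 1 -> e * h s <= A / N.+1%:R * s ^+ N.+1.
  move=> e1.
  pose q : R -> R := fun s : R => A / N.+1%:R * s ^+ N.+1 - e * h s.
  have dq (s' : R) : is_derive s' 1 q (A * s' ^+ N - e * dh s').
    have d1 : is_derive s' 1 (fun s : R => s ^+ N.+1) (N.+1%:R * s' ^+ N).
      have H := @is_deriveX _ _ id N.+1 s' 1 1 (is_derive_id _ _).
      rewrite exprfctE in H. apply: (is_derive_eq H).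
      by rewrite /GRing.scale/= mulr1.
    have d2 : is_derive s' 1 (fun s => A / N.+1%:R * s ^+ N.+1) (A * s' ^+ N).
      have H := @is_deriveZ _ _ _ _ (A / N.+1%:R) _ _ _ d1.
      apply: (is_derive_eq H); rewrite /GRing.scale/=.
      by rewrite mulrA divfK// pnatr_eq0.
    have d3 : is_derive s' 1 (fun s => e * h s) (e * dh s').
      by have := @is_deriveZ _ _ _ _ e _ _ _ (dH s').
    exact: is_deriveB.
  have : q 0 <= q s.
    apply: (@ger0_derive1_ndecr _ q 0 1) => //.
    - move=> x; rewrite in_itv/= => /andP[x0 x1].
      rewrite derive1E; have [_ ->] := dq x; rewrite subr_ge0.
      rewrite (le_trans (ler_norm _))// normrM e1 mul1r bd//.
      by rewrite !ltW.
    - by apply: derivable_within_continuous => x _; case: (dq x).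
  by rewrite /q h0 expr0n /= !mulr0 subr0 subr_ge0.
rewrite ler_norml; apply/andP; split.
  by rewrite lerNl -mulN1r key// normrN1.
by rewrite -[h s]mul1r key// normr1.
Qed.

(** Integrating along the segment from 0 to z bounds the tails by (2 B)^N / N!; the
factor 2 comes from estimating real and imaginary parts separately, and the
factorial absorbs it together with the power of 2 of the conclusion. *)
Lemma exp_tail_bound (B : R) : 0 <= B -> exists2 C, 0 <= C &
  forall N (z : R[i]), `|z| <= B%:C -> `|exp_tail N z| <= (C * 2^-1 ^+ N)%:C.
Proof.
move=> B0; exists (2 * expR B * expR (4 * B)).
  by rewrite !mulr_ge0// ?expR_ge0.
move=> N z zB.
have zRe : `|complex.Re z| <= B.
  by rewrite -lecR (le_trans (normc_ge_Re z)).
have zIm : `|complex.Im z| <= B.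
  rewrite -lecR; apply: le_trans zB; rewrite -[complex.Im z]opprK -ReiNIm normrN.
  rewrite (le_trans (normc_ge_Re _))// normrM.
  have -> : `|'i%C : R[i]| = 1 by rewrite normc_def /= expr0n add0r expr1n sqrtr1.
  by rewrite mulr1.
have H M s : 0 <= s <= 1 ->
    `|complex.Re (exp_tail M (s%:C * z))| <= expR B * (2 * B) ^+ M / M`!%:R * s ^+ M /\
    `|complex.Im (exp_tail M (s%:C * z))| <= expR B * (2 * B) ^+ M / M`!%:R * s ^+ M.
  elim: M s => [|M IH] s s01.
    have [s0 s1] := andP s01.
    rewrite /exp_tail big_ord0 subr0 fact0 divr1 !expr0 !mulr1 /cexp.
    have E1 : expR (complex.Re (s%:C * z)) <= expR B.
      rewrite ler_expR; case: z zRe {zB zIm} => x y /= zRe.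
      rewrite mul0r subr0 (le_trans (ler_norm _))// normrM (ger0_norm s0).
      by rewrite -[B]mul1r ler_pM.
    split; rewrite /= mul0r ?subr0 ?addr0 normrM ger0_norm ?expR_ge0//.
      rewrite -[expR B]mulr1 ler_pM ?expR_ge0// ler_norml cos_geN1 cos_le1//.
    rewrite -[expR B]mulr1 ler_pM ?expR_ge0// ler_norml sin_geN1 sin_le1//.
  pose A := expR B * (2 * B) ^+ M.+1 / M`!%:R.
  have A0 : 0 <= A by rewrite !mulr_ge0 ?expR_ge0 ?invr_ge0 ?ler0n// exprn_ge0// mulr_ge0.
  have -> : expR B * (2 * B) ^+ M.+1 / M.+1`!%:R = A / M.+1%:R.
    by rewrite factS natrM invfM /A; ring.
  have b0 (x : R) : 0 * z = 0 by rewrite mul0r.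
  have t0 : exp_tail M.+1 (0%:C * z) = 0.
    rewrite mul0r /exp_tail big_ord_recl /= expr0 mulr1 fact0 invr1.
    rewrite big1 => [|j _]; last by rewrite expr0n mulr0.
    rewrite addr0 /cexp /= expR0 cos0 sin0.
    by rewrite mul1r subrr.
  have HH s' : 0 <= s' <= 1 ->
     `|complex.Re (exp_tail M (s'%:C * z) * z)| <= A * s' ^+ M /\
     `|complex.Im (exp_tail M (s'%:C * z) * z)| <= A * s' ^+ M.
    move=> /IH; set D := _ * s' ^+ M.
    have -> : A * s' ^+ M = D * B + D * B.
      by rewrite /A /D exprS; ring.
    case: (exp_tail _ _) => u v /= [h1 h2].
    case: z zRe zIm {zB IH t0 b0} => x y /= zRe zIm.
    split; [rewrite (le_trans (ler_normB _ _))//|rewrite (le_trans (ler_normD _ _))//];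
      by rewrite !normrM lerD// ler_pM.
  split.
    apply: (@derivative_power_bound (fun s => complex.Re (exp_tail M.+1 (s%:C * z)))
      (fun s => complex.Re (exp_tail M (s%:C * z) * z))) => //.
    - by move=> s'; have [] := is_derive_ray M.+1 z s'.
    - by rewrite t0.
    - by move=> s' /HH[].
  apply: (@derivative_power_bound (fun s => complex.Im (exp_tail M.+1 (s%:C * z)))
    (fun s => complex.Im (exp_tail M (s%:C * z) * z))) => //.
  - by move=> s'; have [] := is_derive_ray M.+1 z s'.
  - by rewrite t0.
  - by move=> s' /HH[].
have [|h1 h2] := H N 1; first by rewrite ler01 lexx.
rewrite expr1n mulr1 in h1 h2; rewrite rmorph1 mul1r in h1 h2.
apply: le_trans (norm_le_ReIm h1 h2) _; rewrite lecR.
have F : (4 * B) ^+ N / N`!%:R <= expR (4 * B).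
  have B4 : 0 <= 4 * B by rewrite mulr_ge0.
  case: N {H h1 h2} => [|N]; first by rewrite expr0 fact0 divr1 (le_trans _ (expR_ge1Dx _))// lerDl.
  by apply: le_trans (expR_ge1Dxn N B4); rewrite lerDr.
have -> : expR B * (2 * B) ^+ N / N`!%:R + expR B * (2 * B) ^+ N / N`!%:R =
    2 * expR B * ((4 * B) ^+ N / N`!%:R) * 2^-1 ^+ N.
  have -> : (4 : R) = 2 * 2 by rewrite -natrM.
  rewrite -[2 * 2 * B]mulrA [(2 * (2 * B)) ^+ N]exprMn.
  have E : (2 : R) ^+ N * 2^-1 ^+ N = 1 by rewrite -exprMn divff ?expr1n// pnatr_eq0.
  rewrite -[LHS]mulr1 -[X in _ * X = _]E; move: ((2 * B) ^+ N) (2 ^+ N) (2^-1 ^+ N) => X Y Z; ring.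
apply: ler_wpM2r; first by rewrite exprn_ge0.
by apply: ler_wpM2l F; rewrite mulr_ge0// expR_ge0.
Qed.

End ExponentialTail.

(** * Geometric and exponential expansions inside a pairing *)

Section Families.
Variable R : realType.
Implicit Types (f g phi : R * R -> R[i]) (a : R * R) (w : functional R).
Implicit Types (K : set (R * R)) (m N : nat) (z : R[i]).

Lemma norm_real (x : R) : `|x%:C| = `|x|%:C :> R[i].
Proof. by rewrite normc_def /= expr0n addr0 sqrtr_sqr. Qed.

Lemma cauchy_den z (x : R) : complex.Im z != 0 -> z - x%:C != 0.
Proof. by case: z => u v /= v0; rewrite eq_complex /= subr0 (negbTE v0) andbF. Qed.

Lemma smooth_cauchy z f : complex.Im z != 0 -> smooth f ->
  (forall a, complex.Im (f a) = 0) -> smooth (fun a => (z - f a)^-1).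
Proof.
move=> z0 sf f0; apply: smooth_inv.
  by apply: smooth_sub => //; exact: smooth_cst.
move=> a; rewrite eq_complex negb_and; apply/orP; right.
by move: (f0 a); case: (f a) z0 => u v; case: z => x y /= + ->; rewrite subr0.
Qed.

Section Compact.
Variables (K : set (R * R)) (c : R * R -> R) (r' : R).
Hypotheses (cK : compact K) (sc : smooth (fun a => (c a)%:C))
  (Kc : forall a, K a -> `|c a| <= r').

(** A derivative of 1/(z - c) is a derivative of c times the square of 1/(z - c),
so that each order of differentiation is controlled by the preceding one. *)
Lemma cauchy_bounded m r : r' < r -> exists2 C, 0 <= C & forall z,
  `|z| = r%:C -> complex.Im z != 0 ->
  bounded_upto m K (fun a => (z - (c a)%:C)^-1) C.
Proof.
move=> rr'; elim: m => [|m [C C0 IH]].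
  exists (r - r')^-1; first by rewrite invr_ge0 subr_ge0 ltW.
  move=> z zr z0 [|//] a _ Ka /=.
  rewrite normfV fmorphV lef_pV2 ?posrE ?normr_gt0 ?cauchy_den//; last first.
    by rewrite ltcR subr_gt0.
  apply: le_trans (lerB_dist _ _); rewrite zr rmorphB lerD2l lerN2.
  by rewrite norm_real lecR Kc.
have [M1 M10 H1] := bounded_upto_exists m (smooth_cderive false sc) cK.
have [M2 M20 H2] := bounded_upto_exists m (smooth_cderive true sc) cK.
pose D := 2 ^+ m * ((M1 + M2) * (2 ^+ m * (C * C))).
have D0 : 0 <= D by rewrite !mulr_ge0 ?exprn_ge0 ?addr_ge0// ?mulr_ge0.
exists (C + D); first exact: addr_ge0.
move=> z zr z0; have sv := smooth_cauchy z0 sc (fun a => erefl).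
apply/bounded_uptoS; split=> [a Ka|b].
  by rewrite (le_trans (bounded_upto0 (IH z zr z0) Ka))// lecR lerDl.
have -> : cderive b (fun a => (z - (c a)%:C)^-1) =
    fun a => cderive b (fun a => (c a)%:C) a * ((z - (c a)%:C)^-1 * (z - (c a)%:C)^-1).
  rewrite cderive_inv; last 2 first.
  - by apply: smooth_sub => //; exact: smooth_cst.
  - by move=> a; exact: cauchy_den.
  apply/funext => a; rewrite expr2; congr (_ * _).
  have -> : (fun a => z - (c a)%:C) = (fun a => z + (-1) * (c a)%:C).
    by apply/funext => x; rewrite mulN1r.
  rewrite cderive_add ?cderive_cst ?cderive_scale//; [|exact: smooth_cst|exact: smooth_scale].
  by rewrite add0r mulN1r opprK.
apply: (@bounded_upto_le _ _ _ _ D); first by rewrite lerDr.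
apply: bounded_upto_mul; [exact: smooth_cderive|exact: smooth_mul| |].
  case: b; first by apply: bounded_upto_le H2; rewrite lerDr.
  by apply: bounded_upto_le H1; rewrite lerDl.
by apply: bounded_upto_mul => //; exact: IH.
Qed.

Lemma bernoulli_power (x d : R) N : 0 <= x -> 0 <= d ->
  N%:R * d * x ^+ N.-1 <= (x + d) ^+ N.
Proof.
move=> x0 d0; elim: N => [|N IH]; first by rewrite !mul0r expr0.
have le : x ^+ N <= (x + d) ^+ N by rewrite lerXn2r ?nnegrE ?addr_ge0// lerDl.
rewrite exprS mulrDl /= -natr1 mulrDl mul1r mulrDl lerD//; last exact: ler_wpM2l.
case: N IH {le} => [|N] IH; first by rewrite !mul0r mulr_ge0// exprn_ge0.
by rewrite exprS mulrCA ler_wpM2l.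
Qed.

(** A derivative of c^N costs a factor N, which is absorbed by a slightly larger
radius. *)
Lemma power_bounded m r2 : 0 < r' -> r' < r2 -> exists2 C, 0 <= C & forall N,
  bounded_upto m K (fun a => (c a)%:C ^+ N) (C * r2 ^+ N).
Proof.
move=> r'0; elim: m r2 => [|m IH] r2 rr2.
  exists 1 => // N [|//] a _ Ka /=; rewrite mul1r normrX rmorphXn.
  rewrite norm_real; apply: lerXn2r; rewrite ?nnegrE ?ler0c//.
    exact: le_trans (ltW r'0) (ltW rr2).
  by rewrite lecR; exact: le_trans (Kc Ka) (ltW rr2).
(* The induction hypothesis is used at r1, and the factor N is paid by passing
   from r1 to r2. *)
pose r1 := (r' + r2) / 2.
have rr1 : r' < r1 by rewrite /r1; lra.
have r12 : r1 < r2 by rewrite /r1; lra.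
have r10 : 0 <= r1 by apply: ltW; exact: lt_trans rr1.
have [C C0 HC] := IH r1 rr1.
have [M1 M10 H1] := bounded_upto_exists m (smooth_cderive false sc) cK.
have [M2 M20 H2] := bounded_upto_exists m (smooth_cderive true sc) cK.
pose D := 2 ^+ m * (2 ^+ m * (C * (M1 + M2))) / (r2 - r1).
have D0 : 0 <= D.
  rewrite mulr_ge0 ?invr_ge0 ?subr_ge0 ?(ltW r12)//.
  by rewrite !mulr_ge0 ?exprn_ge0 ?addr_ge0.
exists (1 + D); first by rewrite addr_ge0.
have r20 : 0 <= r2 by exact: le_trans (ltW r12).
move=> N; apply/bounded_uptoS; split=> [a Ka|b].
  apply: (@le_trans _ _ (r2 ^+ N)%:C); last first.
    by rewrite lecR ler_peMl ?exprn_ge0// lerDl.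
  rewrite normrX rmorphXn norm_real; apply: lerXn2r; rewrite ?nnegrE ?ler0c//.
  by rewrite lecR; exact: le_trans (Kc Ka) (ltW rr2).
rewrite cderive_exprn//.
have -> : (fun a => N%:R * (c a)%:C ^+ N.-1 * cderive b (fun a => (c a)%:C) a) =
    fun a => N%:R * ((c a)%:C ^+ N.-1 * cderive b (fun a => (c a)%:C) a).
  by apply/funext => a; rewrite mulrA.
have Hb : bounded_upto m K (cderive b (fun a => (c a)%:C)) (M1 + M2).
  case: b; first by apply: bounded_upto_le H2; rewrite lerDr.
  by apply: bounded_upto_le H1; rewrite lerDl.
have sp : smooth (fun a => (c a)%:C ^+ N.-1) by exact: smooth_exprn.
have sp' := smooth_mul sp (smooth_cderive b sc).
have := bounded_upto_scale N%:R sp'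
  (bounded_upto_mul sp (smooth_cderive b sc) (HC N.-1) Hb).
apply: bounded_upto_le; rewrite normr_nat.
have -> : complex.Re (N%:R : R[i]) = N%:R by rewrite -(rmorph_nat (real_complex R)).
have bern : N%:R * (r2 - r1) * r1 ^+ N.-1 <= r2 ^+ N.
  have := @bernoulli_power r1 (r2 - r1) N r10.
  by rewrite subr_ge0 [r1 + _]addrC subrK; apply; exact: ltW.
have d0 : 0 < r2 - r1 by rewrite subr_gt0.
apply: (@le_trans _ _ (D * r2 ^+ N)); last first.
  by rewrite ler_wpM2r ?exprn_ge0// lerDr.
have bern' : N%:R * r1 ^+ N.-1 <= r2 ^+ N / (r2 - r1).
  by rewrite ler_pdivlMr// mulrAC.
have -> : N%:R * (2 ^+ m * (C * r1 ^+ N.-1 * (M1 + M2))) =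
   (2 ^+ m * (C * (M1 + M2))) * (N%:R * r1 ^+ N.-1) by ring.
apply: (@le_trans _ _ ((2 ^+ m * (C * (M1 + M2))) * (r2 ^+ N / (r2 - r1)))).
  by apply: ler_wpM2l => //; rewrite !mulr_ge0 ?exprn_ge0 ?addr_ge0.
have -> : D * r2 ^+ N =
    2 ^+ m * ((2 ^+ m * (C * (M1 + M2))) * (r2 ^+ N / (r2 - r1))).
  by rewrite /D; ring.
rewrite ler_peMl ?exprn_ege1 ?ler1n//.
by rewrite !mulr_ge0 ?exprn_ge0 ?addr_ge0 ?invr_ge0 ?(ltW d0).
Qed.

(** Differentiating shifts N by one, which costs a factor 2 only. *)
Lemma exp_tail_bounded m f : smooth f -> exists2 C, 0 <= C & forall N,
  bounded_upto m K (fun a => exp_tail N (f a)) (C * 2^-1 ^+ N).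
Proof.
move=> sf; have [B B0 HB] := bounded_upto_exists 0 sf cK.
have [E E0 HE] := exp_tail_bound B0.
have HE' N a : K a -> `|exp_tail N (f a)| <= (E * 2^-1 ^+ N)%:C.
  by move=> Ka; apply: HE; exact: (bounded_upto0 HB).
have h0 N : 0 <= 2^-1 ^+ N :> R by rewrite exprn_ge0// invr_ge0.
elim: m => [|m [C C0 IH]].
  by exists E => // N [|//] a _ Ka; exact: HE'.
have [M1 M10 H1] := bounded_upto_exists m (smooth_cderive false sf) cK.
have [M2 M20 H2] := bounded_upto_exists m (smooth_cderive true sf) cK.
pose D := 2 ^+ m * (C * 2 * (M1 + M2)).
have D0 : 0 <= D by rewrite !mulr_ge0 ?exprn_ge0 ?addr_ge0.
exists (E + D); first exact: addr_ge0.
move=> N; apply/bounded_uptoS; split=> [a Ka|b].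
  by rewrite (le_trans (HE' N a Ka))// lecR ler_wpM2r// lerDl.
rewrite cderive_exp_tail//.
have Hb : bounded_upto m K (cderive b f) (M1 + M2).
  case: b; first by apply: bounded_upto_le H2; rewrite lerDr.
  by apply: bounded_upto_le H1; rewrite lerDl.
have := bounded_upto_mul (smooth_exp_tail N.-1 sf) (smooth_cderive b sf) (IH N.-1) Hb.
apply: bounded_upto_le.
have h : 2^-1 ^+ N.-1 <= 2 * 2^-1 ^+ N :> R.
  case: N => [|N] /=; first by rewrite expr0 mulr1 ler1n.
  by rewrite exprS mulrA divff ?mul1r.
apply: (@le_trans _ _ (D * 2^-1 ^+ N)); last by rewrite ler_wpM2r// lerDr.
have -> : 2 ^+ m * (C * 2^-1 ^+ N.-1 * (M1 + M2)) =
   2 ^+ m * C * (M1 + M2) * 2^-1 ^+ N.-1 by ring.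
have -> : D * 2^-1 ^+ N = 2 ^+ m * C * (M1 + M2) * (2 * 2^-1 ^+ N).
  by rewrite /D; ring.
by apply: ler_wpM2l => //; rewrite !mulr_ge0 ?exprn_ge0 ?addr_ge0.
Qed.

End Compact.

Section Expansion.
Variables (w : functional R) (c : R * R -> R) (rho r : R) (g : R * R -> R[i]).
Hypotheses (dw : is_distribution w) (tw : tame w)
  (sc : smooth (fun a => (c a)%:C)) (rho0 : 0 <= rho) (rhor : rho < r)
  (sw : forall a, supp w a -> `|c a| <= rho) (sg : smooth g).

Lemma pairing_cauchy_step z N : complex.Im z != 0 ->
  pairing w (fun a => g a * ((c a)%:C ^+ N * (z - (c a)%:C)^-1)) =
  z^-1 * pairing w (fun a => g a * (c a)%:C ^+ N) +
  z^-1 * pairing w (fun a => g a * ((c a)%:C ^+ N.+1 * (z - (c a)%:C)^-1)).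
Proof.
move=> z0; have sv := smooth_cauchy z0 sc (fun a => erefl).
have sp n : smooth (fun a => (c a)%:C ^+ n) by exact: smooth_exprn.
have zn0 : z != 0 by apply: contraNneq z0 => ->.
rewrite -!pairing_scale//; last 2 first.
- by do ?apply: smooth_mul.
- by do ?apply: smooth_mul.
rewrite -pairing_add//; last 2 first.
- by apply: smooth_scale; do ?apply: smooth_mul.
- by apply: smooth_scale; do ?apply: smooth_mul.
congr pairing; apply/funext => a; rewrite exprS.
by field; rewrite cauchy_den.
Qed.

Lemma pairing_cauchy_expand z N : complex.Im z != 0 ->
  pairing w (fun a => g a * (z - (c a)%:C)^-1) =
  \sum_(n < N) z ^- n.+1 * pairing w (fun a => g a * (c a)%:C ^+ n) +
  z ^- N * pairing w (fun a => g a * ((c a)%:C ^+ N * (z - (c a)%:C)^-1)).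
Proof.
move=> z0; elim: N => [|N IH].
  rewrite big_ord0 add0r expr0 invr1 mul1r; congr pairing; apply/funext => a.
  by rewrite mul1r.
rewrite IH big_ord_recr /= -addrA; congr (_ + _).
have -> : z ^- N.+1 = z ^- N * z^-1 by rewrite exprSr invfM.
by rewrite pairing_cauchy_step// mulrDr !mulrA.
Qed.

(** After N terms of the geometric series the remainder is z^-N times the pairing
with g c^N / (z - c), of size (r2 / r)^N for some r2 between rho and r. *)
Lemma pairing_cauchy_rate : exists C q, [/\ 0 <= C, 0 <= q < 1 &
  forall N z, `|z| = r%:C -> complex.Im z != 0 ->
  `|pairing w (fun a => g a * (z - (c a)%:C)^-1) -
    \sum_(n < N) z ^- n.+1 * pairing w (fun a => g a * (c a)%:C ^+ n)|
   <= (C * q ^+ N)%:C].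
Proof.
(* Three margins: for the cutoff, for the derivatives of the powers of c, and
   for the decay of the remainder. *)
pose r1 := (2 * rho + r) / 3.
pose r2 := (rho + 2 * r) / 3.
have h1 : rho < r1 by move: rhor; rewrite /r1; lra.
have h2 : r1 < r2 by move: rhor; rewrite /r1 /r2; lra.
have h3 : r2 < r by move: rhor; rewrite /r2; lra.
have r10 : 0 < r1 by exact: le_lt_trans h1.
have r20 : 0 < r2 by exact: lt_trans h2.
have r0 : 0 < r by exact: lt_trans h3.
have [K [m [A [cK Kc A0 HA]]]] := pairing_continuous dw tw sc rho0 h1 sw.
have [B B0 HB] := cauchy_bounded cK sc Kc m (lt_trans h2 h3).
have [D D0 HD] := power_bounded cK sc Kc m r10 h2.
have [E E0 HE] := bounded_upto_exists m sg cK.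
exists (A * (2 ^+ m * (E * (2 ^+ m * (D * B))))), (r2 / r); split.
- by rewrite !mulr_ge0 ?exprn_ge0.
- by rewrite divr_ge0 ?(ltW r20) ?(ltW r0)//= ltr_pdivrMr// mul1r.
move=> N z zr z0; rewrite (pairing_cauchy_expand N)//.
rewrite addrAC subrr add0r normrM normfV normrX zr.
have sv := smooth_cauchy z0 sc (fun a => erefl).
have sp : smooth (fun a => (c a)%:C ^+ N) by exact: smooth_exprn.
have sF : smooth (fun a => g a * ((c a)%:C ^+ N * (z - (c a)%:C)^-1)).
  by do ?apply: smooth_mul.
have b := bounded_upto_mul sg (smooth_mul sp sv) HE
  (bounded_upto_mul sp sv (HD N) (HB z zr z0)).
have M0 : 0 <= 2 ^+ m * (E * (2 ^+ m * (D * r2 ^+ N * B))).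
  by rewrite !mulr_ge0 ?exprn_ge0// ltW.
have := HA _ _ sF M0 b; move=> H.
apply: (@le_trans _ _ ((r%:C ^+ N)^-1 *
   (A * (2 ^+ m * (E * (2 ^+ m * (D * r2 ^+ N * B)))))%:C)).
  apply: ler_wpM2l => //; rewrite invr_ge0 exprn_ge0// ler0c ltW//.
rewrite -rmorphXn -fmorphV -rmorphM lecR (expr_div_n r2 r).
rewrite le_eqVlt; apply/orP; left; apply/eqP.
move: (r2 ^+ N) (r ^- N) (2 ^+ m) => X Y Z; ring.
Qed.

Lemma pairing_cauchy_bounded : exists2 C, 0 <= C &
  forall z, `|z| = r%:C -> complex.Im z != 0 ->
  `|pairing w (fun a => g a * (z - (c a)%:C)^-1)| <= C%:C.
Proof.
have [C [q [C0 _ H]]] := pairing_cauchy_rate; exists C => // z zr z0.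
by have := H 0%N z zr z0; rewrite big_ord0 subr0 expr0 mulr1.
Qed.

Lemma pairing_exp_tail f : smooth f -> exists2 C, 0 <= C &
  forall N, `|pairing w (fun a => g a * exp_tail N (f a))| <= (C * 2^-1 ^+ N)%:C.
Proof.
move=> sf.
have [K [m [A [cK Kc A0 HA]]]] := pairing_continuous dw tw sc rho0 rhor sw.
have [B B0 HB] := exp_tail_bounded cK m sf.
have [E E0 HE] := bounded_upto_exists m sg cK.
exists (A * (2 ^+ m * (E * B))); first by rewrite !mulr_ge0 ?exprn_ge0.
move=> N; have sF := smooth_mul sg (smooth_exp_tail N sf).
have b := bounded_upto_mul sg (smooth_exp_tail N sf) HE (HB N).
have M0 : 0 <= 2 ^+ m * (E * (B * 2^-1 ^+ N)).
  by rewrite !mulr_ge0 ?exprn_ge0 ?invr_ge0.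
by have := HA _ _ sF M0 b; rewrite !mulrA.
Qed.

End Expansion.
End Families.

(** * Integration over the angle *)

Section RealIntegral.
Variable R : realType.
Local Notation mu := (@lebesgue_measure R).
Local Notation D := `[0 : R, 2 * pi]%classic.

Lemma circle_measurable : measurable D.
Proof. exact: measurable_itv. Qed.

Lemma circle_measure : mu D = (2 * pi)%:E.
Proof.
rewrite lebesgue_measure_itv /= lte_fin mulr_gt0 ?pi_gt0//.
by rewrite oppr0 adde0.
Qed.

Lemma measurable_fun_point (x : R) (h : R -> R) : measurable_fun [set x] h.
Proof.
move=> _ Y mY; have [hx|hx] := pselect (Y (h x)).
  rewrite (_ : _ `&` _ = [set x]); first exact: measurable_set1.
  by apply/seteqP; split=> [y []|y ->].
rewrite (_ : _ `&` _ = set0); first exact: measurable0.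
by apply/seteqP; split=> [y [-> /hx]|].
Qed.

(** The angles at which the circle meets the real axis, where a Cauchy kernel may
be singular on the support. *)
Definition real_points : set R := [set 0] `|` [set pi] `|` [set 2 * pi].

Lemma real_points_measurable : measurable real_points.
Proof.
by apply: measurableU; [apply: measurableU|]; exact: measurable_set1.
Qed.

Lemma real_points_null : mu real_points = 0%E.
Proof.
apply: countable_lebesgue_measure0; apply: finite_set_countable.
by rewrite /real_points !finite_setU.
Qed.

Lemma sin_neq0 (x : R) : D x -> ~ real_points x -> sin x != 0.
Proof.
rewrite /= in_itv /= => /andP[x0 x2] nx.
have xn0 : x != 0 by apply: contra_not_neq nx => ->; left; left.
have xnpi : x != pi by apply: contra_not_neq nx => ->; left; right.
have xn2 : x != 2 * pi by apply: contra_not_neq nx => ->; right.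
have x0' : 0 < x by rewrite lt_neqAle eq_sym xn0.
have x2' : x < 2 * pi by rewrite lt_neqAle xn2.
have [xpi|xpi] := ltP x pi; first by rewrite gt_eqF// sin_gt0_pi// x0'.
have xpi' : pi < x by rewrite lt_neqAle eq_sym xnpi.
rewrite -[x](subrK pi) sinDpi oppr_eq0 gt_eqF// sin_gt0_pi//.
by apply/andP; split; lra.
Qed.

(** The exceptional angles form a null set, and measurability on it is automatic
because it is finite. *)
Lemma integral_limit (hN : nat -> R -> R) (h : R -> R) (C q : R) :
  0 <= q < 1 -> (forall n, mu.-integrable D (EFin \o hN n)) ->
  (forall n x, D x -> ~ real_points x -> `|h x - hN n x| <= C * q ^+ n) ->
  mu.-integrable D (EFin \o h) /\ forall n,
   `|(\int[mu]_(x in D) h x) - (\int[mu]_(x in D) hN n x)| <= C * q ^+ n * (2 * pi).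
Proof.
move=> /andP[q0 q1] iN bd; pose E := D `\` real_points.
have mD := circle_measurable.
have mE : measurable E by apply: measurableD => //; exact: real_points_measurable.
have muE : (mu E < +oo)%E.
  apply: (@le_lt_trans _ _ (mu D)); last by rewrite circle_measure ltry.
  by apply: le_measure; rewrite ?inE//; exact: subDsetl.
have iNE n : mu.-integrable E (EFin \o hN n).
  by apply: integrableS (iN n) => //; exact: subDsetl.
have mhN n : measurable_fun E (hN n).
  by apply/measurable_EFinP; exact: measurable_int (iNE n).
have mhE : measurable_fun E h.
  apply: (@measurable_fun_cvg _ _ _ _ hN) => // x [Dx nx].
  apply/cvgrPdist_le => e e0.
  have : (fun n => C * q ^+ n) @ \oo --> C * 0.
    apply: cvgM; first exact: cvg_cst.
    by apply: cvg_expr; rewrite ger0_norm.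
  rewrite mulr0 => /cvgrPdist_le/(_ e e0); apply: filterS => n.
  rewrite sub0r normrN => H; apply: le_trans (bd n x Dx nx) _.
  exact: le_trans (ler_norm _) H.
have mhD : measurable_fun D h.
  apply: (@measurable_funS _ _ _ _ (E `|` ([set 0] `|` [set pi] `|` [set 2 * pi]))).
  - by apply: measurableU => //; exact: real_points_measurable.
  - by move=> x Dx; have [nx|nx] := pselect (real_points x); [right|left].
  have m1 (x : R) : measurable [set x] by exact: measurable_set1.
  apply/(measurable_funU h mE (@real_points_measurable)); split=> //.
  apply/(measurable_funU h (measurableU _ _ (m1 0) (m1 pi)) (m1 (2 * pi))).
  split; last exact: measurable_fun_point.
  by apply/(measurable_funU h (m1 0) (m1 pi)); split; exact: measurable_fun_point.
have dN n : mu.-integrable E (EFin \o (fun x => h x - hN n x)).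
  apply: measurable_bounded_integrable => //; first exact: (measurable_funB mhE (mhN n)).
  exists (C * q ^+ n); split; first exact: num_real.
  move=> M HM x [Dx nx] /=; apply: le_trans (bd n x Dx nx) _; exact: ltW.
have hiE : mu.-integrable E (EFin \o h).
  have -> : EFin \o h = (EFin \o (fun x => h x - hN 0%N x)) \+ (EFin \o hN 0%N).
    by apply/funext => x /=; rewrite -EFinD subrK.
  exact: integrableD.
have hiD : mu.-integrable D (EFin \o h).
  have mfD : measurable_fun D (EFin \o h) by exact/measurable_EFinP.
  have := @negligible_integrable _ _ _ mu D real_points _ real_points_measurable
    mD mfD real_points_null.
  by move=> [_]; exact.
split=> // n.
have red f : mu.-integrable D (EFin \o f) ->
    \int[mu]_(x in D) f x = \int[mu]_(x in E) f x.
  move=> fi; rewrite /Rintegral; congr fine.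
  exact: (@negligible_integral _ _ _ mu D real_points _ real_points_measurable
    mD fi real_points_null).
rewrite !red// -RintegralB//.
have nrm := @le_normr_Rintegral _ _ _ mu E _ mE (dN n).
apply: (le_trans nrm).
have cE : mu.-integrable E (EFin \o cst (C * q ^+ n)).
  apply: measurable_bounded_integrable => //; exact: bounded_cst.
have nE : mu.-integrable E (EFin \o (fun x => `|h x - hN n x|)).
  have := integrable_abse (dN n); congr integrable.
have mono : \int[mu]_(x in E) `|h x - hN n x| <= \int[mu]_(x in E) cst (C * q ^+ n) x.
  by apply: le_Rintegral => // x [Dx nx]; exact: bd.
apply: (le_trans mono).
rewrite Rintegral_cst// ler_wpM2l//.
  have D1 : D 1.
    rewrite /= in_itv /= ler01 /=; have := pi_ge2 R; lra.
  have n1 : ~ real_points 1.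
    by have := pi_ge2 R => p2 [[|]|] /= h1; lra.
  by apply: le_trans (bd n 1 D1 n1); exact: normr_ge0.
rewrite -lee_fin fineK; last by rewrite ge0_fin_numE.
rewrite -circle_measure; apply: le_measure; rewrite ?inE//; exact: subDsetl.
Qed.

End RealIntegral.

(** * Contour integrals *)

Section ContourIntegral.
Variable R : realType.
Local Notation mu := (@lebesgue_measure R).
Local Notation D := `[0 : R, 2 * pi]%classic.

Definition angle_integral (h : R -> R) (v : R) :=
  mu.-integrable D (EFin \o h) /\ \int[mu]_(x in D) h x = v.

Lemma angle_integralD h1 h2 v1 v2 : angle_integral h1 v1 ->
  angle_integral h2 v2 -> angle_integral (fun x => h1 x + h2 x) (v1 + v2).
Proof.
move=> [i1 <-] [i2 <-]; split; last by rewrite RintegralD//; exact: circle_measurable.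
have mD := @circle_measurable R.
have := @integrableD _ _ _ mu D mD _ _ i1 i2; congr integrable.
Qed.

Lemma angle_integralZ c h v : angle_integral h v ->
  angle_integral (fun x => c * h x) (c * v).
Proof.
move=> [i1 <-]; split; last by rewrite RintegralZl//; exact: circle_measurable.
have mD := @circle_measurable R.
have := @integrableZl _ _ _ mu D mD c _ i1; congr integrable.
Qed.

Lemma angle_integral_derivative (f F : R -> R) :
  (forall x : R, is_derive x 1 F (f x)) -> continuous f ->
  angle_integral f (F (2 * pi) - F 0).
Proof.
move=> dF cf; have pi2 : (0 : R) < 2 * pi by rewrite mulr_gt0 ?pi_gt0.
have cF : continuous F.
  move=> x; apply: differentiable_continuous; apply/derivable1_diffP.
  by case: (dF x).
split.
  have := @continuous_compact_integrable R f D (@segment_compact R 0 (2 * pi)).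
  apply; exact: continuous_subspaceT.
rewrite /Rintegral (@continuous_FTC2 R f F)//.
- exact: continuous_subspaceT.
- split.
  + by move=> x _; case: (dF x).
  + by apply: cvg_at_right_filter; exact: cF.
  + by apply: cvg_at_left_filter; exact: cF.
- by move=> x _; rewrite derive1E; have [_ ->] := dF x.
Qed.

Definition integrand (r : R) (f : R[i] -> R[i]) (theta : R) : R[i] :=
  (0 +i* 1) * circle_point r theta * f (circle_point r theta).

(** Integrability is part of the notion, so that it is stable under sums and uniform
limits. *)
Definition has_circint (r : R) (f : R[i] -> R[i]) (v : R[i]) :=
  angle_integral (fun x => complex.Re (integrand r f x)) (complex.Re v) /\
  angle_integral (fun x => complex.Im (integrand r f x)) (complex.Im v).

Lemma has_circint_mx p r (f : R[i] -> 'M[R[i]]_p) (V : 'M[R[i]]_p) :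
  (forall i j, has_circint r (fun z => f z i j) (V i j)) -> circint r f = V.
Proof.
move=> H; apply/matrixP => i j; rewrite mxE.
have [[_ h1] [_ h2]] := H i j.
case: (V i j) h1 h2 => u v /= <- <-; by [].
Qed.

Lemma has_circintD r f g u v : has_circint r f u -> has_circint r g v ->
  has_circint r (fun z => f z + g z) (u + v).
Proof.
move=> [f1 f2] [g1 g2]; split.
  have := angle_integralD f1 g1; case: u v {f1 f2 g1 g2} => [? ?] [? ?] /=.
  congr angle_integral; apply/funext => x; rewrite /integrand mulrDr.
  by case: (_ * f _) => ? ?; case: (_ * g _).
have := angle_integralD f2 g2; case: u v {f1 f2 g1 g2} => [? ?] [? ?] /=.
congr angle_integral; apply/funext => x; rewrite /integrand mulrDr.
by case: (_ * f _) => ? ?; case: (_ * g _).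
Qed.

Lemma has_circintZ r c f v : has_circint r f v ->
  has_circint r (fun z => c * f z) (c * v).
Proof.
case: c => a b [f1 f2]; split.
  have := angle_integralD (angle_integralZ a f1) (angle_integralZ (- b) f2).
  case: v {f1 f2} => [? ?] /=; rewrite mulNr.
  congr angle_integral; apply/funext => x; rewrite /integrand mulrCA.
  by case: (_ * f _) => ? ? /=; rewrite mulNr.
have := angle_integralD (angle_integralZ a f2) (angle_integralZ b f1).
case: v {f1 f2} => [? ?] /=.
congr angle_integral; apply/funext => x; rewrite /integrand mulrCA.
by case: (_ * f _).
Qed.

Lemma has_circint0 r : has_circint r (fun=> 0) 0.
Proof.
have := angle_integral_derivative (fun x : R => is_derive_cst (0 : R) x 1)
  (@cst_continuous R R 0).
rewrite subr0 => h.
have E : integrand r (fun=> 0) = fun=> 0.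
  by apply/funext => x; rewrite /integrand mulr0.
by split; rewrite E.
Qed.

Lemma has_circint_sum r (I : Type) (s : seq I) (P : pred I) F V :
  (forall i, has_circint r (F i) (V i)) ->
  has_circint r (fun z => \sum_(i <- s | P i) F i z) (\sum_(i <- s | P i) V i).
Proof.
move=> H; elim: s => [|i s IH].
  rewrite big_nil; have := has_circint0 r; congr has_circint.
  by apply/funext => z; rewrite big_nil.
rewrite big_cons; case: (boolP (P i)) => Pi.
  have := has_circintD (H i) IH; congr has_circint.
  by apply/funext => z; rewrite big_cons Pi.
by move: IH; congr has_circint; apply/funext => z; rewrite big_cons (negbTE Pi).
Qed.

Definition cis (x : R) : R[i] := cos x +i* sin x.

Lemma circle_pointE r x : circle_point r x = r%:C * cis x.
Proof. by rewrite /circle_point /cis; simpc. Qed.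

Lemma norm_cis x : `|cis x| = 1.
Proof. by rewrite normc_def /= cos2Dsin2 sqrtr1. Qed.

Lemma norm_circle_point (r x : R) : 0 <= r -> `|circle_point r x| = r%:C.
Proof. by move=> r0; rewrite circle_pointE normrM norm_cis mulr1 norm_real ger0_norm. Qed.

Lemma cisD x y : cis (x + y) = cis x * cis y.
Proof. by rewrite /cis sinD cosD; simpc; rewrite [sin x * _ + _]addrC. Qed.

Lemma cis0 : cis 0 = 1.
Proof. by rewrite /cis cos0 sin0. Qed.

Lemma cis_neq0 x : cis x != 0.
Proof. by rewrite -normr_eq0 norm_cis oner_eq0. Qed.

Lemma cisXn x n : cis x ^+ n = cis (n%:R * x).
Proof.
elim: n => [|n IH]; first by rewrite expr0 mul0r cis0.
by rewrite exprS IH -cisD -natr1 mulrDl mul1r addrC.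
Qed.

Lemma cisN x : cis (- x) = (cis x)^-1.
Proof.
apply: (mulfI (cis_neq0 x)); rewrite -cisD subrr cis0 mulfV//; exact: cis_neq0.
Qed.

Lemma cisXz x (n : int) : cis x ^ n = cis (n%:~R * x).
Proof.
case: n => n; first exact: cisXn.
by rewrite NegzE -exprnN cisXn -cisN mulrNz mulNr.
Qed.

Lemma cis2pi (n : int) : cis (n%:~R * (2 * pi)) = 1.
Proof.
rewrite -cisXz (_ : cis _ = 1) ?exp1rz//.
by rewrite /cis mulr_natl cos2pi sin2pi.
Qed.

Lemma is_derive_linear (h : R -> R) (dh : R -> R) (c : R) (x : R) :
  (forall y : R, is_derive y 1 h (dh y)) ->
  is_derive x 1 (fun y => h (c * y)) (c * dh (c * x)).
Proof.
move=> hd.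
have d1 : is_derive x 1 (fun y : R => c * y) c.
  have H := @is_deriveZ _ _ _ id c x 1 1 (is_derive_id _ _).
  by apply: (is_derive_eq H); rewrite /GRing.scale/= mulr1.
have H := @is_derive1_comp R h (fun y => c * y) x _ _ (hd (c * x)) d1.
by apply: (is_derive_eq H); rewrite mulrC.
Qed.

(** For z = r e^(i x) the integrand is a multiple of e^(i m x) with m = n + 1,
which has a periodic primitive unless m = 0. *)
Lemma has_circint_monomial (r : R) (n : int) : 0 < r ->
  has_circint r (fun z => z ^ n)
    (if n == -1 then 0 +i* (2 * pi) else 0).
Proof.
move=> r0; pose m := n + 1.
have rC0 : r%:C != 0 :> R[i] by rewrite fmorph_eq0 gt_eqF.
have E x : integrand r (fun z => z ^ n) x = (0 +i* 1) * (r ^ m)%:C * cis (m%:~R * x).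
  rewrite /integrand circle_pointE -cisXz -[RHS]mulrA.
  have -> : (r ^ m)%:C * cis x ^ m = (r%:C * cis x) ^ m.
    rewrite exprzMl ?unitfE ?cis_neq0 ?rC0//; congr (_ * _).
    exact: (fmorphXz (real_complex R)).
  have z0 : r%:C * cis x != 0 by rewrite mulf_neq0 ?cis_neq0.
  by rewrite -mulrA /m expfzDr// expr1z; congr (_ * _); rewrite mulrC.
have [n1|n1] := eqVneq n (-1).
  have m0 : m = 0 by rewrite /m n1 addNr.
  split => /=.
    have := angle_integral_derivative (fun x : R => is_derive_cst (0 : R) x 1)
      (@cst_continuous R R 0).
    rewrite subr0; congr angle_integral; apply/funext => x.
    by rewrite E m0 expr0z mul0r cis0 mulr1 mulr1.
  have := angle_integral_derivative (fun x : R => is_derive_id x (1 : R))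
    (@cst_continuous R R 1).
  rewrite /= subr0; congr angle_integral; apply/funext => x.
  by rewrite E m0 expr0z mul0r cis0 mulr1 mulr1.
have m0 : (m%:~R : R) != 0.
  by rewrite intr_eq0 /m -[1]opprK subr_eq0.
have c2 : cos (m%:~R * (2 * pi)) = 1 :> R by have [] := cis2pi m.
have s2 : sin (m%:~R * (2 * pi)) = 0 :> R by have [] := cis2pi m.
split => /=.
  have d (x : R) : is_derive x 1 (fun y => cos (m%:~R * y)) (m%:~R * - sin (m%:~R * x) : R).
    exact: (is_derive_linear _ _ (fun y => is_derive_cos y)).
  have cont : continuous (fun x : R => m%:~R * - sin (m%:~R * x) : R).
    move=> x; apply: cvgM; first exact: cvg_cst.
    apply: cvgN; apply: continuous_comp; last exact: continuous_sin.
    by apply: cvgM; [exact: cvg_cst|exact: cvg_id].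
  have := angle_integralZ (r ^ m / m%:~R) (angle_integral_derivative d cont).
  rewrite c2 mulr0 cos0 subrr mulr0; congr angle_integral; apply/funext => x.
  rewrite E /cis /=; simpc; rewrite /=.
  by field.
have d (x : R) : is_derive x 1 (fun y => sin (m%:~R * y)) (m%:~R * cos (m%:~R * x) : R).
  exact: (is_derive_linear _ _ (fun y => is_derive_sin y)).
have cont : continuous (fun x : R => m%:~R * cos (m%:~R * x) : R).
  move=> x; apply: cvgM; first exact: cvg_cst.
  apply: continuous_comp; last exact: continuous_cos.
  by apply: cvgM; [exact: cvg_cst|exact: cvg_id].
have := angle_integralZ (r ^ m / m%:~R) (angle_integral_derivative d cont).
rewrite s2 mulr0 sin0 subrr mulr0; congr angle_integral; apply/funext => x.
rewrite E /cis /=; simpc; rewrite /=.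
by field.
Qed.

(** Estimates are needed at the nonreal points of the circle only, and there every
Cauchy kernel is smooth on the whole plane. *)
Lemma has_circint_limit (r : R) (F : nat -> R[i] -> R[i]) V f v (C q : R) :
  0 < r -> 0 <= q < 1 -> (forall n, has_circint r (F n) (V n)) ->
  (forall n z, `|z| = r%:C -> complex.Im z != 0 ->
     `|f z - F n z| <= (C * q ^+ n)%:C) ->
  (forall n, `|v - V n| <= (C * q ^+ n)%:C) ->
  has_circint r f v.
Proof.
move=> r0 q01 HF bd bv.
have im x : D x -> ~ real_points x -> complex.Im (circle_point r x) != 0.
  by move=> Dx nx; apply: mulf_neq0; [rewrite gt_eqF|exact: sin_neq0].
have bdi n x : D x -> ~ real_points x ->
    `|integrand r f x - integrand r (F n) x| <= (r * C * q ^+ n)%:C.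
  move=> Dx nx; rewrite /integrand -mulrBr !normrM norm_circle_point ?(ltW r0)//.
  have -> : `|0 +i* 1 : R[i]| = 1 by rewrite normc_def /= expr0n add0r expr1n sqrtr1.
  rewrite mul1r -mulrA rmorphM ler_pM2l; last by rewrite ltcR.
  by apply: bd; [rewrite norm_circle_point// ltW|exact: im].
have lim (h : R -> R) (hN : nat -> R -> R) (a : R) (aN : nat -> R) :
   (forall n, angle_integral (hN n) (aN n)) ->
   (forall n x, D x -> ~ real_points x -> `|h x - hN n x| <= r * C * q ^+ n) ->
   (forall n, `|a - aN n| <= C * q ^+ n) -> angle_integral h a.
  move=> iN hb ab.
  have [hi he] := integral_limit q01 (fun n => (iN n).1) hb.
  split=> //; apply/eqP; rewrite -subr_eq0 -normr_le0; apply/ler_addgt0Pl => e e0.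
  rewrite addr0.
  have : (fun n => (r * C * (2 * pi) + C) * q ^+ n) @ \oo --> (r * C * (2 * pi) + C) * 0.
    apply: cvgM; first exact: cvg_cst.
    by apply: cvg_expr; have /andP[q0 q1] := q01; rewrite ger0_norm.
  rewrite mulr0 => /cvgrPdist_le/(_ e e0)[n0 _ /(_ n0 (leqnn _))].
  rewrite sub0r normrN => H; apply: le_trans H; apply: le_trans (ler_norm _).
  rewrite -(subrKA (\int[mu]_(x in D) hN n0 x)).
  rewrite (le_trans (ler_normD _ _))//.
  have -> : (r * C * (2 * pi) + C) * q ^+ n0 =
    r * C * q ^+ n0 * (2 * pi) + C * q ^+ n0 by ring.
  rewrite lerD//.
  by rewrite (iN n0).2 distrC.
have Re_le (z : R[i]) (b : R) : `|z| <= b%:C -> `|complex.Re z| <= b.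
  by move=> zb; rewrite -lecR (le_trans (normc_ge_Re z)).
have Im_le (z : R[i]) (b : R) : `|z| <= b%:C -> `|complex.Im z| <= b.
  move=> zb; rewrite -[complex.Im z]opprK -ReiNIm normrN; apply: Re_le.
  rewrite normrM; have -> : `|'i%C : R[i]| = 1.
    by rewrite normc_def /= expr0n add0r expr1n sqrtr1.
  by rewrite mulr1.
have ReB (z z' : R[i]) : complex.Re z - complex.Re z' = complex.Re (z - z').
  by case: z z' => ? ? [].
have ImB (z z' : R[i]) : complex.Im z - complex.Im z' = complex.Im (z - z').
  by case: z z' => ? ? [].
split.
  apply: (lim _ (fun n x => complex.Re (integrand r (F n) x)) _
     (fun n => complex.Re (V n))) => [n|n x Dx nx|n].
  - by have [] := HF n.
  - by rewrite ReB; apply: Re_le; exact: bdi.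
  - by rewrite ReB; apply: Re_le; exact: bv.
apply: (lim _ (fun n x => complex.Im (integrand r (F n) x)) _
   (fun n => complex.Im (V n))) => [n|n x Dx nx|n].
- by have [] := HF n.
- by rewrite ImB; apply: Im_le; exact: bdi.
- by rewrite ImB; apply: Im_le; exact: bv.
Qed.

Lemma has_circint_ext (r : R) f g v : 0 < r ->
  (forall z, `|z| = r%:C -> complex.Im z != 0 -> f z = g z) ->
  has_circint r g v -> has_circint r f v.
Proof.
move=> r0 fg gv.
apply: (@has_circint_limit r (fun=> g) (fun=> v) f v 0 0) => //.
- by rewrite lexx ltr01.
- by move=> n z zr z0; rewrite fg// subrr normr0 mul0r.
- by move=> n; rewrite subrr normr0 mul0r.
Qed.

End ContourIntegral.

(** * Cauchy's formula inside a pairing *)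

Section CauchyFormula.
Variable R : realType.
Implicit Types (p q : {poly R[i]}) (z : R[i]).

Definition two_pi_i : R[i] := 0 +i* (2 * pi).

Lemma nonreal_neq0 z : complex.Im z != 0 -> z != 0.
Proof. by apply: contraNneq => ->. Qed.

Lemma circle_power r (n i : nat) : 0 < r ->
  has_circint r (fun z => z ^- n.+1 * z ^+ i) (if i == n then two_pi_i else 0).
Proof.
move=> r0; have := has_circint_monomial (i%:Z - n.+1%:Z) r0.
have -> : (i%:Z - n.+1%:Z == -1) = (i == n).
  by rewrite -[n.+1]addn1 PoszD opprD addrA -subr_eq0 opprK subrK subr_eq0 eqz_nat.
apply: has_circint_ext => // z _ /nonreal_neq0 z0.
by rewrite expfzDr// -exprnP -exprnN mulrC.
Qed.

Lemma polynomial_bound p r : exists2 B : R, 0 <= B & forall z, `|z| = r%:C -> `|p.[z]| <= B%:C.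
Proof.
have [r0|r0] := leP 0 r; last first.
  exists 0 => // z zr; have := normr_ge0 z; rewrite zr ler0c => h.
  by move: r0; rewrite ltNge h.
exists (\sum_(i < size p) complex.Re `|p`_i| * r ^+ i).
  by apply: sumr_ge0 => i _; rewrite mulr_ge0 ?exprn_ge0// normc_def sqrtr_ge0.
move=> z zr; rewrite horner_coef (le_trans (ler_norm_sum _ _ _))// rmorph_sum /=.
apply: ler_sum => i _; rewrite normrM normrX zr rmorphM rmorphXn; exact: lexx.
Qed.

Lemma exp_partial_sum N q z :
  (\sum_(j < N) (j`!)%:R^-1 *: q ^+ j).[z] = cexp q.[z] - exp_tail N q.[z].
Proof.
rewrite /exp_tail opprB addrC subrK horner_sum; apply: eq_bigr => j _.
by rewrite hornerZ horner_exp.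
Qed.

(** Cauchy's theorem by polynomial approximation. *)
Lemma has_circint_entire r p q : 0 < r ->
  has_circint r (fun z => p.[z] * cexp q.[z]) 0.
Proof.
move=> r0.
have poly (e : {poly R[i]}) : has_circint r (fun z => e.[z]) 0.
  have H : has_circint r (fun z => \sum_(i < size e) e`_i * z ^+ i)
      (\sum_(i < size e) e`_i * 0).
    apply: has_circint_sum => i; apply: has_circintZ.
    exact: (has_circint_monomial i r0).
  rewrite big1 in H; last by move=> i _; rewrite mulr0.
  by apply: has_circint_ext H => // z _ _; rewrite horner_coef.
have [P P0 HP] := polynomial_bound p r; have [Q Q0 HQ] := polynomial_bound q r.
have [E E0 HE] := exp_tail_bound Q0.
apply: (@has_circint_limit R r
  (fun N z => (p * \sum_(j < N) (j`!)%:R^-1 *: q ^+ j).[z]) (fun=> 0) _ _ (P * E) 2^-1) => //.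
- by rewrite invr_ge0 ler0n /= invf_lt1 ?ltr1n.
- move=> N z zr z0; rewrite hornerM exp_partial_sum -mulrBr subKr normrM.
  by rewrite -mulrA rmorphM ler_pM// ?HP// HE// HQ.
- move=> N; rewrite subrr normr0 ler0c !mulr_ge0 ?exprn_ge0 ?invr_ge0//.
Qed.

Section Pairing.
Variables (w : functional R) (c : R * R -> R) (rho r : R) (g : R * R -> R[i]).
Hypotheses (dw : is_distribution w) (tw : tame w)
  (sc : smooth (fun a => (c a)%:C)) (rho0 : 0 <= rho) (rhor : rho < r)
  (sw : forall a, supp w a -> `|c a| <= rho) (sg : smooth g).

Let r0 : 0 < r. Proof. exact: le_lt_trans rhor. Qed.

(** Substituting the geometric series of 1/(z - c) leaves contour integrals of
monomials, and those that survive rebuild p. *)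
Lemma pairing_cauchy_poly p :
  has_circint r (fun z => pairing w (fun a => g a * (z - (c a)%:C)^-1) * p.[z])
    (two_pi_i * pairing w (fun a => g a * p.[(c a)%:C])).
Proof.
pose mo n := pairing w (fun a => g a * (c a)%:C ^+ n).
have [C [q [C0 q01 H]]] := pairing_cauchy_rate dw tw sc rho0 rhor sw sg.
have [P P0 HP] := polynomial_bound p r.
have /andP[q0 q1] := q01.
apply: (@has_circint_limit R r
  (fun N z => (\sum_(n < N + size p) z ^- n.+1 * mo n) * p.[z])
  (fun=> two_pi_i * pairing w (fun a => g a * p.[(c a)%:C])) _ _ (C * P) q) => //.
- move=> N.
  have -> : pairing w (fun a => g a * p.[(c a)%:C]) = \sum_(i < size p) p`_i * mo i.
    transitivity (pairing w (fun a => \sum_(i < size p) p`_i * (g a * (c a)%:C ^+ i))).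
      congr pairing; apply/funext => a; rewrite horner_coef mulr_sumr.
      by apply: eq_bigr => i _; rewrite mulrCA.
    rewrite pairing_sum//; last first.
      by move=> i; apply: smooth_scale; apply: smooth_mul => //; exact: smooth_exprn.
    apply: eq_bigr => i _; rewrite pairing_scale//.
    by apply: smooth_mul => //; exact: smooth_exprn.
  have -> : two_pi_i * (\sum_(i < size p) p`_i * mo i) =
      \sum_(n < N + size p) \sum_(i < size p)
        (mo n * p`_i) * (if (i : nat) == n then two_pi_i else 0).
    rewrite exchange_big /= mulr_sumr; apply: eq_bigr => i _.
    have iN : (i < N + size p)%N by rewrite ltn_addl.
    rewrite (bigD1 (Ordinal iN))//= eqxx big1 ?addr0.
      by rewrite mulrC [p`_i * _]mulrC.
    move=> n ni; rewrite ifF ?mulr0//; apply: contra_neqF ni => /eqP ni.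
    by apply/val_inj.
  apply: (@has_circint_ext _ _ _ (fun z => \sum_(n < N + size p)
      \sum_(i < size p) (mo n * p`_i) * (z ^- n.+1 * z ^+ i))) => //.
    move=> z _ _; rewrite mulr_suml; apply: eq_bigr => n _.
    by rewrite horner_coef mulr_sumr; apply: eq_bigr => i _; ring.
  apply: has_circint_sum => n; apply: has_circint_sum => i.
  by apply: has_circintZ; exact: circle_power.
- move=> N z zr z0; rewrite -mulrBl normrM mulrAC rmorphM ler_pM ?HP//.
  rewrite (le_trans (H _ _ zr z0))// lecR exprD mulrA ler_piMr//.
    by rewrite mulr_ge0// exprn_ge0.
  by rewrite exprn_ile1// ltW.
- move=> N; rewrite subrr normr0 ler0c !mulr_ge0 ?exprn_ge0//.
Qed.

(** Cauchy's formula inside a pairing: the exponential is approximated by the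
partial sums of its series, uniformly on the circle on the left and in the
seminorms that control w on the right. *)
Lemma pairing_cauchy p q :
  has_circint r
    (fun z => pairing w (fun a => g a * (z - (c a)%:C)^-1) * (p.[z] * cexp q.[z]))
    (two_pi_i * pairing w (fun a => g a * (p.[(c a)%:C] * cexp q.[(c a)%:C]))).
Proof.
have sp (e : {poly R[i]}) : smooth (fun a => e.[(c a)%:C]) by exact: smooth_horner.
have [C C0 HC] := pairing_cauchy_bounded dw tw sc rho0 rhor sw sg.
have [P P0 HP] := polynomial_bound p r; have [Q Q0 HQ] := polynomial_bound q r.
have [E E0 HE] := exp_tail_bound Q0.
have [B B0 HB] := pairing_exp_tail dw tw sc rho0 rhor sw (smooth_mul sg (sp p)) (sp q).
pose e N := p * \sum_(j < N) (j`!)%:R^-1 *: q ^+ j.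
have h20 N : 0 <= 2^-1 ^+ N :> R by rewrite exprn_ge0// invr_ge0.
have pi0 : 0 <= 2 * pi :> R by rewrite mulr_ge0// pi_ge0.
apply: (@has_circint_limit R r _ _ _ _ (C * (P * E) + (2 * pi) * B) 2^-1 r0 _
  (fun N => pairing_cauchy_poly (e N))) => //.
- by rewrite invr_ge0 ler0n /= invf_lt1 ?ltr1n.
- move=> N z zr z0; rewrite hornerM exp_partial_sum -mulrBr -mulrBr subKr !normrM.
  apply: (@le_trans _ _ (C * (P * E) * 2^-1 ^+ N)%:C); last first.
    by rewrite lecR ler_wpM2r// lerDl mulr_ge0.
  have -> : C * (P * E) * 2^-1 ^+ N = C * (P * (E * 2^-1 ^+ N)) by ring.
  rewrite !rmorphM; apply: ler_pM => //; first exact: HC.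
  apply: ler_pM => //; first exact: HP.
  by rewrite -rmorphM HE// HQ.
- move=> N; rewrite -mulrBr normrM.
  have -> : pairing w (fun a => g a * (p.[(c a)%:C] * cexp q.[(c a)%:C])) -
     pairing w (fun a => g a * (e N).[(c a)%:C]) =
     pairing w (fun a => g a * p.[(c a)%:C] * exp_tail N q.[(c a)%:C]).
    apply/eqP; rewrite subr_eq -pairing_add//.
    - apply/eqP; congr pairing; apply/funext => a.
      by rewrite hornerM exp_partial_sum; ring.
    - by apply: smooth_mul; [exact: smooth_mul|exact: smooth_exp_tail].
    - exact: smooth_mul.
  apply: (@le_trans _ _ ((2 * pi) * B * 2^-1 ^+ N)%:C); last first.
    by rewrite lecR ler_wpM2r// lerDr !mulr_ge0.
  rewrite -mulrA rmorphM; apply: ler_pM => //.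
  by rewrite normc_def /= expr0n add0r sqrtr_sqr ger0_norm.
Qed.

End Pairing.
End CauchyFormula.
Arguments two_pi_i {R}.

(** * Sesquilinear forms *)

Section Forms.
Variables (R : realType) (p : nat).
Local Notation C := R[i].
Local Notation M := 'M[R[i]]_p.
Implicit Types (u : kernelM R p) (P Q A B : R -> M) (z : C).

Definition tame_kernel u := forall i j, tame (u i j).

Definition smooth_x P := forall i j, smooth (fun a : R * R => P a.1 i j).
Definition smooth_y Q := forall i j, smooth (fun a : R * R => Q a.2 i j).

Lemma supp_rad u i j a : generalized_kernel u -> supp (u i j) a ->
  `|a.1| <= rad_x u /\ `|a.2| <= rad_y u.
Proof.
move=> [_ bx by_] sa; have ka : ksupp u a by exists i, j.
by split; apply: ub_le_sup => //; [exists a.1|exists a.2] => //; exists a.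
Qed.

Lemma sup_norm_ge0 (S : set R) : has_ubound [set `|x| | x in S] ->
  0 <= sup [set `|x| | x in S].
Proof.
move=> bS; have [[v [x Sx xv]]|E] := pselect ([set `|x| | x in S] !=set0).
  apply: le_trans (ub_le_sup bS _); first exact: (normr_ge0 x).
  by exists x.
rewrite (_ : [set `|x| | x in S] = set0) ?sup0//.
by apply/seteqP; split=> // y yS; exfalso; apply: E; exists y.
Qed.

Lemma rad_x_ge0 u : generalized_kernel u -> 0 <= rad_x u.
Proof. by move=> [_ bx _]; exact: sup_norm_ge0. Qed.

Lemma rad_y_ge0 u : generalized_kernel u -> 0 <= rad_y u.
Proof. by move=> [_ _ bx]; exact: sup_norm_ge0. Qed.

Lemma kernel_distribution u i j : generalized_kernel u -> is_distribution (u i j).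
Proof. by move=> [/(_ i j) []]. Qed.

Lemma kernel_tame u : generalized_kernel u -> tame_kernel u.
Proof.
move=> gu i j; split; first by have [] := kernel_distribution i j gu.
exists (rad_x u + rad_y u) => a /(supp_rad gu)[h1 h2]; split; rewrite subr0.
  by rewrite (le_trans h1)// lerDl rad_y_ge0.
by rewrite (le_trans h2)// lerDr rad_x_ge0.
Qed.

Section TameForms.
Variable u : kernelM R p.
Hypothesis tu : tame_kernel u.

Lemma form_mull (A : M) P Q : smooth_x P -> smooth_y Q ->
  form u (fun x => A *m P x) Q = A *m form u P Q.
Proof.
move=> sP sQ; apply/matrixP => i j; rewrite !mxE.
have sPQ k l i' : smooth (fun a => P a.1 i' k * Q a.2 j l) by exact: smooth_mul.
transitivity (\sum_k \sum_l \sum_m A i m * pairing (u k l) (fun a => P a.1 m k * Q a.2 j l)).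
  apply: eq_bigr => k _; apply: eq_bigr => l _.
  transitivity (\sum_m pairing (u k l) (fun a => A i m * (P a.1 m k * Q a.2 j l))).
    rewrite -pairing_sum//; last by move=> m; exact: smooth_scale.
    congr pairing; apply/funext => a; rewrite mxE mulr_suml.
    by apply: eq_bigr => m _; rewrite mulrA.
  by apply: eq_bigr => m _; rewrite pairing_scale.
under eq_bigr do rewrite exchange_big /=.
rewrite exchange_big /=; apply: eq_bigr => m _; rewrite mxE mulr_sumr.
by apply: eq_bigr => k _; rewrite mulr_sumr.
Qed.

Lemma form_mulr (B : M) P Q : smooth_x P -> smooth_y Q ->
  form u P (fun y => B *m Q y) = form u P Q *m B^T.
Proof.
move=> sP sQ; apply/matrixP => i j; rewrite !mxE.
have sPQ k l j' : smooth (fun a => P a.1 i k * Q a.2 j' l) by exact: smooth_mul.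
transitivity (\sum_k \sum_l \sum_m pairing (u k l) (fun a => P a.1 i k * Q a.2 m l) * B j m).
  apply: eq_bigr => k _; apply: eq_bigr => l _.
  transitivity (\sum_m pairing (u k l) (fun a => B j m * (P a.1 i k * Q a.2 m l))).
    rewrite -pairing_sum//; last by move=> m; exact: smooth_scale.
    congr pairing; apply/funext => a; rewrite mxE mulr_sumr.
    by apply: eq_bigr => m _; rewrite mulrCA.
  by apply: eq_bigr => m _; rewrite pairing_scale// mulrC.
under eq_bigr do rewrite exchange_big /=.
rewrite exchange_big /=; apply: eq_bigr => m _; rewrite !mxE mulr_suml.
by apply: eq_bigr => k _; rewrite mulr_suml.
Qed.

Lemma form_addr P Q1 Q2 : smooth_x P -> smooth_y Q1 -> smooth_y Q2 ->
  form u P (fun y => Q1 y + Q2 y) = form u P Q1 + form u P Q2.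
Proof.
move=> sP s1 s2; apply/matrixP => i j; rewrite !mxE -big_split /=.
apply: eq_bigr => k _; rewrite -big_split /=; apply: eq_bigr => l _.
rewrite -pairing_add//; [|exact: smooth_mul..].
by congr pairing; apply/funext => a; rewrite mxE mulrDr.
Qed.

Lemma form_addl P1 P2 Q : smooth_x P1 -> smooth_x P2 -> smooth_y Q ->
  form u (fun x => P1 x + P2 x) Q = form u P1 Q + form u P2 Q.
Proof.
move=> s1 s2 sQ; apply/matrixP => i j; rewrite !mxE -big_split /=.
apply: eq_bigr => k _; rewrite -big_split /=; apply: eq_bigr => l _.
rewrite -pairing_add//; [|exact: smooth_mul..].
by congr pairing; apply/funext => a; rewrite mxE mulrDl.
Qed.

Lemma form0r P : form u P (fun=> 0) = 0.
Proof.
apply/matrixP => i j; rewrite !mxE big1// => k _; rewrite big1// => l _.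
rewrite -[RHS](pairing0 (tu k l)); congr pairing; apply/funext => a.
by rewrite mxE mulr0.
Qed.

Lemma form0l Q : form u (fun=> 0) Q = 0.
Proof.
apply/matrixP => i j; rewrite !mxE big1// => k _; rewrite big1// => l _.
rewrite -[RHS](pairing0 (tu k l)); congr pairing; apply/funext => a.
by rewrite mxE mul0r.
Qed.

Lemma smooth_y_sum (I : Type) (s : seq I) (Pr : pred I) (Q : I -> R -> M) :
  (forall i, smooth_y (Q i)) -> smooth_y (fun y => \sum_(i <- s | Pr i) Q i y).
Proof.
move=> sQ i j; apply: (smooth_ext (g := fun a => \sum_(k <- s | Pr k) Q k a.2 i j)).
  by move=> a; rewrite summxE.
by apply: smooth_sum => k; exact: sQ.
Qed.

Lemma smooth_x_sum (I : Type) (s : seq I) (Pr : pred I) (Q : I -> R -> M) :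
  (forall i, smooth_x (Q i)) -> smooth_x (fun y => \sum_(i <- s | Pr i) Q i y).
Proof.
move=> sQ i j; apply: (smooth_ext (g := fun a => \sum_(k <- s | Pr k) Q k a.1 i j)).
  by move=> a; rewrite summxE.
by apply: smooth_sum => k; exact: sQ.
Qed.

Lemma form_sumr (I : Type) (s : seq I) (Pr : pred I) P (Q : I -> R -> M) :
  smooth_x P -> (forall i, smooth_y (Q i)) ->
  form u P (fun y => \sum_(i <- s | Pr i) Q i y) =
  \sum_(i <- s | Pr i) form u P (Q i).
Proof.
move=> sP sQ; elim: s => [|i s IH].
  rewrite big_nil -[RHS](form0r P); congr form; apply/funext => y.
  by rewrite big_nil.
rewrite big_cons -IH; case: (boolP (Pr i)) => Pi.
  rewrite -form_addr//; last exact: smooth_y_sum.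
  by congr form; apply/funext => y; rewrite big_cons Pi.
by congr form; apply/funext => y; rewrite big_cons (negbTE Pi).
Qed.

Lemma form_suml (I : Type) (s : seq I) (Pr : pred I) (P : I -> R -> M) Q :
  (forall i, smooth_x (P i)) -> smooth_y Q ->
  form u (fun y => \sum_(i <- s | Pr i) P i y) Q =
  \sum_(i <- s | Pr i) form u (P i) Q.
Proof.
move=> sP sQ; elim: s => [|i s IH].
  rewrite big_nil -[RHS](form0l Q); congr form; apply/funext => y.
  by rewrite big_nil.
rewrite big_cons -IH; case: (boolP (Pr i)) => Pi.
  rewrite -form_addl//; last exact: smooth_x_sum.
  by congr form; apply/funext => y; rewrite big_cons Pi.
by congr form; apply/funext => y; rewrite big_cons (negbTE Pi).
Qed.

Lemma tame_kmul f : smooth f -> tame_kernel (kmul f u).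
Proof. by move=> sf i j; rewrite mxE; exact: tame_dmul. Qed.

Lemma form_kmul (f : R * R -> C) (f1 f2 : R -> C) P Q :
  (forall a, f a = f1 a.1 * f2 a.2) -> smooth (fun a => f1 a.1) ->
  smooth (fun a => f2 a.2) -> smooth_x P -> smooth_y Q ->
  form (kmul f u) P Q = form u (fun x => f1 x *: P x) (fun y => f2 y *: Q y).
Proof.
move=> fE s1 s2 sP sQ; apply/matrixP => i j; rewrite !mxE.
apply: eq_bigr => k _; apply: eq_bigr => l _; rewrite mxE pairing_dmul//; last 2 first.
- by apply: (smooth_ext fE); exact: smooth_mul.
- exact: smooth_mul.
by congr pairing; apply/funext => a; rewrite fE !mxE; ring.
Qed.

End TameForms.

Lemma smooth_x_scale (f : R -> C) P : smooth (fun a => f a.1) -> smooth_x P ->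
  smooth_x (fun x => f x *: P x).
Proof.
move=> sf sP i j; apply: (smooth_ext (g := fun a => f a.1 * P a.1 i j)).
  by move=> a; rewrite mxE.
exact: smooth_mul.
Qed.

Lemma smooth_y_scale (f : R -> C) P : smooth (fun a => f a.2) -> smooth_y P ->
  smooth_y (fun x => f x *: P x).
Proof.
move=> sf sP i j; apply: (smooth_ext (g := fun a => f a.2 * P a.2 i j)).
  by move=> a; rewrite mxE.
exact: smooth_mul.
Qed.

Lemma smooth_x_scalar (f : R -> C) : smooth (fun a => f a.1) ->
  smooth_x (fun x => (f x)%:M).
Proof.
move=> sf i j; apply: (smooth_ext (g := fun a => (i == j)%:R * f a.1)).
  by move=> a; rewrite mxE mulr_natl.
exact: smooth_scale.
Qed.

Lemma smooth_y_scalar (f : R -> C) : smooth (fun a => f a.2) ->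
  smooth_y (fun x => (f x)%:M).
Proof.
move=> sf i j; apply: (smooth_ext (g := fun a => (i == j)%:R * f a.2)).
  by move=> a; rewrite mxE mulr_natl.
exact: smooth_scale.
Qed.

Lemma smooth_cauchy_x z : complex.Im z != 0 ->
  smooth (fun a : R * R => (z - a.1%:C)^-1).
Proof. by move=> z0; apply: smooth_cauchy => //; exact: smooth_fst. Qed.

Lemma smooth_cauchy_y z : complex.Im z != 0 ->
  smooth (fun a : R * R => (z - a.2%:C)^-1).
Proof. by move=> z0; apply: smooth_cauchy => //; exact: smooth_snd. Qed.

Definition polynomial_mx (E : C -> M) := exists e : 'I_p -> 'I_p -> {poly C},
  forall z i j, E z i j = (e i j).[z].

Lemma polynomial_mxM E F : polynomial_mx E -> polynomial_mx F ->
  polynomial_mx (fun z => E z *m F z).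
Proof.
move=> [e he] [f hf]; exists (fun i j => \sum_k e i k * f k j) => z i j.
by rewrite mxE horner_sum; apply: eq_bigr => k _; rewrite hornerM he hf.
Qed.

Lemma polynomial_mxT E : polynomial_mx E -> polynomial_mx (fun z => (E z)^T).
Proof. by move=> [e he]; exists (fun i j => e j i) => z i j; rewrite mxE he. Qed.

Lemma polynomial_mx_sum n (W : nat -> M) :
  polynomial_mx (fun z => \sum_(k < n) z ^+ k *: W k).
Proof.
exists (fun i j => \sum_(k < n) (W k i j) *: 'X^k) => z i j.
rewrite summxE horner_sum; apply: eq_bigr => k _.
by rewrite mxE hornerZ hornerXn mulrC.
Qed.

Lemma polynomial_mx_x E : polynomial_mx E -> smooth_x (fun x => E x%:C).
Proof.
move=> [e he] i j; apply: (smooth_ext (g := fun a => (e i j).[a.1%:C])).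
  by move=> a; rewrite he.
by apply: smooth_horner; exact: smooth_fst.
Qed.

Lemma polynomial_mx_y E : polynomial_mx E -> smooth_y (fun x => E x%:C).
Proof.
move=> [e he] i j; apply: (smooth_ext (g := fun a => (e i j).[a.2%:C])).
  by move=> a; rewrite he.
by apply: smooth_horner; exact: smooth_snd.
Qed.

Lemma smooth_cexp_x (q : {poly C}) : smooth (fun a : R * R => cexp q.[a.1%:C]).
Proof. by apply: smooth_exp; apply: smooth_horner; exact: smooth_fst. Qed.

Lemma smooth_cexp_y (q : {poly C}) : smooth (fun a : R * R => cexp q.[a.2%:C]).
Proof. by apply: smooth_exp; apply: smooth_horner; exact: smooth_snd. Qed.

Definition has_mxint (r : R) (F : C -> M) (V : M) :=
  forall i j, has_circint r (fun z => F z i j) (V i j).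

Lemma has_mxint_circint r F V : has_mxint r F V -> circint r F = V.
Proof. exact: has_circint_mx. Qed.

Lemma has_mxint_ext r F G V : 0 < r ->
  (forall z, `|z| = r%:C -> complex.Im z != 0 -> F z = G z) ->
  has_mxint r G V -> has_mxint r F V.
Proof.
move=> r0 FG HG i j; apply: has_circint_ext (HG i j) => // z zr z0.
by rewrite FG.
Qed.

Lemma has_mxintD r F G U V : has_mxint r F U -> has_mxint r G V ->
  has_mxint r (fun z => F z + G z) (U + V).
Proof.
move=> HF HG i j; have := has_circintD (HF i j) (HG i j).
by rewrite mxE; congr has_circint; apply/funext => z; rewrite mxE.
Qed.

Lemma has_mxintMr r F V (B : M) : has_mxint r F V ->
  has_mxint r (fun z => F z *m B) (V *m B).
Proof.
move=> HF i j; rewrite mxE.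
have -> : (fun z => (F z *m B) i j) = fun z => \sum_k F z i k * B k j.
  by apply/funext => z; rewrite mxE.
apply: has_circint_sum => k; rewrite mulrC.
have -> : (fun z => F z i k * B k j) = fun z => B k j * F z i k.
  by apply/funext => z; rewrite mulrC.
exact: has_circintZ.
Qed.

Lemma has_mxintMl r F V (B : M) : has_mxint r F V ->
  has_mxint r (fun z => B *m F z) (B *m V).
Proof.
move=> HF i j; rewrite mxE.
have -> : (fun z => (B *m F z) i j) = fun z => \sum_k B i k * F z k j.
  by apply/funext => z; rewrite mxE.
by apply: has_circint_sum => k; apply: has_circintZ.
Qed.

(** The Cauchy kernel is a scalar matrix, so that this is Cauchy's formula entry by
entry. *)
Lemma contour_form_x u (r : R) (f : R -> C) B E (q : {poly C}) :
  generalized_kernel u -> rad_x u < r -> smooth (fun a => f a.1) -> smooth_y B ->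
  polynomial_mx E ->
  has_mxint r
    (fun z => cexp q.[z] *: (E z *m form u (fun x => f x *: cauchy p z x) B))
    (two_pi_i *: form u (fun x => f x *: (cexp q.[x%:C] *: E x%:C)) B).
Proof.
move=> gu ur sf sB [e he] i j; have tu := kernel_tame gu.
have r0 : 0 < r by exact: le_lt_trans (rad_x_ge0 gu) ur.
pose g j' l (a : R * R) := f a.1 * B a.2 j' l.
have sg j' l : smooth (g j' l) by exact: smooth_mul.
have H k l := pairing_cauchy (kernel_distribution k l gu) (tu k l) (@smooth_fst R)
  (rad_x_ge0 gu) ur (fun a sa => (supp_rad gu sa).1) (sg j l) (e i k) q.
apply: (@has_circint_ext _ _ _ (fun z => \sum_k \sum_l
    pairing (u k l) (fun a => g j l a * (z - a.1%:C)^-1) * ((e i k).[z] * cexp q.[z]))) => //.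
  move=> z _ z0; rewrite !mxE mulr_sumr; apply: eq_bigr => k _.
  rewrite mxE (bigD1 k)//= [X in _ + X]big1 ?addr0; last first.
    move=> k' k'k; rewrite big1// => l _.
    rewrite -[RHS](pairing0 (tu k' l)); congr pairing; apply/funext => a.
    by rewrite /cauchy !mxE eq_sym (negbTE k'k) mulr0n mulr0 mul0r.
  rewrite mulrA mulr_sumr; apply: eq_bigr => l _; rewrite he mulrC; congr (_ * _).
    congr pairing; apply/funext => a; rewrite /cauchy !mxE eqxx mulr1n /g; ring.
  by rewrite mulrC.
have -> : (two_pi_i *: form u (fun x => f x *: (cexp q.[x%:C] *: E x%:C)) B) i j =
    \sum_k \sum_l two_pi_i *
      pairing (u k l) (fun a => g j l a * ((e i k).[a.1%:C] * cexp q.[a.1%:C])).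
  rewrite !mxE mulr_sumr; apply: eq_bigr => k _; rewrite mulr_sumr.
  apply: eq_bigr => l _; congr (_ * _); congr pairing; apply/funext => a.
  by rewrite !mxE he /g; ring.
by apply: has_circint_sum => k; apply: has_circint_sum => l; exact: H.
Qed.

Lemma contour_form_y u (r : R) (f : R -> C) A E (q : {poly C}) :
  generalized_kernel u -> rad_y u < r -> smooth (fun a => f a.2) -> smooth_x A ->
  polynomial_mx E ->
  has_mxint r
    (fun z => cexp q.[z] *: (form u A (fun y => f y *: cauchy p z y) *m E z))
    (two_pi_i *: form u A (fun y => f y *: (cexp q.[y%:C] *: (E y%:C)^T))).
Proof.
move=> gu ur sf sA [e he] i j; have tu := kernel_tame gu.
have r0 : 0 < r by exact: le_lt_trans (rad_y_ge0 gu) ur.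
pose g k (a : R * R) := A a.1 i k * f a.2.
have sg k : smooth (g k) by exact: smooth_mul.
have H k l := pairing_cauchy (kernel_distribution k l gu) (tu k l) (@smooth_snd R)
  (rad_y_ge0 gu) ur (fun a sa => (supp_rad gu sa).2) (sg k) (e l j) q.
apply: (@has_circint_ext _ _ _ (fun z => \sum_k \sum_l
    pairing (u k l) (fun a => g k a * (z - a.2%:C)^-1) * ((e l j).[z] * cexp q.[z]))) => //.
  move=> z _ z0; rewrite exchange_big !mxE mulr_sumr; apply: eq_bigr => l _.
  rewrite mxE mulr_suml mulr_sumr; apply: eq_bigr => k _.
  rewrite (bigD1 l)//= [X in _ + X]big1 ?addr0; last first.
    move=> l' l'l.
    rewrite -[RHS](pairing0 (tu k l')); congr pairing; apply/funext => a.
    by rewrite /cauchy !mxE eq_sym (negbTE l'l) mulr0n !mulr0.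
  rewrite he mulrCA; congr (_ * _); last by rewrite mulrC.
  congr pairing; apply/funext => a; rewrite /cauchy !mxE eqxx mulr1n /g; ring.
have -> : (two_pi_i *: form u A (fun y => f y *: (cexp q.[y%:C] *: (E y%:C)^T))) i j =
    \sum_k \sum_l two_pi_i *
      pairing (u k l) (fun a => g k a * ((e l j).[a.2%:C] * cexp q.[a.2%:C])).
  rewrite !mxE mulr_sumr; apply: eq_bigr => k _; rewrite mulr_sumr.
  apply: eq_bigr => l _; congr (_ * _); congr pairing; apply/funext => a.
  by rewrite !mxE he /g; ring.
by apply: has_circint_sum => k; apply: has_circint_sum => l; exact: H.
Qed.

Lemma has_mxint_entire r E (q : {poly C}) : 0 < r -> polynomial_mx E ->
  has_mxint r (fun z => cexp q.[z] *: E z) 0.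
Proof.
move=> r0 [e he] i j; rewrite mxE.
have := has_circint_entire (e i j) q r0; congr has_circint.
by apply/funext => z; rewrite mxE he mulrC.
Qed.

End Forms.

(** * Geronimus-Uvarov transformations and the bilinear identities *)

Section Transform.
Variables (R : realType) (p : nat).
Local Notation C := R[i].
Local Notation M := 'M[R[i]]_p.+1.
Implicit Types (u : kernelM R p.+1) (A B : R -> M) (z : C) (W : {poly M}).

Lemma mevalE W z : meval W z = \sum_(n < size W) z ^+ n *: W`_n.
Proof.
rewrite /meval horner_coef; apply: eq_bigr => n _.
by rewrite -rmorphXn /= -scalemx1 mulr_algr.
Qed.

Lemma meval_poly W : polynomial_mx (meval W).
Proof.
have [e he] := @polynomial_mx_sum R p.+1 (size W) (fun n => W`_n).
by exists e => z i j; rewrite mevalE he.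
Qed.

Lemma chi_block_poly (S : bmatrix R p.+1) n : polynomial_mx (chi_block S n).
Proof. exact: polynomial_mx_sum. Qed.

(** The divided difference of W is a polynomial in z, so that the singularity at
z = y is carried by W(y). *)
Lemma cauchy_meval W z (y : R) : complex.Im z != 0 ->
  (z - y%:C)^-1 *: (meval W z) = (z - y%:C)^-1 *: (meval W y%:C) +
   \sum_(n < size W) \sum_(i < n) z ^+ (n.-1 - i) *: (y%:C ^+ i *: W`_n).
Proof.
move=> z0; rewrite !mevalE -[LHS](subrKC ((z - y%:C)^-1 *: \sum_(n < size W) y%:C ^+ n *: W`_n)).
congr (_ + _); rewrite -scalerBr -sumrB scaler_sumr; apply: eq_bigr => n _.
rewrite -scalerBl subrXX scalerA mulrA mulVf ?mul1r ?cauchy_den// scaler_suml.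
by apply: eq_bigr => i _; rewrite scalerA.
Qed.

(** The transformed kernel may charge zeros of WG on or outside the circle, so that
Cauchy's formula does not apply to it. Multiplying by WG(z) and replacing WG(z) by
WG(y) transfers the Cauchy transform to u; the difference is a polynomial in z,
whose product with an entire function integrates to 0. *)
Lemma contour_form_geronimus_uvarov u uh (WC WG : {poly M}) (r : R) (f : R -> C) A E
    (q : {poly C}) :
  generalized_kernel u -> generalized_kernel uh -> geronimus_uvarov u uh WC WG ->
  rad_y u < r -> smooth (fun a => f a.2) -> smooth_x A -> polynomial_mx E ->
  has_mxint r
    (fun z => cexp q.[z] *: (form uh A (fun y => f y *: cauchy p.+1 z y) *m meval WG z *m E z))
    (two_pi_i *: form u (fun x => A x *m meval WC x%:C)
       (fun y => f y *: (cexp q.[y%:C] *: (E y%:C)^T))).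
Proof.
move=> gu guh GU ur sf sA pE; have tu := kernel_tame gu; have tuh := kernel_tame guh.
have r0 : 0 < r by exact: le_lt_trans (rad_y_ge0 gu) ur.
pose N n i := form uh A (fun y => f y *: (y%:C ^+ i *: (WG`_n)^T)).
pose rest z : M := \sum_(n < size WG) \sum_(i < n) z ^+ (n.-1 - i) *: N n i.
have sAW : smooth_x (fun x => A x *m meval WC x%:C).
  move=> i j; apply: (smooth_ext (g := fun a => \sum_k A a.1 i k * meval WC a.1%:C k j)).
    by move=> a; rewrite mxE.
  by apply: smooth_sum => k; apply: smooth_mul => //; exact: (polynomial_mx_x (meval_poly WC)).
have prest : polynomial_mx rest.
  exists (fun i j => \sum_(n < size WG) \sum_(k < n) (N n k i j) *: 'X^(n.-1 - k)) => z i j.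
  rewrite /rest summxE horner_sum; apply: eq_bigr => n _; rewrite summxE horner_sum.
  by apply: eq_bigr => k _; rewrite mxE hornerZ hornerXn mulrC.
have H1 := contour_form_y q gu ur sf sAW pE.
have H2 := has_mxint_entire q r0 (polynomial_mxM prest pE).
(* Up to the integral of [rest], the integrand is that of Cauchy's formula for u. *)
have := has_mxintD H1 H2; rewrite addr0; apply: has_mxint_ext => // z _ z0.
rewrite -scalerDr -mulmxDl; congr (_ *: (_ *m _)).
have sfc : smooth_y (fun y => f y *: cauchy p.+1 z y).
  apply: smooth_y_scale => //; apply: smooth_y_scalar; exact: smooth_cauchy_y.
have sN n i : smooth_y (fun y => f y *: (y%:C ^+ i *: (WG`_n)^T)).
  apply: smooth_y_scale => //; apply: smooth_y_scale.
    by apply: smooth_exprn; exact: smooth_snd.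
  by move=> k l; exact: smooth_cst.
rewrite -[meval WG z]trmxK -form_mulr//.
rewrite -GU; last 2 first.
- by move=> i j; exists setT; split => //; [exact: openT|exact: sA].
- by move=> i j; exists setT; split => //; [exact: openT|exact: sfc].
have sW : smooth_y (fun y => (f y *: cauchy p.+1 z y) *m (meval WG y%:C)^T).
  move=> i j; apply: (smooth_ext (g := fun a =>
     (f a.2 * (z - a.2%:C)^-1) * (meval WG a.2%:C)^T i j)).
    by move=> a; rewrite /cauchy scale_scalar_mx mul_scalar_mx mxE.
  apply: smooth_mul; first by apply: smooth_mul => //; exact: smooth_cauchy_y.
  exact: (polynomial_mx_y (polynomial_mxT (meval_poly WG))).
have sNZ n i : smooth_y (fun y => z ^+ (n.-1 - i) *: (f y *: (y%:C ^+ i *: (WG`_n)^T))).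
  by apply: smooth_y_scale => //; exact: smooth_cst.
have -> : (fun y => (meval WG z)^T *m (f y *: cauchy p.+1 z y)) =
   fun y => (f y *: cauchy p.+1 z y) *m (meval WG y%:C)^T +
    \sum_(n < size WG) \sum_(i < n) z ^+ (n.-1 - i) *: (f y *: (y%:C ^+ i *: (WG`_n)^T)).
  apply/funext => y; rewrite /cauchy -scalemxAr mul_mx_scalar -scalemxAl mul_scalar_mx.
  have T c (X : M) : c *: X^T = (c *: X)^T by rewrite linearZ.
  rewrite !T cauchy_meval// scalerDr linearD /=; congr (_ + _).
  rewrite scaler_sumr linear_sum; apply: eq_bigr => n _.
  rewrite scaler_sumr linear_sum; apply: eq_bigr => i _.
  by rewrite !linearZ /= !scalerA; congr (_ *: _); ring.
rewrite form_addr//; last by apply: smooth_y_sum => n; exact: smooth_y_sum.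
congr (_ + _); rewrite form_sumr//; last by move=> n; exact: smooth_y_sum.
apply: eq_bigr => n _; rewrite form_sumr//; apply: eq_bigr => i _.
rewrite /N; have := form_mulr tuh ((z ^+ (n.-1 - i))%:M) sA (sN n i).
rewrite tr_scalar_mx mul_mx_scalar => <-; congr form; apply/funext => y.
by rewrite mul_scalar_mx.
Qed.

Lemma cexpD (a b : C) : cexp (a + b) = cexp a * cexp b.
Proof.
case: a b => x y [x' y']; rewrite /cexp /= expRD cosD sinD.
apply/eqP; rewrite eq_complex /=; apply/andP; split; apply/eqP; ring.
Qed.

Lemma t1E (t : time R) z : t1 t z = ('X * t.1).[z].
Proof. by rewrite hornerM hornerX. Qed.

Lemma t2E (t : time R) z : t2 t z = ('X * t.2).[z].
Proof. by rewrite hornerM hornerX. Qed.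

Lemma smooth_t1 (t : time R) : smooth (fun a : R * R => cexp (t1 t a.1%:C)).
Proof.
apply: (smooth_ext (g := fun a => cexp ('X * t.1).[a.1%:C])).
  by move=> a; rewrite t1E.
exact: smooth_cexp_x.
Qed.

Lemma smooth_t2 (t : time R) : smooth (fun a : R * R => cexp (- t2 t a.2%:C)).
Proof.
apply: (smooth_ext (g := fun a => cexp (- 'X * t.2).[a.2%:C])).
  by move=> a; rewrite t2E mulNr hornerN.
exact: smooth_cexp_y.
Qed.

Lemma form_flow u t A B : tame_kernel u -> smooth_x A -> smooth_y B ->
  form (flow t u) A B = form u (fun x => cexp (t1 t x%:C) *: A x)
    (fun y => cexp (- t2 t y%:C) *: B y).
Proof.
move=> tu sA sB; apply: (@form_kmul _ _ u tu _ (fun x => cexp (t1 t x%:C))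
  (fun y => cexp (- t2 t y%:C))) => //.
- by move=> a; rewrite cexpD.
- exact: smooth_t1.
- exact: smooth_t2.
Qed.

Section Bilinear.
Variables (u uh : kernelM R p.+1) (WC WG : {poly M}).
Hypotheses (hu : generalized_kernel u) (huh : generalized_kernel uh)
  (hGU : geronimus_uvarov u uh WC WG).
Variables (r1 r2 : R) (hr1 : rad_x u < r1) (hr2 : rad_y u < r2) (t t' : time R)
  (k l : nat).

Let A x : M := cexp (t1 t' x%:C) *: P1 (flow t' uh) k x%:C.
Let B y : M := cexp (- t2 t y%:C) *: P2 (flow t u) l y%:C.

(** What both sides of the identities between wave functions integrate to. *)
Definition bilinear_value : M :=
  two_pi_i *: form u (fun x => A x *m meval WC x%:C) B.

Let pP1 : polynomial_mx (fun z => P1 (flow t' uh) k z).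
Proof. exact: chi_block_poly. Qed.

Let pP2 : polynomial_mx (fun z => P2 (flow t u) l z).
Proof. exact: chi_block_poly. Qed.

Let sA : smooth_x A.
Proof. by apply: smooth_x_scale; [exact: smooth_t1|exact: (polynomial_mx_x pP1)]. Qed.

Let sB : smooth_y B.
Proof. by apply: smooth_y_scale; [exact: smooth_t2|exact: (polynomial_mx_y pP2)]. Qed.

Let r10 : 0 < r1. Proof. exact: le_lt_trans (rad_x_ge0 hu) hr1. Qed.
Let r20 : 0 < r2. Proof. exact: le_lt_trans (rad_y_ge0 hu) hr2. Qed.

Lemma baker_integral_x : has_mxint r1
  (fun z => Psi1 uh k t' z *m meval WC z *m (Psi1s u l t z)^T)
  (bilinear_value *m invmx (Hblk (flow t u) l)).
Proof.
have H := contour_form_x (f := fun=> 1) ('X * t'.1) hu hr1 (smooth_cst 1) sB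
  (polynomial_mxM pP1 (meval_poly WC)).
have := has_mxintMr (invmx (Hblk (flow t u) l)) H.
have -> : two_pi_i *: form u (fun x : R => 1 *: (cexp ('X * t'.1).[x%:C] *:
     (P1 (flow t' uh) k x%:C *m meval WC x%:C))) B = bilinear_value.
  congr (_ *: form _ _ _); apply/funext => x; rewrite scale1r -t1E /A.
  by rewrite -scalemxAl.
apply: has_mxint_ext => // z _ _.
rewrite /Psi1 /Psi1s trmxK -!scalemxAl -t1E; congr (_ *: _).
rewrite mulmxA; congr (_ *m form _ _ _ *m _).
by apply/funext => x; rewrite scale1r.
Qed.

Lemma baker_integral_y : has_mxint r2
  (fun z => Psi2 uh k t' z *m meval WG z *m (Psi2s u l t z)^T)
  (bilinear_value *m invmx (Hblk (flow t u) l)).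
Proof.
have H := contour_form_geronimus_uvarov (f := fun=> 1) (- 'X * t.2) hu huh hGU hr2 (smooth_cst 1) sA
  (polynomial_mxT pP2).
have := has_mxintMr (invmx (Hblk (flow t u) l)) H.
have q2 z : (- 'X * t.2).[z] = - t2 t z by rewrite t2E mulNr hornerN.
have -> : two_pi_i *: form u (fun x => A x *m meval WC x%:C)
    (fun y : R => 1 *: (cexp (- 'X * t.2).[y%:C] *: ((P2 (flow t u) l y%:C)^T)^T)) =
    bilinear_value.
  congr (_ *: form _ _ _); apply/funext => y; by rewrite scale1r q2 trmxK.
apply: has_mxint_ext => // z _ _.
rewrite q2 /Psi2s linearZ /= trmx_mul trmxK -scalemxAr -!scalemxAl -!mulmxA.
congr (_ *: (form _ _ _ *m _)).
by apply/funext => x; rewrite scale1r.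
Qed.

Lemma wave_integral_x : has_mxint r1
  (fun z => cexp (t1 t' z - t1 t z) *:
        (P1 (flow t' uh) k z *m meval WC z *m (C2 (flow t u) l z)^T))
  bilinear_value.
Proof.
have H := contour_form_x (f := fun x => cexp (t1 t x%:C))
  ('X * t'.1 - 'X * t.1) hu hr1 (smooth_t1 t) sB
  (polynomial_mxM pP1 (meval_poly WC)).
have q2 z : ('X * t'.1 - 'X * t.1).[z] = t1 t' z - t1 t z by rewrite hornerD hornerN !t1E.
have E : two_pi_i *: form u (fun x : R => cexp (t1 t x%:C) *:
     (cexp ('X * t'.1 - 'X * t.1).[x%:C] *:
     (P1 (flow t' uh) k x%:C *m meval WC x%:C))) B = bilinear_value.
  congr (_ *: form _ _ _); apply/funext => x; rewrite q2 scalerA -cexpD subrKC /A.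
  by rewrite -scalemxAl.
rewrite E in H; apply: (has_mxint_ext r10 _ H) => z _ z0.
rewrite q2 /C2 trmxK form_flow//.
- exact: kernel_tame.
- by apply: smooth_x_scalar; exact: smooth_cauchy_x.
- exact: (polynomial_mx_y pP2).
Qed.

Lemma wave_integral_y : has_mxint r2
  (fun z => cexp (t2 t' z - t2 t z) *:
        (C1 (flow t' uh) k z *m meval WG z *m (P2 (flow t u) l z)^T))
  bilinear_value.
Proof.
have H := contour_form_geronimus_uvarov (f := fun y => cexp (- t2 t' y%:C))
  ('X * t'.2 - 'X * t.2) hu huh hGU hr2 (smooth_t2 t') sA
  (polynomial_mxT pP2).
have q2 z : ('X * t'.2 - 'X * t.2).[z] = t2 t' z - t2 t z by rewrite hornerD hornerN !t2E.
have E : two_pi_i *: form u (fun x => A x *m meval WC x%:C)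
    (fun y : R => cexp (- t2 t' y%:C) *: (cexp ('X * t'.2 - 'X * t.2).[y%:C] *:
       ((P2 (flow t u) l y%:C)^T)^T)) = bilinear_value.
  congr (_ *: form _ _ _); apply/funext => y; rewrite q2 trmxK scalerA -cexpD.
  by rewrite addrA addNr add0r.
rewrite E in H; apply: (has_mxint_ext r20 _ H) => z _ z0.
rewrite q2 /C1 form_flow//.
- exact: kernel_tame.
- exact: (polynomial_mx_x pP1).
- by apply: smooth_y_scalar; exact: smooth_cauchy_y.
Qed.

End Bilinear.
End Transform.

(** * Block factorization *)

Section BlockAlgebra.
Variables (R : realType) (p : nat).
Local Notation M := 'M[R[i]]_p.
Implicit Types (A B G S L X : bmatrix R p) (H : nat -> M).

Lemma bmatrixP A B : (forall i j, A i j = B i j) -> A = B.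
Proof. by move=> AB; apply/funext => i; apply/funext => j. Qed.

Lemma lmul_bid X : lmul (bid R p) X = X.
Proof.
apply: bmatrixP => i j; rewrite /lmul big_ord_recr /= {2}/bid eqxx mul1mx.
by rewrite big1 ?add0r// => m _; rewrite /bid gtn_eqF ?mul0mx// ltn_ord.
Qed.

Lemma lmul_bidr A : lower_unitriangular A -> lmul A (bid R p) = A.
Proof.
move=> [_ lA]; apply: bmatrixP => i j; rewrite /lmul.
have [ji|ij] := leqP j i.
  have ji' : (j < i.+1)%N by [].
  rewrite (bigD1 (Ordinal ji'))//= /bid eqxx mulmx1 big1 ?addr0// => m mj.
  by rewrite ifF ?mulmx0//; apply: contra_neqF mj => /eqP mj; apply: val_inj.
rewrite lA// big1// => m _; rewrite /bid ifF ?mulmx0//.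
by rewrite ltn_eqF// (leq_trans (ltn_ord m)).
Qed.

Lemma lmul_widen A X i j n : lower_unitriangular A -> (i < n)%N ->
  lmul A X i j = \sum_(m < n) A i m *m X m j.
Proof.
move=> [_ lA] ilt; rewrite /lmul -!(big_mkord xpredT (fun m => A i m *m X m j)).
rewrite [RHS](@big_cat_nat _ _ _ i.+1)//= [X in _ = _ + X]big_nat_cond.
rewrite [X in _ = _ + X]big1 ?addr0// => m; rewrite andbT => /andP[im _].
by rewrite lA ?mul0mx.
Qed.

(** Since B is triangular, both sums may be taken over the same range. *)
Lemma lmulA A B X : lower_unitriangular B ->
  lmul A (lmul B X) = lmul (lmul A B) X.
Proof.
move=> lB; apply: bmatrixP => i j; rewrite {1}/lmul [RHS]/lmul.
transitivity (\sum_(m < i.+1) \sum_(n < i.+1) A i m *m (B m n *m X n j)).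
  apply: eq_bigr => m _; rewrite (lmul_widen X j lB (ltn_ord m)).
  by rewrite mulmx_sumr.
rewrite exchange_big /=; apply: eq_bigr => n _; rewrite /lmul mulmx_suml.
by apply: eq_bigr => m _; rewrite mulmxA.
Qed.

(** Forward substitution: row i of the inverse is reached after i + 1 steps. *)
Fixpoint forward (S : bmatrix R p) (n : nat) : bmatrix R p :=
  if n is n'.+1 then
    fun i j => bid R p i j - \sum_(m < i) S i m *m forward S n' m j
  else fun _ _ => 0.

Definition linv (S : bmatrix R p) : bmatrix R p := fun i j => forward S i.+1 i j.

Lemma forwardE S n i j : (i < n)%N -> forward S n i j = linv S i j.
Proof.
elim/ltn_ind: i n => i IH [//|n] ni; rewrite /linv /=; congr (_ - _).
apply: eq_bigr => m _; congr (_ *m _); rewrite !IH//.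
by rewrite (leq_trans (ltn_ord m)).
Qed.

Lemma linvE S i j : linv S i j = bid R p i j - \sum_(m < i) S i m *m linv S m j.
Proof.
rewrite {1}/linv /=; congr (_ - _); apply: eq_bigr => m _.
by rewrite forwardE.
Qed.

Lemma linv_lower S : lower_unitriangular (linv S).
Proof.
have low i j : (i < j)%N -> linv S i j = 0.
  elim/ltn_ind: i => i IH ij; rewrite linvE /bid ltn_eqF// sub0r big1 ?oppr0//.
  by move=> m _; rewrite IH ?mulmx0// (ltn_trans (ltn_ord m)).
split=> // i; rewrite linvE /bid eqxx big1 ?subr0// => m _.
by rewrite low ?mulmx0.
Qed.

Lemma lmul_linv S : lower_unitriangular S -> lmul S (linv S) = bid R p.
Proof.
move=> [S1 _]; apply: bmatrixP => i j; rewrite /lmul big_ord_recr /= S1 mul1mx.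
by rewrite linvE addrC subrK.
Qed.

(** The right inverse of S has itself a right inverse, which has to be S by
associativity. *)
Lemma linv_inverse S : lower_unitriangular S -> is_inverse S (linv S).
Proof.
move=> lS; have lL := linv_lower S; have lL' := linv_lower (linv S).
split=> //; first exact: lmul_linv.
suff {2}-> : S = linv (linv S) by exact: lmul_linv.
rewrite -[LHS]lmul_bidr// -(lmul_linv lL) lmulA// lmul_linv//.
exact: lmul_bid.
Qed.

Lemma truncation_inj m G n (x : nat -> 'M[R[i]]_(m, p)) :
  truncation G n \in unitmx ->
  (forall j, (j < n)%N -> \sum_(i < n) x i *m G i j = 0) ->
  forall i, (i < n)%N -> x i = 0.
Proof.
move=> uG Hx i ilt.
have E : (\mxrow_(k < n) x k) *m truncation G n = 0.
  rewrite /truncation mul_mxrow_mxblock -[RHS](mxrow0 (q_ := fun _ : 'I_n => p)).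
  by apply: eq_mxrow => j; rewrite Hx.
have {}E : \mxrow_(k < n) x k = 0.
  by rewrite -[LHS](mulmxK uG) E mul0mx.
by rewrite -[x i]/(x (Ordinal ilt)) -(mxrowK (fun k : 'I_n => x k)) E submxrow0.
Qed.

Lemma truncation_solve G n (b : nat -> M) : truncation G n \in unitmx ->
  exists x : nat -> M, forall j, (j < n)%N -> \sum_(i < n) x i *m G i j = b j.
Proof.
move=> uG; pose X := (\mxrow_(k < n) b k) *m invmx (truncation G n).
pose Y (i : 'I_n) : M := submxrow X i.
exists (fun i => if insub i is Some o then Y o else 0) => j jn.
have E : (\mxrow_(k < n) Y k) *m truncation G n = \mxrow_(k < n) b k.
  by rewrite submxrowK mulmxKV.
rewrite -[b j]/(b (Ordinal jn)) -(mxrowK (fun k : 'I_n => b k)) -E.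
rewrite /truncation mul_mxrow_mxblock mxrowK; apply: eq_bigr => i _.
by rewrite valK.
Qed.

Lemma truncation_btr G n : truncation (btr G) n = (truncation G n)^T.
Proof. by rewrite /truncation tr_mxblock. Qed.

Definition nonsingular G := forall n, truncation G n \in unitmx.

Lemma nonsingular_btr G : nonsingular G -> nonsingular (btr G).
Proof. by move=> nG n; rewrite truncation_btr unitmx_tr. Qed.

Lemma orthogonal_rows G : nonsingular G -> exists2 S, lower_unitriangular S &
  forall n l, (l < n)%N -> lmul S G n l = 0.
Proof.
move=> nG.
have /choice[x Hx] n := truncation_solve (fun l => - G n l) (nG n).
exists (fun n k => if (k < n)%N then x n k else if n == k then 1%:M else 0).
  split=> [i|i j ij]; first by rewrite ltnn eqxx.
  by rewrite ltnNge ltnW//= ltn_eqF.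
move=> n l ln; rewrite /lmul big_ord_recr /= ltnn eqxx mul1mx.
rewrite (eq_bigr (fun k : 'I_n => x n k *m G k l)) ?Hx ?addNr//.
by move=> k _; rewrite ltn_ord.
Qed.

Lemma lmul_bdiag H X : lmul (bdiag H) X = fun i j => H i *m X i j.
Proof.
apply: bmatrixP => i j; rewrite /lmul big_ord_recr /= {2}/bdiag eqxx.
by rewrite big1 ?add0r// => m _; rewrite /bdiag gtn_eqF ?mul0mx// ltn_ord.
Qed.

(** The rows of S1 make S1 G upper triangular and those of S2, found for the
transpose of G, make G S2^T lower triangular. So S1 G S2^T is diagonal. *)
Lemma gauss_borel_exists G : nonsingular G ->
  exists F : bmatrix R p * (nat -> M) * bmatrix R p, gauss_borel G F.1.1 F.1.2 F.2.
Proof.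
move=> nG.
have [S1 lS1 o1] := orthogonal_rows nG.
have [S2 lS2 o2] := orthogonal_rows (nonsingular_btr nG).
pose H n := lmul S1 G n n; exists (S1, H, S2); split=> //=.
have i1 := linv_inverse lS1; have i2 := linv_inverse lS2.
exists (linv S1), (linv S2); split=> //.
have [lL1 _ L1S1] := i1; have [lL2 _ L2S2] := i2.
pose U := lmul S1 G.
have UE : lmul S2 (btr U) = fun i j => if i == j then (H i)^T else 0.
  apply: bmatrixP => m n.
  have [mn|nm|<-] := ltngtP m n.
  - rewrite /= ?ltn_eqF// /lmul big1// => l _; rewrite /btr /U o1 ?trmx0 ?mulmx0//.
    by rewrite (leq_ltn_trans _ mn)// -ltnS.
  - rewrite /= ?gtn_eqF//.
    have -> : lmul S2 (btr U) m n =
        \sum_(k < n.+1) lmul S2 (btr G) m k *m (S1 n k)^T.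
      rewrite /lmul (eq_bigr (fun l : 'I_m.+1 => \sum_(k < n.+1)
          S2 m l *m ((G k l)^T *m (S1 n k)^T))); last first.
        move=> l _; rewrite /btr /U /lmul raddf_sum mulmx_sumr /=.
        by apply: eq_bigr => k _; rewrite trmx_mul.
      rewrite exchange_big /=; apply: eq_bigr => k _; rewrite mulmx_suml.
      by apply: eq_bigr => l _; rewrite mulmxA.
    rewrite big1// => k _; rewrite o2 ?mul0mx//.
    by rewrite (leq_ltn_trans _ nm)// -ltnS.
  - rewrite /= ?eqxx /lmul big_ord_recr /= (proj1 lS2) mul1mx big1 ?add0r//.
    by move=> l _; rewrite /btr /U o1 ?trmx0 ?mulmx0.
rewrite lmul_bdiag -[LHS]lmul_bid -L1S1 -lmulA//; congr lmul.
apply: bmatrixP => i j.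
have -> : lmul S1 G i j = (btr U j i)^T by rewrite /btr trmxK.
rewrite -[btr U]lmul_bid -L2S2 -lmulA// UE {1}/lmul.
have [ji|ij] := ltnP j i.
  rewrite /btr (proj2 lL2)// trmx0 mulmx0 big1 ?trmx0// => m _.
  by rewrite ltn_eqF ?mulmx0// (leq_ltn_trans _ ji)// -ltnS.
rewrite -ltnS in ij; rewrite (bigD1 (Ordinal ij))//= eqxx big1 ?addr0.
  by rewrite trmx_mul trmxK.
move=> m mi; rewrite ifF ?mulmx0//; apply: contra_neqF mi => /eqP mi.
exact: val_inj.
Qed.

(** Transposition exchanges x and y; every statement about y is obtained from the
one about x in this way. *)
Lemma gauss_borel_btr G S1 H S2 : gauss_borel G S1 H S2 ->
  gauss_borel (btr G) S2 (fun n => (H n)^T) S1.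
Proof.
move=> [lS1 lS2 [L1 [L2 [i1 i2 ->]]]]; split=> //; exists L2, L1; split=> //.
have [lL1 _ _] := i1; have [lL2 _ _] := i2.
apply: bmatrixP => i j; rewrite {1}/btr !lmul_bdiag.
rewrite (lmul_widen _ _ lL1 (leq_maxr i.+1 j.+1)).
rewrite (lmul_widen _ _ lL2 (leq_maxl i.+1 j.+1)) raddf_sum /=.
by apply: eq_bigr => m _; rewrite /btr !trmx_mul trmxK mulmxA.
Qed.

Lemma gauss_borel_rows G S1 H S2 : gauss_borel G S1 H S2 ->
  (forall n l, (l < n)%N -> lmul S1 G n l = 0) /\ forall n, lmul S1 G n n = H n.
Proof.
move=> [lS1 lS2 [L1 [L2 [[lL1 S1L1 _] [lL2 _ _] ->]]]].
rewrite lmulA// S1L1 lmul_bid lmul_bdiag /btr; split=> [n l ln|n].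
  by rewrite (proj2 lL2)// trmx0 mulmx0.
by rewrite (proj1 lL2) trmx1 mulmx1.
Qed.

(** A row vector annihilated by the pivot would give a vanishing combination of the
rows of a truncation of G. *)
Lemma pivot_unit G S1 H S2 n : nonsingular G -> gauss_borel G S1 H S2 ->
  H n \in unitmx.
Proof.
move=> nG gb; have [ort e1] := gauss_borel_rows gb; have [lS1 _ _] := gb.
rewrite -row_free_unit -kermx_eq0; apply/rowV0P => v /sub_kermxP vH.
have := truncation_inj (x := fun k => v *m S1 n k) (nG n.+1).
move=> /(_ _ n (ltnSn n)); rewrite (proj1 lS1) mulmx1; apply => j jn.
have -> : \sum_(k < n.+1) (v *m S1 n k) *m G k j = v *m lmul S1 G n j.
  by rewrite /lmul mulmx_sumr; apply: eq_bigr => k _; rewrite mulmxA.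
move: jn; rewrite ltnS leq_eqVlt => /predU1P[->|jn]; first by rewrite e1.
by rewrite ort// mulmx0.
Qed.

End BlockAlgebra.

(** * Gram matrices of shifted kernels *)

Section MiwaShift.
Variables (R : realType) (p : nat).
Local Notation M := 'M[R[i]]_p.
Implicit Types (A B G S L X : bmatrix R p) (H : nat -> M) (z : R[i]).

(** The ratio matrices [tau1] and [tau2] depend on the pivots only; stating them
that way allows transposed pivots. *)
Fixpoint ratio_prod (n : nat) (H K : nat -> M) : M :=
  if n is m.+1 then (H m *m invmx (K m)) *m ratio_prod m H K else 1%:M.

Fixpoint coratio_prod (n : nat) (H K : nat -> M) : M :=
  if n is m.+1 then (invmx (H m) *m K m) *m coratio_prod m H K else 1%:M.

Lemma ratio_prod_unit n H K : (forall m, H m \in unitmx) ->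
  (forall m, K m \in unitmx) -> ratio_prod n H K \in unitmx.
Proof.
move=> uH uK; elim: n => [|n IH] /=; first exact: unitmx1.
by rewrite !unitmx_mul uH unitmx_inv uK.
Qed.

(** Transposing the pivots reverses the order of the factors. *)
Lemma ratio_prod_tr n H K : (forall m, H m \in unitmx) ->
  (forall m, K m \in unitmx) ->
  (ratio_prod n (fun m => (H m)^T) (fun m => (K m)^T))^T *m coratio_prod n H K = 1%:M.
Proof.
move=> uH uK; elim: n => [|n IH] /=; first by rewrite trmx1 mulmx1.
rewrite !trmx_mul trmxK -trmx_inv trmxK -IH -!mulmxA; congr (_ *m _).
by rewrite !mulmxA (mulmxK (uH n)) mulVmx// mul1mx.
Qed.

(** The Gram matrix of a kernel multiplied by 1 - x/z. *)
Definition row_shift z G : bmatrix R p := fun k l => G k l - z^-1 *: G k.+1 l.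

(** The shifted kernel is the original one times 1 - x/z. Hence, for its orthogonal
polynomials P'_n, the product (1 - x/z) P'_n is orthogonal to the powers y^l with
l < n for the original kernel; its degree being n + 1, it is a combination of P_n
and P_(n+1). The relation is stated through the values f of an arbitrary linear
functional on the powers of x. *)
Lemma three_term G S1 H S2 S1' H' S2' z n m (f : nat -> 'M[R[i]]_(p, m)) :
  nonsingular G -> gauss_borel G S1 H S2 ->
  gauss_borel (row_shift z G) S1' H' S2' ->
  \sum_(k < n.+1) S1' n k *m (f k - z^-1 *: f k.+1) =
  (H' n *m invmx (H n)) *m (\sum_(k < n.+1) S1 n k *m f k)
  - z^-1 *: \sum_(k < n.+2) S1 n.+1 k *m f k.
Proof.
move=> nG gb gb'.
have [lS1 _ _] := gb; have [lS1' _ _] := gb'.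
have [ort e1] := gauss_borel_rows gb; have [ort' e1'] := gauss_borel_rows gb'.
have uH := pivot_unit n nG gb.
pose W := H' n *m invmx (H n).
pose y k : M := S1' n k - z^-1 *: (if k is k'.+1 then S1' n k' else 0).
(* The coefficients of (1 - x/z) P'_n minus those of the claimed combination: the
   one of index n + 1 is 0, and the others are the solution of a nonsingular
   homogeneous system. *)
pose D k := y k - (W *m S1 n k - z^-1 *: S1 n.+1 k).
have ySum q (g : nat -> 'M[R[i]]_(p, q)) :
    \sum_(k < n.+2) y k *m g k = \sum_(k < n.+1) S1' n k *m (g k - z^-1 *: g k.+1).
  rewrite /y (eq_bigr (fun k : 'I_n.+2 => S1' n k *m g k - z^-1 *:
     ((if (k : nat) is k'.+1 then S1' n k' else 0) *m g k))); last first.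
    by move=> k _; rewrite mulmxBl -scalemxAl.
  rewrite sumrB big_ord_recr /= (proj2 lS1')// mul0mx addr0.
  rewrite [X in _ - X]big_ord_recl /= mul0mx scaler0 add0r -sumrB.
  by apply: eq_bigr => k _; rewrite mulmxBr -scalemxAr.
have Wsum q (g : nat -> 'M[R[i]]_(p, q)) :
    \sum_(k < n.+2) (W *m S1 n k - z^-1 *: S1 n.+1 k) *m g k =
    W *m (\sum_(k < n.+1) S1 n k *m g k) - z^-1 *: \sum_(k < n.+2) S1 n.+1 k *m g k.
  rewrite (eq_bigr (fun k : 'I_n.+2 => W *m (S1 n k *m g k) -
     z^-1 *: (S1 n.+1 k *m g k))); last first.
    by move=> k _; rewrite mulmxBl mulmxA -scalemxAl.
  rewrite sumrB -mulmx_sumr -scaler_sumr; congr (_ *m _ - _).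
  by rewrite big_ord_recr /= (proj2 lS1)// mul0mx addr0.
have Dlast : D n.+1 = 0.
  by rewrite /D /y (proj2 lS1')// (proj2 lS1)// (proj1 lS1') (proj1 lS1) mulmx0 subrr.
have D0 k : (k < n.+2)%N -> D k = 0.
  rewrite ltnS leq_eqVlt => /predU1P[->//|kn].
  apply: (truncation_inj (nG n.+1)) kn => j jn.
  transitivity (\sum_(k < n.+2) D k *m G k j).
    by rewrite [RHS]big_ord_recr /= Dlast mul0mx addr0.
  rewrite /D (eq_bigr (fun k : 'I_n.+2 => y k *m G k j -
     (W *m S1 n k - z^-1 *: S1 n.+1 k) *m G k j)); last first.
    by move=> i _; rewrite mulmxBl.
  rewrite sumrB (ySum _ (fun k => G k j)) (Wsum _ (fun k => G k j)).
  rewrite -/(lmul S1 G n j) -/(lmul S1 G n.+1 j) (ort n.+1 j jn) scaler0 subr0.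
  rewrite -/(lmul S1' (row_shift z G) n j).
  move: jn; rewrite ltnS leq_eqVlt => /predU1P[->|jn].
    by rewrite e1 e1' /W mulmxKV// subrr.
  by rewrite ort// ort'// mulmx0 subrr.
rewrite -ySum -Wsum; apply/eqP; rewrite -subr_eq0 -sumrB; apply/eqP.
by rewrite big1// => k _; rewrite -mulmxBl -/(D k) D0 ?mul0mx.
Qed.

Lemma chi_blockE S n z : chi_block S n z = \sum_(k < n.+1) S n k *m (z ^+ k)%:M.
Proof. by apply: eq_bigr => k _; rewrite mul_mx_scalar. Qed.

(** Evaluation at x = z annihilates the factor 1 - x/z, which makes the relation a
recursion of order one. *)
Lemma shift_polynomial G S1 H S2 S1' H' S2' z n : z != 0 ->
  nonsingular G -> gauss_borel G S1 H S2 ->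
  gauss_borel (row_shift z G) S1' H' S2' ->
  chi_block S1 n z = z ^+ n *: ratio_prod n H' H.
Proof.
move=> z0 nG gb gb'; have [lS1 _ _] := gb.
elim: n => [|n IH].
  by rewrite /chi_block big_ord1 /= (proj1 lS1) expr0.
have := three_term n (fun k => (z ^+ k)%:M) nG gb gb'.
rewrite big1 => [|k _]; last first.
  by rewrite exprS scale_scalar_mx mulrA mulVf// mul1r subrr mulmx0.
rewrite -!chi_blockE IH => /esym/eqP; rewrite subr_eq0 => /eqP E.
apply: (scalerI (invr_neq0 z0)); rewrite -E /= -scalemxAr scalerA.
by rewrite exprS mulrA mulVf// mul1r.
Qed.

(** The functional is now the form with the second polynomial of index n of the
shifted kernel. The left side of the relation vanishes up to index n, where it is
the pivot, so that the recursion leads from the value at 1 to this pivot. *)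
Lemma shift_cauchy G S1 H S2 S1' H' S2' z n : z != 0 ->
  nonsingular G -> gauss_borel G S1 H S2 ->
  gauss_borel (row_shift z G) S1' H' S2' ->
  z ^+ n *: (ratio_prod n.+1 H' H *m (\sum_(m < n.+1) G 0%N m *m (S2' n m)^T)) = H' n.
Proof.
move=> z0 nG gb gb'; have [lS1 _ _] := gb; have [lS1' _ _] := gb'.
pose f k := \sum_(m < n.+1) G k m *m (S2' n m)^T.
have [ort _] := gauss_borel_rows gb.
have [ort2 e2] := gauss_borel_rows (gauss_borel_btr gb').
have fshift k : f k - z^-1 *: f k.+1 = (lmul S2' (btr (row_shift z G)) n k)^T.
  rewrite /f /lmul [RHS]raddf_sum scaler_sumr -sumrB; apply: eq_bigr => m _.
  by rewrite /= trmx_mul /btr trmxK /row_shift mulmxBl -scalemxAl.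
pose b k := \sum_(j < k.+1) S1 k j *m f j.
have step k : (k <= n)%N -> (H' k *m invmx (H k)) *m b k - z^-1 *: b k.+1 =
    if k == n then H' n else 0.
  move=> kn; rewrite /b -(three_term k f nG gb gb') big_ord_recr /=.
  rewrite (proj1 lS1') mul1mx big1 ?add0r => [|j _]; last first.
    by rewrite fshift ort2 ?trmx0 ?mulmx0// (leq_trans (ltn_ord j)).
  rewrite fshift; have [->|kn'] := eqVneq k n; first by rewrite e2 trmxK.
  by rewrite ort2 ?trmx0// ltn_neqAle kn'.
have bE k : (k <= n)%N -> b k = z ^+ k *: (ratio_prod k H' H *m f 0%N).
  elim: k => [|k IH] kn.
    by rewrite /b big_ord1 (proj1 lS1) expr0 scale1r.
  have := step k (ltnW kn); rewrite ltn_eqF// => /eqP; rewrite subr_eq0 => /eqP E.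
  apply: (scalerI (invr_neq0 z0)); rewrite -E IH ?(ltnW kn)//.
  by rewrite -scalemxAr scalerA exprS mulrA mulVf// mul1r /= mulmxA.
have bn : b n.+1 = 0.
  rewrite /b /f (eq_bigr (fun j : 'I_n.+2 => \sum_(m < n.+1)
      (S1 n.+1 j *m G j m) *m (S2' n m)^T)); last first.
    by move=> j _; rewrite mulmx_sumr; apply: eq_bigr => m _; rewrite mulmxA.
  rewrite exchange_big /= big1// => m _; rewrite -mulmx_suml.
  by rewrite -/(lmul S1 G n.+1 m) ort ?mul0mx.
have := step n (leqnn n); rewrite eqxx bn scaler0 subr0 bE// => <-.
by rewrite -scalemxAr mulmxA.
Qed.

End MiwaShift.

(** * Wave functions as ratios of tau matrices *)

Section TauRatios.
Variables (R : realType) (p : nat).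
Local Notation C := R[i].
Local Notation M := 'M[R[i]]_p.
Implicit Types (v w : kernelM R p) (z : C).

Lemma gb_factorsP v : quasidefinite v ->
  gauss_borel (gram v) (S1 v) (Hblk v) (S2 v).
Proof.
move=> qv; rewrite /S1 /Hblk /S2 /gb_factors.
have [F HF] := gauss_borel_exists qv.
by case: xgetP => [F' _ HF'|/(_ F)]; [exact: HF'|case].
Qed.

Lemma Hblk_unit v n : quasidefinite v -> Hblk v n \in unitmx.
Proof. by move=> qv; exact: (pivot_unit n qv (gb_factorsP qv)). Qed.

Lemma tau1E n v w : tau1 n v w = ratio_prod n (Hblk v) (Hblk w).
Proof. by elim: n => //= n ->. Qed.

Lemma tau2E n v w : tau2 n v w = coratio_prod n (Hblk v) (Hblk w).
Proof. by elim: n => //= n ->. Qed.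

Lemma smooth_x_power k : smooth_x (fun x : R => ((x%:C ^+ k)%:M : M)).
Proof. by apply: smooth_x_scalar; apply: smooth_exprn; exact: smooth_fst. Qed.

Lemma smooth_y_power k : smooth_y (fun x : R => ((x%:C ^+ k)%:M : M)).
Proof. by apply: smooth_y_scalar; apply: smooth_exprn; exact: smooth_snd. Qed.

Lemma smooth_miwa_x z : smooth (fun a : R * R => 1 - a.1%:C / z).
Proof.
apply: smooth_sub; first exact: smooth_cst.
by apply: smooth_mul; [exact: smooth_fst|exact: smooth_cst].
Qed.

Lemma smooth_miwa_y z : smooth (fun a : R * R => 1 - a.2%:C / z).
Proof.
apply: smooth_sub; first exact: smooth_cst.
by apply: smooth_mul; [exact: smooth_snd|exact: smooth_cst].
Qed.

Lemma miwa_inv z (x : R) : complex.Im z != 0 -> (1 - x%:C / z)^-1 = z * (z - x%:C)^-1.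
Proof.
move=> z0; have zn0 := nonreal_neq0 z0; have d0 := cauchy_den x z0.
by field; rewrite zn0 d0.
Qed.

Lemma smooth_miwa_inv_x z : complex.Im z != 0 ->
  smooth (fun a : R * R => (1 - a.1%:C / z)^-1).
Proof.
move=> z0; apply: (smooth_ext (g := fun a => z * (z - a.1%:C)^-1)).
  by move=> a; rewrite miwa_inv.
by apply: smooth_scale; exact: smooth_cauchy_x.
Qed.

Lemma smooth_miwa_inv_y z : complex.Im z != 0 ->
  smooth (fun a : R * R => (1 - a.2%:C / z)^-1).
Proof.
move=> z0; apply: (smooth_ext (g := fun a => z * (z - a.2%:C)^-1)).
  by move=> a; rewrite miwa_inv.
by apply: smooth_scale; exact: smooth_cauchy_y.
Qed.

Section Shifts.
Variables (v : kernelM R p) (z : C).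
Hypotheses (tv : tame_kernel v) (z0 : complex.Im z != 0).

Lemma form_kmul_x (f : R -> C) (P Q : R -> M) : smooth (fun a => f a.1) ->
  smooth_x P -> smooth_y Q ->
  form (kmul (fun a => f a.1) v) P Q = form v (fun x => f x *: P x) Q.
Proof.
move=> sf sP sQ; rewrite (@form_kmul _ _ _ tv _ f (fun=> 1))//.
- by congr form; apply/funext => y; rewrite scale1r.
- by move=> a; rewrite mulr1.
- exact: smooth_cst.
Qed.

Lemma form_kmul_y (f : R -> C) (P Q : R -> M) : smooth (fun a => f a.2) ->
  smooth_x P -> smooth_y Q ->
  form (kmul (fun a => f a.2) v) P Q = form v P (fun y => f y *: Q y).
Proof.
move=> sf sP sQ; rewrite (@form_kmul _ _ _ tv _ (fun=> 1) f)//.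
- by congr form; apply/funext => y; rewrite scale1r.
- by move=> a; rewrite mul1r.
- exact: smooth_cst.
Qed.

Lemma form_Zl c (P Q : R -> M) : smooth_x P -> smooth_y Q ->
  form v (fun x => c *: P x) Q = c *: form v P Q.
Proof.
move=> sP sQ; have := form_mull tv (c%:M) sP sQ; rewrite mul_scalar_mx => <-.
by congr form; apply/funext => x; rewrite mul_scalar_mx.
Qed.

Lemma form_Zr c (P Q : R -> M) : smooth_x P -> smooth_y Q ->
  form v P (fun x => c *: Q x) = c *: form v P Q.
Proof.
move=> sP sQ; have := form_mulr tv (c%:M) sP sQ.
rewrite tr_scalar_mx mul_mx_scalar => <-.
by congr form; apply/funext => x; rewrite mul_scalar_mx.
Qed.

Lemma gram_miwa1m : gram (miwa1m z v) = row_shift z (gram v).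
Proof.
apply: bmatrixP => k l; rewrite /gram /row_shift /miwa1m.
have sk := smooth_x_power k; have sk' := smooth_x_power k.+1; have sl := smooth_y_power l.
rewrite (@form_kmul_x (fun x => 1 - x%:C / z))//; last exact: smooth_miwa_x.
rewrite -scaleNr -form_Zl// -form_addl//; last first.
  by apply: smooth_x_scale => //; exact: smooth_cst.
congr form; apply/funext => x; rewrite !scale_scalar_mx -raddfD /=; congr (_%:M).
by rewrite exprS; ring.
Qed.

Lemma gram_miwa2p : btr (gram (miwa2p z v)) = row_shift z (btr (gram v)).
Proof.
apply: bmatrixP => l k; rewrite /gram /row_shift /btr /miwa2p.
have sk := smooth_x_power k; have sl := smooth_y_power l; have sl' := smooth_y_power l.+1.
rewrite (@form_kmul_y (fun x => 1 - x%:C / z))//; last exact: smooth_miwa_y.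
rewrite -scaleNr -linearZ /= -linearD /= -form_Zr// -form_addr//; last first.
  by apply: smooth_y_scale => //; exact: smooth_cst.
congr (_^T); congr form; apply/funext => x; rewrite !scale_scalar_mx -raddfD /=.
by congr (_%:M); rewrite exprS; ring.
Qed.

Lemma gram_miwa1p : gram v = row_shift z (gram (miwa1p z v)).
Proof.
apply: bmatrixP => k l; rewrite /gram /row_shift /miwa1p.
have sk := smooth_x_power k; have sk' := smooth_x_power k.+1; have sl := smooth_y_power l.
have sm := smooth_miwa_inv_x z0; have zn0 := nonreal_neq0 z0.
have sf (P : R -> M) : smooth_x P -> smooth_x (fun x => (1 - x%:C / z)^-1 *: P x).
  exact: (@smooth_x_scale _ _ (fun x => (1 - x%:C / z)^-1)).
rewrite !(@form_kmul_x (fun x => (1 - x%:C / z)^-1))//.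
have szk' := smooth_x_scale (f := fun=> - z^-1) (smooth_cst _) (sf _ sk').
rewrite -scaleNr -(form_Zl _ (sf _ sk') sl) -(form_addl tv (sf _ sk) szk' sl).
congr form; apply/funext => x; rewrite !scale_scalar_mx -raddfD /=; congr (_%:M).
have d0 := cauchy_den x z0.
by rewrite exprS miwa_inv//; field; rewrite ?zn0 ?d0.
Qed.

Lemma gram_miwa2m : btr (gram v) = row_shift z (btr (gram (miwa2m z v))).
Proof.
apply: bmatrixP => l k; rewrite /gram /row_shift /btr /miwa2m.
have sk := smooth_x_power k; have sl := smooth_y_power l; have sl' := smooth_y_power l.+1.
have sm := smooth_miwa_inv_y z0; have zn0 := nonreal_neq0 z0.
have sf (P : R -> M) : smooth_y P -> smooth_y (fun x => (1 - x%:C / z)^-1 *: P x).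
  exact: (@smooth_y_scale _ _ (fun x => (1 - x%:C / z)^-1)).
rewrite !(@form_kmul_y (fun x => (1 - x%:C / z)^-1))//.
have szl' := smooth_y_scale (f := fun=> - z^-1) (smooth_cst _) (sf _ sl').
rewrite -scaleNr -linearZ /= -linearD /=.
rewrite -(form_Zr _ sk (sf _ sl')) -(form_addr tv sk (sf _ sl) szl').
congr (_^T); congr form; apply/funext => x; rewrite !scale_scalar_mx -raddfD /=.
have d0 := cauchy_den x z0.
by congr (_%:M); rewrite exprS miwa_inv//; field; rewrite ?zn0 ?d0.
Qed.

(** As 1/(z - x) = z^-1 (1 - x/z)^-1, the Cauchy kernel amounts to a Miwa shift. *)
Lemma form_cauchy_x (S : bmatrix R p) l :
  form v (cauchy p z) (fun y => chi_block S l y%:C) =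
  z^-1 *: \sum_(m < l.+1) gram (miwa1p z v) 0 m *m (S l m)^T.
Proof.
have sc : smooth_x (cauchy p z).
  by apply: smooth_x_scalar; exact: smooth_cauchy_x.
have zn0 := nonreal_neq0 z0.
have -> : (fun y : R => chi_block S l y%:C) =
    fun y : R => \sum_(m < l.+1) S l m *m (y%:C ^+ m)%:M.
  by apply/funext => y; rewrite chi_blockE.
rewrite form_sumr//; last first.
  move=> m i j; apply: (smooth_ext (g := fun a => S l m i j * a.2%:C ^+ m)).
    by move=> a; rewrite mul_mx_scalar mxE mulrC.
  by apply: smooth_scale; apply: smooth_exprn; exact: smooth_snd.
rewrite scaler_sumr; apply: eq_bigr => m _.
rewrite (form_mulr tv (S l m) sc (smooth_y_power m)) scalemxAl; congr (_ *m _).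
rewrite /gram /miwa1p (@form_kmul_x (fun x => (1 - x%:C / z)^-1)); last 3 first.
- exact: smooth_miwa_inv_x.
- exact: smooth_x_power.
- exact: smooth_y_power.
rewrite -form_Zl; last 2 first.
- apply: (@smooth_x_scale _ _ (fun x => (1 - x%:C / z)^-1)).
    exact: smooth_miwa_inv_x.
  exact: smooth_x_power.
- exact: smooth_y_power.
congr form; apply/funext => x; rewrite !scale_scalar_mx expr0 mulr1 miwa_inv//.
by rewrite mulrA mulVf// mul1r.
Qed.

Lemma form_cauchy_y (S : bmatrix R p) k :
  form v (fun x => chi_block S k x%:C) (cauchy p z) =
  z^-1 *: \sum_(m < k.+1) S k m *m gram (miwa2m z v) m 0.
Proof.
have sc : smooth_y (cauchy p z).
  by apply: smooth_y_scalar; exact: smooth_cauchy_y.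
have zn0 := nonreal_neq0 z0.
have -> : (fun y : R => chi_block S k y%:C) =
    fun y : R => \sum_(m < k.+1) S k m *m (y%:C ^+ m)%:M.
  by apply/funext => y; rewrite chi_blockE.
rewrite form_suml//; last first.
  move=> m i j; apply: (smooth_ext (g := fun a => S k m i j * a.1%:C ^+ m)).
    by move=> a; rewrite mul_mx_scalar mxE mulrC.
  by apply: smooth_scale; apply: smooth_exprn; exact: smooth_fst.
rewrite scaler_sumr; apply: eq_bigr => m _.
rewrite (form_mull tv (S k m) (smooth_x_power m) sc) scalemxAr; congr (_ *m _).
rewrite /gram /miwa2m (@form_kmul_y (fun x => (1 - x%:C / z)^-1)); last 3 first.
- exact: smooth_miwa_inv_y.
- exact: smooth_x_power.
- exact: smooth_y_power.
rewrite -form_Zr; last 2 first.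
- exact: smooth_x_power.
- apply: (@smooth_y_scale _ _ (fun x => (1 - x%:C / z)^-1)).
    exact: smooth_miwa_inv_y.
  exact: smooth_y_power.
congr form; apply/funext => x; rewrite !scale_scalar_mx expr0 mulr1 miwa_inv//.
by rewrite mulrA mulVf// mul1r.
Qed.

Hypothesis qv : quasidefinite v.

Lemma P1_tau n : quasidefinite (miwa1m z v) ->
  P1 v n z = z ^+ n *: tau1 n (miwa1m z v) v.
Proof.
move=> q'; have gb' := gb_factorsP q'; rewrite gram_miwa1m in gb'.
by rewrite tau1E; exact: shift_polynomial (nonreal_neq0 z0) qv (gb_factorsP qv) gb'.
Qed.

Lemma C2_tau l : quasidefinite (miwa1p z v) ->
  (C2 v l z)^T = z ^- l.+1 *: (invmx (tau1 l.+1 v (miwa1p z v)) *m Hblk v l).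
Proof.
move=> q'; have gb := gb_factorsP qv; rewrite gram_miwa1p in gb.
have zn0 := nonreal_neq0 z0.
have := shift_cauchy l zn0 q' (gb_factorsP q') gb; rewrite -tau1E => <-.
rewrite /C2 trmxK /P2 form_cauchy_x -scalemxAr scalerA mulKmx; last first.
  rewrite tau1E; apply: ratio_prod_unit => m; exact: Hblk_unit.
by congr (_ *: _); rewrite exprSr invfM mulrAC mulVf ?mul1r// expf_neq0.
Qed.

Lemma P2_tau n : quasidefinite (miwa2p z v) ->
  (P2 v n z)^T = z ^+ n *: invmx (tau2 n (miwa2p z v) v).
Proof.
move=> q'; have gb' := gauss_borel_btr (gb_factorsP q'); rewrite gram_miwa2p in gb'.
rewrite /P2 (shift_polynomial n (nonreal_neq0 z0) (nonsingular_btr qv)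
  (gauss_borel_btr (gb_factorsP qv)) gb') linearZ /=; congr (_ *: _).
have E := ratio_prod_tr n (fun m => Hblk_unit m q') (fun m => Hblk_unit m qv).
have [_ u] := mulmx1_unit E.
by rewrite tau2E -[LHS](mulmxK u) E mul1mx.
Qed.

Lemma C1_tau k : quasidefinite (miwa2m z v) ->
  C1 v k z = z ^- k.+1 *: (Hblk v k *m tau2 k.+1 v (miwa2m z v)).
Proof.
move=> q'; have gb := gauss_borel_btr (gb_factorsP qv); rewrite gram_miwa2m in gb.
have zn0 := nonreal_neq0 z0.
have := shift_cauchy k zn0 (nonsingular_btr q') (gauss_borel_btr (gb_factorsP q')) gb.
move=> /(congr1 trmx); rewrite trmxK => <-.
have E := ratio_prod_tr k.+1 (fun m => Hblk_unit m qv) (fun m => Hblk_unit m q').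
have trZ c (X : M) : (c *: X)^T = c *: X^T by rewrite linearZ.
rewrite trZ -scalemxAl trmx_mul -mulmxA tau2E E mulmx1 scalerA.
rewrite /C1 /P1 form_cauchy_y.
have -> : z ^- k.+1 * z ^+ k = z^-1.
  by rewrite exprSr invfM mulrAC mulVf ?mul1r// expf_neq0.
congr (_ *: _); rewrite raddf_sum; apply: eq_bigr => m _.
by rewrite /= trmx_mul trmxK /btr trmxK.
Qed.

End Shifts.

Lemma wave_tau_x (H T W U : M) (c d e : C) : H \in unitmx ->
  (c * (e * d)) *: (T *m W *m U) =
  (c *: ((d *: T) *m W *m (e *: (U *m H)))) *m invmx H.
Proof.
move=> uH; rewrite -!scalemxAl -!scalemxAr -!scalemxAl !scalerA -!mulmxA.
by rewrite (mulmxV uH) mulmx1 -mulrA [d * e]mulrC.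
Qed.

Lemma wave_tau_y (H T W U : M) (c d e : C) : H \in unitmx ->
  (d * e * c) *: (T *m W *m U) =
  invmx H *m (c *: ((d *: (H *m T)) *m W *m (e *: U))).
Proof.
move=> uH; rewrite -!scalemxAl -!scalemxAr !scalerA !mulmxA.
by rewrite (mulVmx uH) mul1mx -[c * d * e]mulrA [c * _]mulrC.
Qed.

End TauRatios.

(** * The bilinear identities *)

Theorem theorem12 (R : realType) (p : nat) (u uh : kernelM R p.+1)
    (WC WG : {poly 'M[R[i]]_p.+1})
    (hu : generalized_kernel u) (huh : generalized_kernel uh)
    (hWC : WC \is monic)
    (hWG : sigma WG `&` [set y%:C | y in supp_y u] = set0)
    (hGU : geronimus_uvarov u uh WC WG)
    (r1 r2 : R) (hr1 : rad_x u < r1) (hr2 : rad_y u < r2)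
    (t t' : time R)
    (hqd : quasidefinite (flow t u)) (hqdh : quasidefinite (flow t' uh))
    (k l : nat) :
  [/\ circint r1 (fun z =>
        Psi1 uh k t' z *m meval WC z *m (Psi1s u l t z)^T) =
      circint r2 (fun z =>
        Psi2 uh k t' z *m meval WG z *m (Psi2s u l t z)^T),
      circint r1 (fun z => cexp (t1 t' z - t1 t z) *:
        (P1 (flow t' uh) k z *m meval WC z *m (C2 (flow t u) l z)^T)) =
      circint r2 (fun z => cexp (t2 t' z - t2 t z) *:
        (C1 (flow t' uh) k z *m meval WG z *m (P2 (flow t u) l z)^T)) &
      (forall z : R[i], `|z| = r1%:C ->
         quasidefinite (miwa1m z (flow t' uh)) /\
         quasidefinite (miwa1p z (flow t u))) ->
      (forall z : R[i], `|z| = r2%:C ->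
         quasidefinite (miwa2p z (flow t u)) /\
         ((forall y, supp_y uh y -> z != y%:C) ->
            quasidefinite (miwa2m z (flow t' uh)))) ->
      circint r1 (fun z =>
        (cexp (t1 t' z - t1 t z) * z ^ (k%:Z - l%:Z - 1)) *:
        (tau1 k (miwa1m z (flow t' uh)) (flow t' uh) *m meval WC z
           *m invmx (tau1 l.+1 (flow t u) (miwa1p z (flow t u)))))
        *m Hblk (flow t u) l =
      Hblk (flow t' uh) k *m
      circint r2 (fun z =>
        (z ^ (l%:Z - k%:Z - 1) * cexp (t2 t' z - t2 t z)) *:
        (tau2 k.+1 (flow t' uh) (miwa2m z (flow t' uh)) *m meval WG z
           *m invmx (tau2 l (miwa2p z (flow t u)) (flow t u))))].
Proof.
have wx := wave_integral_x uh WC hu hr1 t t' k l.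
have wy := wave_integral_y hu huh hGU hr2 t t' k l.
split.
- rewrite (has_mxint_circint (baker_integral_x uh WC hu hr1 t t' k l)).
  by rewrite (has_mxint_circint (baker_integral_y hu huh hGU hr2 t t' k l)).
- by rewrite (has_mxint_circint wx) (has_mxint_circint wy).
move=> q1 q2.
have r10 : 0 < r1 by exact: le_lt_trans (rad_x_ge0 hu) hr1.
have r20 : 0 < r2 by exact: le_lt_trans (rad_y_ge0 hu) hr2.
have flow_tame (s : time R) (v : kernelM R p.+1) : generalized_kernel v ->
    tame_kernel (flow s v).
  move=> gv; apply: tame_kmul; first exact: kernel_tame.
  apply: (smooth_ext (g := fun a => cexp (t1 s a.1%:C) * cexp (- t2 s a.2%:C))).
    by move=> a; rewrite cexpD.
  by apply: smooth_mul; [exact: smooth_t1|exact: smooth_t2].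
have tu := flow_tame t u hu; have tuh := flow_tame t' uh huh.
pose H := Hblk (flow t u) l; pose Hh := Hblk (flow t' uh) k.
have uH : H \in unitmx by exact: Hblk_unit.
have uHh : Hh \in unitmx by exact: Hblk_unit.
have zpow z n m : z != 0 :> R[i] -> z ^ (n%:Z - m%:Z - 1) = z ^- m.+1 * z ^+ n.
  move=> z0; rewrite -addrA -opprD -PoszD addn1 expfzDr// -exprnP -exprnN.
  by rewrite mulrC.
have Ix := has_mxintMr (invmx H) wx.
have Iy := has_mxintMl (invmx Hh) wy.
rewrite (has_mxint_circint (has_mxint_ext r10 _ Ix)); last first.
  move=> z zr z0; have [qm qp] := q1 z zr; have zn0 := nonreal_neq0 z0.
  rewrite (P1_tau _ _ _ _ qm)// (C2_tau _ _ _ _ qp)// zpow//.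
  exact: wave_tau_x.
rewrite (has_mxint_circint (has_mxint_ext r20 _ Iy)); last first.
  move=> z zr z0; have [qp qm] := q2 z zr; have zn0 := nonreal_neq0 z0.
  have {}qm : quasidefinite (miwa2m z (flow t' uh)).
    by apply: qm => y _; apply: contraNneq z0 => ->.
  rewrite (P2_tau _ _ _ _ qp)// (C1_tau _ _ _ _ qm)// zpow//.
  exact: wave_tau_y.
by rewrite (mulmxKV uH) (mulKVmx uHh).
Qed.
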